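(* Let $\ell\in\mathbb{N}$. For each $\mathsf{A}\in\mathfrak{G}_\ell$, $$\mu(\mathsf{A})=\int_{\mathsf{I}(\ell)}\nu_{\mathbb{F}(\ell)}(d\mathsf{i})\,\lambda_{f_{\ell,\mathsf{i}}}^{\mathfrak{u}}(\mathsf{A}),$$ where $\lambda_{f_{\ell,\mathsf{i}}}^{\mathfrak{u}}=\lambda_{f_{\ell,\mathsf{i}}}\circ\mathfrak{u}_{\ell,\mathsf{i}}^{-1}$ and, for $\mathsf{i}=\sum_n\delta_{i_n}$, $\mathfrak{u}_{\ell,\mathsf{i}}:\prod_n\mathcal{B}_{\ell,i_n}\to\mathsf{S}$ is the unlabel map $\mathfrak{u}_{\ell,\mathsf{i}}((s_n)_n)=\sum_n\delta_{s_n}$.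
   Context: **Space and process.** $S$ is a locally compact Hausdorff space with countable basis, and $\lambda$ is a Radon measure on $S$ with $\lambda(\mathcal{O})>0$ for every non-empty open $\mathcal{O}\subset S$. The configuration space $\mathsf{S}$ over $S$ is the set of measures $\mathsf{s}=\sum_i\delta_{s_i}$ with $s_i\in S$ and $\mathsf{s}(K)<\infty$ for every compact $K$, with the vague topology. A point process on $S$ is a probability measure on $(\mathsf{S},\mathfrak{B}(\mathsf{S}))$. A symmetric function $\rho^m$ on $S^m$ is the $m$-point correlation function of a point process $\mu$ with respect to $\lambda$ if $$\int_{\mathsf{S}}\prod_{i=1}^{j}\frac{\mathsf{s}(A_i)!}{(\mathsf{s}(A_i)-k_i)!}\,\mu(d\mathsf{s})=\int_{A_1^{k_1}\times\cdots\times A_j^{k_j}}\rho^m(\mathbf{x})\,\lambda^m(d\mathbf{x})$$ for all disjoint $A_1,\ldots,A_j\in\mathfrak{B}(S)$ and $k_1,\ldots,k_j\in\mathbb{N}$ with $k_1+\cdots+k_j=m$, where a factor is $0$ if $\mathsf{s}(A_i)-k_i<0$. For an $m\times m$ matrix $A=(a_{i,j})$ and real $\alpha$, $\det_\alpha A=\sum_{\sigma\in\mathfrak{S}_m}\alpha^{m-\nu(\sigma)}\prod_{i=1}^m a_{i,\sigma(i)}$, where $\nu(\sigma)$ is the number of cycles of $\sigma$. Given a measurable kernel $\mathsf{K}:S\times S\to\mathbb{C}$, the $\alpha$-determinantal point process associated with $(\mathsf{K},\lambda)$ is the point process with $m$-point correlation functions $\rho^m(\mathbf{x})=\det_\alpha[\mathsf{K}(x_i,x_j)]_{i,j=1}^m$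 with respect to $\lambda$, for all $m$. The same definitions are used for a countable discrete space with counting measure. **Standing assumptions on $(\mathsf{K},\alpha)$.** $\mathsf{K}$ is also regarded as the operator $\mathsf{K}f(x)=\int_S\mathsf{K}(x,y)f(y)\lambda(dy)$ on $L^2(S,\lambda)$. Assume $\alpha\in\{2/m;m\in\mathbb{N}\}\cup\{-1/m;m\in\mathbb{N}\}$; $\mathsf{K}$ is Hermitian symmetric and of locally trace class (that is, $1_A\mathsf{K}1_A$ is trace class for every compact $A$); $\mathrm{Spec}(\mathsf{K})\subset[0,\infty)$, and $\mathrm{Spec}(\mathsf{K})\subset[0,-1/\alpha]$ if $\alpha<0$. As usual, the version of the kernel is such that $\int_A\mathsf{K}(x,x)\lambda(dx)=\mathrm{Tr}(1_A\mathsf{K}1_A)$ for relatively compact measurable $A$. Then the $\alpha$-determinantal point process $\mu$ associated with $(\mathsf{K},\lambda)$ exists and is unique. **Partitions.** A $\lambda$-partition of $S$ is a countable collection of disjoint, relatively compact, measurable sets of positive $\lambda$-measure with union $S$. Assume given $\lambda$-partitions $\Delta(\ell)=\{\mathcal{A}_{\ell,i}\}_{i\in I(\ell)}$, $\ell\in\mathbb{N}$, such that every cell of $\Delta(\ell+1)$ is contained in a cell of $\Delta(\ell)$, each cell of $\Delta(\ell)$ contains exactly two cells of $\Delta(\ell+1)$, and, with $\mathfrak{F}_\ell=\sigma[\mathcal{A}_{\ell,i};i\in I(\ell)]$, $\sigma[\bigcup_\ell\mathfrak{F}_\ell]=\mathfrak{B}(S)$. The index sets are $I(\ell)=I\times\{0,1\}^{\ell-1}$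 with $I=I(1)$, labelled so that for $\ell<\ell'$, $i\in I(\ell)$, $i'\in I(\ell')$: $\mathcal{A}_{\ell,i}\supset\mathcal{A}_{\ell',i'}$ iff $i=(j_1,\ldots,j_\ell)$ and $i'=(j_1,\ldots,j_\ell,\ldots,j_{\ell'})$. **Basis.** Let $\mathbb{I}=I\cup\bigcup_{\ell\ge2}\{(j_1,\ldots,j_\ell)\in I(\ell);j_\ell=0\}$, with $\mathrm{rank}(i)=\ell$ for $i\in I(\ell)$. For rank $1$ put $\mathcal{B}_i=\mathcal{A}_{1,i}$; for $i=(j_1,\ldots,j_\ell)$ with $\ell\ge2$ put $\mathcal{B}_i=\mathcal{A}_{\ell-1,(j_1,\ldots,j_{\ell-1})}$. Fix an orthonormal basis $\{f_i\}_{i\in\mathbb{I}}$ of $L^2(S,\lambda)$ of real-valued functions with $\sigma[f_i;i\in\mathbb{I},\mathrm{rank}(i)=\ell]=\mathfrak{F}_\ell$ for each $\ell$, $\mathrm{supp}(f_i)=\{f_i\ne0\}=\mathcal{B}_i$, and $f_i=1_{\mathcal{A}_{1,i}}/\sqrt{\lambda(\mathcal{A}_{1,i})}$ for rank $1$. **Level $\ell$ objects.** $\mathbb{I}(\ell)$ is the disjoint union of $I(\ell)$ (elements of rank $1$) and, for $r\ge2$, the set of $i=(\mathbf{j}_\ell,j_{\ell+1},\ldots,j_{\ell+r-1})\in I(\ell)\times\{0,1\}^{r-1}$ with $j_{\ell+r-1}=0$ (elements of rank $r$), where $\mathbf{j}_\ell=(j_1,\ldots,j_\ell)\in I(\ell)$.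 For $i$ of rank $1$: $f_{\ell,i}=1_{\mathcal{A}_{\ell,i}}/\sqrt{\lambda(\mathcal{A}_{\ell,i})}$ and $\mathcal{B}_{\ell,i}=\mathcal{A}_{\ell,i}$. For $i$ of rank $r\ge2$, with $j=(j_1,\ldots,j_{\ell+r-1})\in\mathbb{I}$ the flattened sequence: $f_{\ell,i}=f_j$ and $\mathcal{B}_{\ell,i}=\mathcal{B}_j$. Then $\mathbb{F}(\ell)=\{f_{\ell,i}\}_{i\in\mathbb{I}(\ell)}$ is an orthonormal basis of $L^2(S,\lambda)$ with $\mathrm{supp}(f_{\ell,i})=\mathcal{B}_{\ell,i}$. Define $$\mathsf{K}_{\mathbb{F}(\ell)}(i,j)=\int_{S\times S}\mathsf{K}(x,y)f_{\ell,i}(x)f_{\ell,j}(y)\,\lambda(dx)\lambda(dy),\quad i,j\in\mathbb{I}(\ell).$$ Let $\lambda_{\mathbb{I}(\ell)}$ be the counting measure on $\mathbb{I}(\ell)$ and let $\nu_{\mathbb{F}(\ell)}$ be the $\alpha$-determinantal point process on $\mathbb{I}(\ell)$ associated with $(\mathsf{K}_{\mathbb{F}(\ell)},\lambda_{\mathbb{I}(\ell)})$ (it exists and is unique). **Further notation.** $\mathfrak{G}_\ell=\sigma[\{\mathsf{s}\in\mathsf{S};\mathsf{s}(\mathcal{A}_{\ell,i})=n\};i\in I(\ell),n\in\mathbb{N}]$. $\mathsf{I}(\ell)$ is the configuration space over the discrete set $\mathbb{I}(\ell)$; its elements $\mathsf{i}=\sum_n\delta_{i_n}$ may have multiple points.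 For $i\in\mathbb{I}(\ell)$ let $\lambda_{f_{\ell,i}}(dx)=|f_{\ell,i}(x)|^2\lambda(dx)$, a probability measure with $\lambda_{f_{\ell,i}}(\mathcal{B}_{\ell,i})=1$; for $\mathsf{i}=\sum_n\delta_{i_n}$ let $\lambda_{f_{\ell,\mathsf{i}}}=\prod_n\lambda_{f_{\ell,i_n}}$ on $\prod_n\mathcal{B}_{\ell,i_n}$ (different enumerations of $\mathsf{i}$ are identified by permuting coordinates). For the empty configuration $\mathsf{i}=0$ the product is a one-point space and its image under the unlabel map is the zero configuration. The unlabel map into $\mathsf{S}$ is understood for $\nu_{\mathbb{F}(\ell)}$-a.e. $\mathsf{i}$ and $\lambda_{f_{\ell,\mathsf{i}}}$-almost surely.
   Formalization: The formal statement assumes explicitly that, for ν-a.e. i and almost surely under the product law, the sum of the point masses at the s_n is a configuration in S (finite on compact sets); without it, for partitions that are not locally finite, the unlabel map may fail to land in S. *)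

(* Defs.v *)
From HB Require Import structures.
From mathcomp Require Import all_boot all_order all_algebra all_fingroup.
From mathcomp Require Import finmap.
From mathcomp Require Import all_classical all_reals all_analysis.
From mathcomp Require Import complex.

Set Implicit Arguments.
Unset Strict Implicit.
Unset Printing Implicit Defensive.
Import Order.TTheory GRing.Theory Num.Theory.
Import numFieldNormedType.Exports.

Local Open Scope classical_set_scope.
Local Open Scope ring_scope.
Local Open Scope complex_scope.

(* Levels are numbered from 0: level l below is the level
   ell = l + 1 of the mathematical text. Measurable types are pointed in this
   library, so the spaces considered are nonempty. *)

#[short(type="pcountType")]
HB.structure Definition PointedCountable := {T of Pointed T & Countable T}.

Definition borel (T : ptopologicalType) := g_sigma_algebraType (@open T).
HB.instance Definition _ (T : ptopologicalType) :=
  Measurable.copy (borel T) (g_sigma_algebraType (@open T)).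

Record radon (R : realType) (T : ptopologicalType)
    (lam : {measure set (borel T) -> \bar R}) : Prop := Radon {
  radon_compact : forall C : set T, compact C -> (lam C < +oo)%E ;
  radon_outer : forall B : set T, measurable (B : set (borel T)) ->
    lam B = ereal_inf [set lam O | O in [set O : set T | open O /\ B `<=` O]] ;
  radon_inner : forall O : set T, open O ->
    lam O = ereal_sup [set lam C | C in [set C : set T | compact C /\ C `<=` O]] }.

(* lam^m, by iterated sections; as for [\x], it is defined for any set function
   and is the product measure when lam is sigma-finite. *)
Fixpoint pow_measure (R : realType) d (T : measurableType d)
    (lam : set T -> \bar R) (m : nat) : set (m.-tuple T) -> \bar R :=
  match m with
  | 0%N => fun B => \d_([tuple] : 0.-tuple T) B
  | n.+1 => fun B =>
      (\int[lam]_x pow_measure lam [set t : n.-tuple T | B [tuple of x :: t]])%E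
  end.

Definition is_sum_dirac (R : realType) (T : ptopologicalType) (J : countType)
    (x : J -> T) (s : {measure set (borel T) -> \bar R}) :=
  forall B : set (borel T), measurable B ->
    s B = (\esum_(j in [set: J]) \d_(x j : borel T) B)%E.

Section config.
Variables (R : realType) (T : ptopologicalType).

Record config := Config {
  config_measure :> {measure set (borel T) -> \bar R} ;
  config_atoms : exists (J : countType) (x : J -> T),
    is_sum_dirac x config_measure ;
  config_finite : forall C : set T, compact C ->
    (config_measure C < +oo)%E }.

Let zero_measure : {measure set (borel T) -> \bar R} := mzero.

Let zero_atoms : exists (J : countType) (x : J -> T),
  is_sum_dirac x zero_measure.
Proof.
exists void, (fun v : void => match v with end) => B mB.
by rewrite esum1// => -[].
Qed.

Let zero_finite (C : set T) : compact C -> (zero_measure C < +oo)%E.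
Proof. by move=> _; rewrite /zero_measure /= /mzero ltry. Qed.

Definition config0 := Config zero_atoms zero_finite.

HB.instance Definition _ := gen_eqMixin config.
HB.instance Definition _ := gen_choiceMixin config.
HB.instance Definition _ := isPointed.Build config config0.

Definition Cc := {f : T -> R | continuous f /\ compact (closure [set x | f x != 0])}.

(* the vague topology is the initial topology of the maps s |-> \int f ds *)
Definition vague_eval (s : config) : prod_topology (fun _ : Cc => R) :=
  fun f => fine (\int[s]_(x in [set: borel T]) (sval f x)%:E)%E.

HB.instance Definition _ := Topological.copy config (initial_topology vague_eval).

End config.

(* x (x - 1) ... (x - k + 1); for a natural number x this is x!/(x - k)! if
   k <= x and 0 otherwise. *)
Definition falling (R : realType) (x : \bar R) (k : nat) : \bar R :=
  (\prod_(j < k) (x - (j%:R)%:E))%E.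

(* A_1^{k_1} x ... x A_j^{k_j} *)
Definition power_box (T : Type) (j m : nat) (A : 'I_j -> set T) (k : 'I_j -> nat) :
    set (m.-tuple T) :=
  [set t | forall p : 'I_m,
    nth set0 (flatten [seq nseq (k i) (A i) | i <- enum 'I_j]) p (tnth t p)].

Record is_correlation (R : realType) (T : ptopologicalType)
    (mu : probability (borel (config R T)) R) (lam : set (borel T) -> \bar R)
    (m : nat) (rho : m.-tuple (borel T) -> R) : Prop := IsCorrelation {
  correlation_sym : forall (t : m.-tuple (borel T)) (s : 'S_m),
    rho [tuple tnth t (s i) | i < m] = rho t ;
  correlation_measurable : measurable_fun [set: m.-tuple (borel T)] rho ;
  correlation_moment : forall (j : nat) (A : 'I_j -> set (borel T))
      (k : 'I_j -> nat),
    (forall i, measurable (A i)) -> trivIset setT A -> (\sum_i k i)%N = m ->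
    (\int[mu]_s \prod_(i < j) falling ((s : config R T) (A i)) (k i) =
     \int[pow_measure lam (m := m)]_(t in power_box A k) (rho t)%:E)%E }.

Definition det_alpha (R : realType) (alpha : R) (m : nat) (M : 'M[R[i]]_m) : R[i] :=
  \sum_(s : 'S_m) (alpha ^+ (m - #|porbits s|))%:C * \prod_i M i (s i).

Definition alpha_det_process (R : realType) (T : ptopologicalType)
    (mu : probability (borel (config R T)) R) (lam : set (borel T) -> \bar R)
    (K : T -> T -> R[i]) (alpha : R) :=
  forall m : nat, exists2 rho : m.-tuple (borel T) -> R,
    is_correlation mu lam rho &
    forall t, (rho t)%:C = det_alpha alpha (\matrix_(i, j) K (tnth t i) (tnth t j)).

Section complex_L2.
Variables (R : realType) (d : measure_display) (T : measurableType d).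
Implicit Types (mu : set T -> \bar R) (g h : T -> R[i]).

Definition cmeasurable g :=
  measurable_fun [set: T] (fun x => complex.Re (g x)) /\
  measurable_fun [set: T] (fun x => complex.Im (g x)).

Definition cintegrable mu (D : set T) g :=
  mu.-integrable D (fun x => (complex.Re (g x))%:E) /\
  mu.-integrable D (fun x => (complex.Im (g x))%:E).

Definition cintegral mu (D : set T) g : R[i] :=
  fine (\int[mu]_(x in D) (complex.Re (g x))%:E)%E +i*
  fine (\int[mu]_(x in D) (complex.Im (g x))%:E)%E.

Definition sqnorm mu g : \bar R :=
  (\int[mu]_x (complex.Re (g x) ^+ 2 + complex.Im (g x) ^+ 2)%:E)%E.

Definition L2 mu g := cmeasurable g /\ (sqnorm mu g < +oo)%E.

(* linear in the first argument *)
Definition inner mu g h : R[i] := cintegral mu setT (fun x => g x * conjc (h x)).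

Definition orthonormal mu (J : eqType) (D : set J) (e : J -> T -> R[i]) :=
  (forall j, D j -> L2 mu (e j)) /\
  (forall i j, D i -> D j -> inner mu (e i) (e j) = (i == j)%:R).

Definition orthonormal_basis mu (J : eqType) (e : J -> T -> R[i]) :=
  orthonormal mu setT e /\
  (forall g, L2 mu g -> (forall j, inner mu g (e j) = 0) ->
     {ae mu, forall x, g x = 0}).

Variables (mu : set T -> \bar R) (K : T -> T -> R[i]).

Definition kop g : T -> R[i] := fun x => cintegral mu setT (fun y => K x y * g y).

Definition kop_dom g :=
  [/\ L2 mu g, {ae mu, forall x, cintegrable mu setT (fun y => K x y * g y)} &
      L2 mu (kop g)].

(* K - z is a bijection from its domain onto L^2 with bounded inverse *)
Definition resolvent_set : set R[i] := [set z |
  (exists C : R, forall h, kop_dom h ->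
     (sqnorm mu h <= C%:E * sqnorm mu (fun x => kop h x - z * h x)%R)%E) /\
  (forall g, L2 mu g -> exists2 h, kop_dom h &
     {ae mu, forall x, kop h x - z * h x = g x})].

Definition spectrum : set R[i] := ~` resolvent_set.

(* K = sum_n s_n <., u_n> v_n (singular value decomposition) with summable
   singular values s_n; sum_n s_n is the trace norm. *)
Definition trace_class :=
  (forall g, L2 mu g -> kop_dom g) /\
  exists (s : nat -> R) (u v : nat -> T -> R[i]),
    [/\ (forall n, 0 <= s n), (\sum_(n <oo) (s n)%:E < +oo)%E,
        orthonormal mu [set n | s n != 0] u, orthonormal mu [set n | s n != 0] v &
        forall g, L2 mu g ->
          (fun N => sqnorm mu (fun x => kop g x -
             \sum_(n < N) (s n)%:C * inner mu g (u n) * v n x)%R) @ \oo --> 0%E].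

End complex_L2.

Definition has_sum (R : realType) (J : choiceType) (z : J -> R[i]) (w : R[i]) :=
  forall eps : R, 0 < eps -> exists F0 : {fset J}, forall F : {fset J},
    (F0 `<=` F)%fset -> `|\sum_(j <- F) z j - w| < eps%:C.

Definition is_trace (R : realType) d (T : measurableType d)
    (mu : set T -> \bar R) (K : T -> T -> R[i]) (w : R[i]) :=
  forall (J : countType) (e : J -> T -> R[i]), orthonormal_basis mu e ->
    has_sum (fun j => inner mu (kop mu K (e j)) (e j)) w.

(* the kernel of 1_A K 1_A *)
Definition restr_kernel (R : realType) (T : Type) (A : set T) (K : T -> T -> R[i])
    : T -> T -> R[i] :=
  fun x y => (\1_A x)%:C * K x y * (\1_A y)%:C.

Record kernel_assumptions (R : realType) (S : ptopologicalType)
    (lam : {measure set (borel S) -> \bar R})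
    (K : S -> S -> R[i]) (alpha : R) : Prop := KernelAssumptions {
  kernel_measurable :
    @cmeasurable R _ (borel S * borel S)%type (fun p => K p.1 p.2) ;
  kernel_alpha : exists2 m : nat, (0 < m)%N &
    alpha = 2 / m%:R \/ alpha = - 1 / m%:R ;
  kernel_hermitian : forall x y, K x y = conjc (K y x) ;
  kernel_trace_class : forall A : set S, compact A ->
    @trace_class R _ (borel S) lam (restr_kernel A K) ;
  kernel_spectrum_ge0 :
    @spectrum R _ (borel S) lam K `<=` [set r%:C | r in [set r : R | 0 <= r]] ;
  kernel_spectrum_le : alpha < 0 ->
    @spectrum R _ (borel S) lam K `<=`
      [set r%:C | r in [set r : R | 0 <= r <= - 1 / alpha]] ;
  kernel_version : forall A : set (borel S),
    measurable A -> precompact (A : set S) ->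
    cintegrable lam A (fun x => K x x) /\
    @is_trace R _ (borel S) lam (restr_kernel A K)
      (cintegral lam A (fun x => K x x)) }.

(* The cell of (i, w) has level [size w]: I(l + 1) is the set of (i, w) with
   size w = l. *)
Definition level_cells (I S : Type) (A : I -> seq bool -> set S) (l : nat) :
    set (set S) :=
  [set A p.1 p.2 | p in [set p : I * seq bool | size p.2 = l]].

(* That a cell contains exactly two cells of the next level follows from
   [cells_nested], [cells_disjoint] and [cells_pos]. *)
Record nested_partitions (R : realType) (S : ptopologicalType) (I : countType)
    (lam : {measure set (borel S) -> \bar R})
    (A : I -> seq bool -> set S) : Prop := NestedPartitions {
  cells_measurable : forall i w, measurable (A i w : set (borel S)) ;
  cells_precompact : forall i w, precompact (A i w) ;
  cells_pos : forall i w, (0 < lam (A i w))%E ;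
  cells_disjoint : forall l : nat,
    trivIset [set p : I * seq bool | size p.2 = l] (fun p => A p.1 p.2) ;
  cells_cover : forall l : nat, \bigcup_(B in level_cells A l) B = [set: S] ;
  cells_nested : forall i w i' w', (size w < size w')%N ->
    A i' w' `<=` A i w <-> i = i' /\ prefix w w' ;
  cells_generate :
    <<s \bigcup_l <<s level_cells A l >> >> = @measurable _ (borel S) }.

(* The index set of the basis: rank 1 is w = [::]; for rank >= 2 the last bit is
   0. The rank of (i, w) is [size w + 1]. *)
Definition basis_index (I : countType) := {p : I * seq bool | ~~ last false p.2}.

(* A_{1,i} for w = [::], and the parent cell of (i, w) otherwise *)
Definition basis_supp (I S : Type) (A : I -> seq bool -> set S) (i : I)
    (w : seq bool) : set S :=
  A i (take (size w).-1 w).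

Definition normalized_indic (R : realType) (S : ptopologicalType)
    (lam : {measure set (borel S) -> \bar R}) (B : set S) : S -> R :=
  fun x => \1_B x / Num.sqrt (fine (lam B)).

(* Only the values f i w with (i, w) in [basis_index I] are used. *)
Record adapted_basis (R : realType) (S : ptopologicalType) (I : countType)
    (lam : {measure set (borel S) -> \bar R})
    (A : I -> seq bool -> set S) (f : I -> seq bool -> S -> R) : Prop :=
  AdaptedBasis {
  basis_onb : @orthonormal_basis R _ (borel S) lam (basis_index I)
    (fun j x => (f (val j).1 (val j).2 x)%:C) ;
  basis_sigma : forall l : nat,
    <<s [set C : set S | exists (j : basis_index I) (B : set R),
          [/\ size (val j).2 = l, measurable B &
              C = f (val j).1 (val j).2 @^-1` B]] >> =
    <<s level_cells A l >> ;
  basis_support : forall j : basis_index I,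
    [set x | f (val j).1 (val j).2 x != 0] = basis_supp A (val j).1 (val j).2 ;
  basis_rank1 : forall i, f i [::] = normalized_indic lam (A i [::]) }.

(* the pairs (j_l, w) with j_l in the l-th index set and w as in [basis_index] *)
Definition lvl_index (I : pcountType) (l : nat) :=
  {p : (I * l.-tuple bool) * seq bool | ~~ last false p.2}.
HB.instance Definition _ (I : pcountType) (l : nat) :=
  Countable.on (lvl_index I l).
HB.instance Definition _ (I : pcountType) (l : nat) :=
  isPointed.Build (lvl_index I l) (exist _ ((point, [tuple of nseq l false]), [::]) isT).

Definition lvl_space (I : pcountType) (l : nat) := discrete_topology (lvl_index I l).
HB.instance Definition _ (I : pcountType) (l : nat) :=
  DiscreteTopology.on (lvl_space I l).
HB.instance Definition _ (I : pcountType) (l : nat) :=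
  Pointed.copy (lvl_space I l) (lvl_index I l).

Section level.
Variables (R : realType) (S : ptopologicalType) (I : pcountType).
Variable lam : {measure set (borel S) -> \bar R}.
Variables (A : I -> seq bool -> set S) (f : I -> seq bool -> S -> R) (l : nat).

Definition lvl_fun (j : lvl_index I l) : S -> R :=
  let: (i, w, v) := val j in
  if v is [::] then normalized_indic lam (A i w) else f i (w ++ v).

Definition lvl_supp (j : lvl_index I l) : set S :=
  let: (i, w, v) := val j in
  if v is [::] then A i w else basis_supp A i (w ++ v).

Definition lvl_kernel (K : S -> S -> R[i]) (i j : lvl_space I l) : R[i] :=
  @cintegral R _ (borel S * borel S)%type (lam \x lam)%E setT
    (fun p => K p.1 p.2 * (lvl_fun i p.1)%:C * (lvl_fun j p.2)%:C).

Definition lvl_law (j : lvl_index I l) (E : set (borel S)) : \bar R :=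
  (\int[lam]_(x in E) (lvl_fun j x ^+ 2)%:E)%E.

Definition cell_count_sigma : set (set (config R S)) :=
  <<s [set C | exists (i : I) (w : l.-tuple bool) (n : nat),
        C = [set s : config R S | s (A i w : set (borel S)) = (n%:R)%:E]] >>.

End level.

Definition cylinders (J : countType) (S : ptopologicalType) : set (set (J -> S)) :=
  [set C | exists (j : J) (E : set (borel S)),
     measurable E /\ C = [set x | E (x j)]].
Definition prod_space (J : countType) (S : ptopologicalType) :=
  g_sigma_algebraType (@cylinders J S).
HB.instance Definition _ (J : countType) (S : ptopologicalType) :=
  Measurable.copy (prod_space J S) (g_sigma_algebraType (@cylinders J S)).

(* P is the product of the probability measures law j; this determines P. For
   empty J, S^J is a one-point space. *)
Definition is_product_law (R : realType) (J : countType) (S : ptopologicalType)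
    (P : probability (prod_space J S) R) (law : J -> set (borel S) -> \bar R) :=
  forall (F : {fset J}) (E : J -> set (borel S)), (forall j, measurable (E j)) ->
    P [set x | forall j, j \in F -> E j (x j)] = (\prod_(j <- F) law j (E j))%E.

(* the preimage of AA under the unlabel map (x_j)_j |-> sum_j delta_{x_j} defined
   on the product of the B j, where that sum is a configuration *)
Definition unlabel_preimage (R : realType) (S : ptopologicalType) (J : countType)
    (B : J -> set S) (AA : set (config R S)) : set (prod_space J S) :=
  [set x : J -> S | (forall j, B j (x j)) /\
     exists2 s : config R S, AA s & is_sum_dirac x s].

(* Main.v *)
(* The event AA depends only on the numbers of points in the cells of the
   level, so both sides are determined by the joint law of these numbers. On
   the right, the point attached to a label j lies almost surely in the cell
   given by the first component of j; the number of points in the cell A_c is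
   therefore the number of labels in the set C_c of the j with first component
   c, and it remains to compare the laws of (s(A_c))_c and (ii(C_c))_c.

   On a finite union of cells, the trace class operator has a kernel
   k(x, y) = sum_n s_n v_n(x) conj(u_n(y)), equal to K almost everywhere, and
   also almost everywhere on the diagonal by the trace condition on K. When the
   alpha-determinants are expanded, the factorial moments of both processes
   become the same expression in the s_n and in the integrals over A_c of
   v_n conj(u_n'): as each function f_j of the level l basis vanishes outside
   its cell, Parseval turns such an integral into the sum over j in C_c of
   <v_n, f_j> conj(<u_n', f_j>).

   The moments of order m are O(m! D^m), hence determine the joint law: for
   each count N, t |-> E[h t^N] is carried from t = 1 to t = 0 by finitely many
   Taylor expansions, with steps short compared to 1 / D. *)
From HB Require Import structures.
From mathcomp Require Import all_boot all_order all_algebra all_fingroup.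
From mathcomp Require Import finmap.
From mathcomp Require Import all_classical all_reals all_analysis.
From mathcomp Require Import measurable_realfun.
From mathcomp Require Import complex.
From mathcomp Require Import ring lra zify.
Require Import Defs.
Set Implicit Arguments.
Unset Strict Implicit.
Unset Printing Implicit Defensive.
Import Order.TTheory GRing.Theory Num.Theory.
Import numFieldNormedType.Exports.
Local Open Scope classical_set_scope.
Local Open Scope ring_scope.
Local Open Scope complex_scope.

(** * Complex-valued integrals *)

Section complex_lemmas.
Variable R : realType.
Implicit Types (x y z w : R[i]) (u v : nat -> R[i]).
Notation Re := complex.Re.
Notation Im := complex.Im.

(** An alpha-determinant uses the kernel on the diagonal, where an identity almost everywhere for
    the product measure need not say anything. The singular functions are therefore altered so that
    their weighted sums of squares are finite at every point: the series for k then converges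
    everywhere, and its diagonal can be compared with that of K through traces over a generating
    family of sets. No moment is evaluated. The moments of both processes are limits of finite sums
    over the same index sets, and only the equality of these sums is needed. One theorem on box
    integrals, for an arbitrary sigma-finite measure, thus serves twice: for [lam] on the space and
    for counting measure on the labels. The moment bound gives the expansion at t = 1 a radius that
    may be too small to reach 0, whence several steps; the weight h holds the other counts, so that
    the joint law is obtained one coordinate at a time. A cell carries infinitely many labels, so
    the number of labels in it is finite only almost surely, and the integrand on the right of the
    theorem is not assumed measurable; both are settled outside null sets. *)

Lemma ReD x y : Re (x + y) = Re x + Re y. Proof. by case: x; case: y. Qed.
Lemma ImD x y : Im (x + y) = Im x + Im y. Proof. by case: x; case: y. Qed.
Lemma ReN x : Re (- x) = - Re x. Proof. by case: x. Qed.
Lemma ImN x : Im (- x) = - Im x. Proof. by case: x. Qed.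
Lemma ReB x y : Re (x - y) = Re x - Re y. Proof. by rewrite ReD ReN. Qed.
Lemma ImB x y : Im (x - y) = Im x - Im y. Proof. by rewrite ImD ImN. Qed.
Lemma ReM x y : Re (x * y) = Re x * Re y - Im x * Im y.
Proof. by case: x; case: y. Qed.
Lemma ImM x y : Im (x * y) = Re x * Im y + Im x * Re y.
Proof. by case: x => a b; case: y => c d. Qed.
Lemma ReJ x : Re (conjc x) = Re x. Proof. by case: x. Qed.
Lemma ImJ x : Im (conjc x) = - Im x. Proof. by case: x. Qed.
Lemma ReC (r : R) : Re r%:C = r. Proof. by []. Qed.
Lemma ImC (r : R) : Im r%:C = 0. Proof. by []. Qed.
Lemma complexP x y : Re x = Re y -> Im x = Im y -> x = y.
Proof. by case: x => a b; case: y => c d /= -> ->. Qed.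

Lemma Re_sum (I : Type) (r : seq I) (P : pred I) (F : I -> R[i]) :
  Re (\sum_(i <- r | P i) F i) = \sum_(i <- r | P i) Re (F i).
Proof. by elim/big_rec2 : _ => // i a b _ <-; rewrite ReD. Qed.
Lemma Im_sum (I : Type) (r : seq I) (P : pred I) (F : I -> R[i]) :
  Im (\sum_(i <- r | P i) F i) = \sum_(i <- r | P i) Im (F i).
Proof. by elim/big_rec2 : _ => // i a b _ <-; rewrite ImD. Qed.

Lemma conjc_sum (I : Type) (r : seq I) (P : pred I) (F : I -> R[i]) :
  conjc (\sum_(i <- r | P i) F i) = \sum_(i <- r | P i) conjc (F i).
Proof. exact: rmorph_sum. Qed.

(** The norm of [R[i]] has values in [R[i]]; majorants and integrals require a modulus with values
    in [R]. *)
Definition cabs z : R := Num.sqrt (Re z ^+ 2 + Im z ^+ 2).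

Lemma cabs_ge0 z : 0 <= cabs z. Proof. exact: sqrtr_ge0. Qed.

Lemma cabs2 z : cabs z ^+ 2 = Re z ^+ 2 + Im z ^+ 2.
Proof. by rewrite sqr_sqrtr// addr_ge0// sqr_ge0. Qed.

Lemma cabsM z w : cabs (z * w) = cabs z * cabs w.
Proof.
rewrite /cabs -sqrtrM ?addr_ge0 ?sqr_ge0//; congr Num.sqrt.
by rewrite ReM ImM; ring.
Qed.

Lemma cabsJ z : cabs (conjc z) = cabs z.
Proof. by rewrite /cabs ReJ ImJ sqrrN. Qed.

Lemma cabsC (r : R) : cabs r%:C = `|r|.
Proof. by rewrite /cabs /= expr0n addr0 sqrtr_sqr. Qed.

Lemma cabsN z : cabs (- z) = cabs z.
Proof. by rewrite /cabs ReN ImN !sqrrN. Qed.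

Lemma cabs0 : cabs 0 = 0. Proof. by rewrite (cabsC 0) normr0. Qed.
Lemma cabs1 : cabs 1 = 1. Proof. by rewrite (cabsC 1) normr1. Qed.

Lemma cabs_eq0 z : cabs z = 0 -> z = 0.
Proof.
move=> /(congr1 (fun t => t ^+ 2)); rewrite cabs2 expr0n/= => /eqP.
rewrite paddr_eq0 ?sqr_ge0// !sqrf_eq0 => /andP[/eqP a /eqP b].
exact: complexP.
Qed.

Lemma le_Re_cabs z : `|Re z| <= cabs z.
Proof. by rewrite -sqrtr_sqr ler_wsqrtr// lerDl sqr_ge0. Qed.

Lemma le_Im_cabs z : `|Im z| <= cabs z.
Proof. by rewrite -sqrtr_sqr ler_wsqrtr// lerDr sqr_ge0. Qed.

Lemma cabs_le z : cabs z <= `|Re z| + `|Im z|.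
Proof.
rewrite -(ler_pXn2r (n:=2)) ?nnegrE ?addr_ge0 ?cabs_ge0// cabs2.
rewrite sqrrD !real_normK ?num_real// lerD2r lerDl.
by rewrite mulrn_wge0// mulr_ge0.
Qed.

Lemma cabsD z w : cabs (z + w) <= cabs z + cabs w.
Proof.
rewrite -(ler_pXn2r (n:=2)) ?nnegrE ?addr_ge0 ?cabs_ge0// sqrrD !cabs2.
have h : Re z * Re w + Im z * Im w <= cabs z * cabs w.
  rewrite (le_trans (ler_norm _))//.
  rewrite -cabsJ -cabsM (le_trans _ (le_Re_cabs _))//.
  by rewrite ReM ReJ ImJ mulNr opprK.
rewrite ReD ImD; lra.
Qed.

Lemma cabs_sum (I : Type) (r : seq I) (P : pred I) (F : I -> R[i]) :
  cabs (\sum_(i <- r | P i) F i) <= \sum_(i <- r | P i) cabs (F i).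
Proof.
elim/big_rec2 : _ => [|i y x _ h]; first by rewrite cabs0.
by rewrite (le_trans (cabsD _ _))// lerD2l.
Qed.

Lemma cabs_prod (I : Type) (r : seq I) (P : pred I) (F : I -> R[i]) :
  cabs (\prod_(i <- r | P i) F i) = \prod_(i <- r | P i) cabs (F i).
Proof. by elim/big_rec2 : _ => [|i a b _ <-]; rewrite ?cabs1 ?cabsM. Qed.

Lemma cabsB z w : cabs (z - w) = cabs (w - z).
Proof. by rewrite -cabsN opprB. Qed.

Lemma cabs_rotate w : cabs w != 0 ->
  exists c : R[i], cabs c = 1 /\ cabs w = Re (c * w).
Proof.
move=> w0; exists (conjc w * ((cabs w)^-1)%:C); split.
  by rewrite cabsM cabsJ cabsC ger0_norm ?invr_ge0 ?cabs_ge0// divff.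
transitivity ((Re w ^+ 2 + Im w ^+ 2) * (cabs w)^-1).
  by rewrite -cabs2 expr2 mulfK.
by case: w w0 => a b _ /=; ring.
Qed.

(** Convergence is stated on the two components so that the limit theorems for real sequences and
    integrals apply directly. *)
Definition ccvg u z :=
  (fun n => Re (u n)) @ \oo --> Re z /\ (fun n => Im (u n)) @ \oo --> Im z.

Lemma ccvg_unique u z w : ccvg u z -> ccvg u w -> z = w.
Proof. by move=> [a b] [c d]; apply: complexP; [apply: (cvg_unique _ a c)|apply: (cvg_unique _ b d)]. Qed.

Lemma ccvg_cst z : ccvg (fun=> z) z.
Proof. by split; exact: cvg_cst. Qed.

Lemma ccvgD u v z w : ccvg u z -> ccvg v w -> ccvg (fun n => u n + v n) (z + w).
Proof.
move=> [a b] [c d]; split; rewrite (ReD, ImD).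
  by under eq_fun do rewrite ReD; exact: cvgD.
by under eq_fun do rewrite ImD; exact: cvgD.
Qed.

Lemma ccvgM u v z w : ccvg u z -> ccvg v w -> ccvg (fun n => u n * v n) (z * w).
Proof.
move=> [a b] [c d]; split; rewrite (ReM, ImM).
  by under eq_fun do rewrite ReM; apply: cvgB; exact: cvgM.
by under eq_fun do rewrite ImM; apply: cvgD; exact: cvgM.
Qed.

Lemma ccvg_sum (I : Type) (r : seq I) (P : pred I) (F : I -> nat -> R[i]) (l : I -> R[i]) :
  (forall i, P i -> ccvg (F i) (l i)) ->
  ccvg (fun n => \sum_(i <- r | P i) F i n) (\sum_(i <- r | P i) l i).
Proof.
move=> h; elim: r => [|i r ih].
  by rewrite big_nil; under eq_fun do rewrite big_nil; exact: ccvg_cst.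
rewrite big_cons; under eq_fun do rewrite big_cons.
by case: ifPn => // Pi; apply: ccvgD => //; exact: h.
Qed.

Lemma ccvg_prod (I : Type) (r : seq I) (P : pred I) (F : I -> nat -> R[i]) (l : I -> R[i]) :
  (forall i, P i -> ccvg (F i) (l i)) ->
  ccvg (fun n => \prod_(i <- r | P i) F i n) (\prod_(i <- r | P i) l i).
Proof.
move=> h; elim: r => [|i r ih].
  by rewrite big_nil; under eq_fun do rewrite big_nil; exact: ccvg_cst.
rewrite big_cons; under eq_fun do rewrite big_cons.
by case: ifPn => // Pi; apply: ccvgM => //; exact: h.
Qed.

Lemma ccvg_cabs0 u z : (fun n => cabs (u n - z)) @ \oo --> (0 : R) -> ccvg u z.
Proof.
move=> h; split; apply/subr_cvg0; apply/norm_cvg0P;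
 apply: (squeeze_cvgr _ (cvg_cst 0) h); apply: nearW => n;
 rewrite normr_ge0/= -?ReB -?ImB.
  exact: le_Re_cabs.
exact: le_Im_cabs.
Qed.

Lemma ccvg_cabs u z : ccvg u z -> (fun n => cabs (u n)) @ \oo --> cabs z.
Proof.
move=> [a b]; rewrite /cabs.
apply: (@continuous_cvg _ _ _ _ _ _ Num.sqrt); first exact: sqrt_continuous.
by apply: cvgD; under eq_fun do rewrite expr2; rewrite expr2; apply: cvgM.
Qed.

Lemma ccvg_abs_series u : cvgn (series (fun n => cabs (u n))) ->
  exists z, ccvg (fun N => \sum_(n < N) u n) z.
Proof.
move=> h.
have cR : cvgn (series (fun n => Re (u n))).
  apply: normed_cvg; apply: (series_le_cvg _ _ _ h) => n /=; rewrite ?cabs_ge0//.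
  exact: le_Re_cabs.
have cI : cvgn (series (fun n => Im (u n))).
  apply: normed_cvg; apply: (series_le_cvg _ _ _ h) => n /=; rewrite ?cabs_ge0//.
  exact: le_Im_cabs.
exists (limn (series (fun n => Re (u n))) +i* limn (series (fun n => Im (u n)))).
split => /=.
  under eq_fun do rewrite Re_sum -(big_mkord xpredT (fun i => Re (u i))).
  exact: cR.
under eq_fun do rewrite Im_sum -(big_mkord xpredT (fun i => Im (u i))).
exact: cI.
Qed.

Lemma ccvg_le u z (B : R) : ccvg u z -> (forall n, cabs (u n) <= B) -> cabs z <= B.
Proof.
move=> /ccvg_cabs uz uB; rewrite -(cvg_lim (@Rhausdorff R) uz).
apply: limr_le; first by apply/cvg_ex; exists (cabs z).
exact: nearW.
Qed.

Lemma ccvg_bounded_series u (B : R) : (forall N, \sum_(n < N) cabs (u n) <= B) ->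
  exists2 z, ccvg (fun N => \sum_(n < N) u n) z & cabs z <= B.
Proof.
move=> uB.
have h : cvgn (series (fun n => cabs (u n))).
  apply: nondecreasing_is_cvgn.
    by apply/nondecreasing_seqP => n; rewrite !seriesEnat/= big_nat_recr//= lerDl cabs_ge0.
  by exists B => _ [n _ <-]; rewrite seriesEord; exact: uB.
have [z zP] := ccvg_abs_series h; exists z => //.
by apply: ccvg_le zP _ => N; apply: le_trans (uB N); exact: cabs_sum.
Qed.

End complex_lemmas.
Arguments cabs {R} z.

Section complex_integral.
Variables (R : realType) (d : measure_display) (T : measurableType d).
Implicit Types (f g h : T -> R[i]).
Notation Re := complex.Re.
Notation Im := complex.Im.

Lemma cmeasurable_cst (c : R[i]) : cmeasurable (fun _ : T => c).
Proof. by split; exact: measurable_cst. Qed.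

Lemma cmeasurableD f g :
  cmeasurable f -> cmeasurable g -> cmeasurable (fun x => f x + g x).
Proof.
move=> [a b] [c e]; split.
  by under eq_fun do rewrite ReD; exact: measurable_funD.
by under eq_fun do rewrite ImD; exact: measurable_funD.
Qed.

Lemma cmeasurableN f : cmeasurable f -> cmeasurable (fun x => - f x).
Proof.
move=> [a b]; split.
  by under eq_fun do rewrite ReN; exact: measurable_funN.
by under eq_fun do rewrite ImN; exact: measurable_funN.
Qed.

Lemma cmeasurableB f g :
  cmeasurable f -> cmeasurable g -> cmeasurable (fun x => f x - g x).
Proof. by move=> mf mg; apply: cmeasurableD => //; exact: cmeasurableN. Qed.

Lemma cmeasurableM f g :
  cmeasurable f -> cmeasurable g -> cmeasurable (fun x => f x * g x).
Proof.
move=> [a b] [c e]; split.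
  by under eq_fun do rewrite ReM; apply: measurable_funB; exact: measurable_funM.
by under eq_fun do rewrite ImM; apply: measurable_funD; exact: measurable_funM.
Qed.

Lemma cmeasurable_conj f : cmeasurable f -> cmeasurable (fun x => conjc (f x)).
Proof.
move=> [a b]; split; first by under eq_fun do rewrite ReJ.
by under eq_fun do rewrite ImJ; exact: measurable_funN.
Qed.

Lemma cmeasurable_real (f : T -> R) :
  measurable_fun setT f -> cmeasurable (fun x => (f x)%:C).
Proof. by move=> mf; split => //=; exact: measurable_cst. Qed.

Lemma cmeasurable_sum (I : Type) (r : seq I) (P : pred I) (F : I -> T -> R[i]) :
  (forall i, cmeasurable (F i)) -> cmeasurable (fun x => \sum_(i <- r | P i) F i x).
Proof.
move=> h; elim: r => [|i r ih].
  by under eq_fun do rewrite big_nil; exact: cmeasurable_cst.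
under eq_fun do rewrite big_cons.
by case: (P i) => //; apply: cmeasurableD.
Qed.

Lemma cmeasurable_prod (I : Type) (r : seq I) (P : pred I) (F : I -> T -> R[i]) :
  (forall i, cmeasurable (F i)) -> cmeasurable (fun x => \prod_(i <- r | P i) F i x).
Proof.
move=> h; elim: r => [|i r ih].
  by under eq_fun do rewrite big_nil; exact: cmeasurable_cst.
under eq_fun do rewrite big_cons.
by case: (P i) => //; apply: cmeasurableM.
Qed.

Lemma measurable_cabs f : cmeasurable f -> measurable_fun setT (fun x => cabs (f x)).
Proof.
move=> [a b].
have ms : measurable_fun setT (@Num.sqrt R).
  by apply: continuous_measurable_fun; exact: sqrt_continuous.
rewrite /cabs; apply: (measurableT_comp ms).
by apply: measurable_funD; exact: measurable_funX.
Qed.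

Lemma cmeasurable_lim (F : nat -> T -> R[i]) f :
  (forall n, cmeasurable (F n)) -> (forall x, ccvg (F^~ x) (f x)) -> cmeasurable f.
Proof.
move=> mF Ff; split.
  by apply: (measurable_fun_cvg (h := fun n x => Re (F n x))) => [n|x _];
    [case: (mF n)|case: (Ff x)].
by apply: (measurable_fun_cvg (h := fun n x => Im (F n x))) => [n|x _];
  [case: (mF n)|case: (Ff x)].
Qed.

Lemma measurable_set_ceq f g : cmeasurable f -> cmeasurable g ->
  measurable [set x | f x = g x].
Proof.
move=> [a b] [c e].
rewrite (_ : [set x | _] = [set x | Re (f x) == Re (g x)] `&` [set x | Im (f x) == Im (g x)]).
  apply: measurableI.
    have := @measurable_fun_eqr _ _ _ setT _ _ a c => /(_ measurableT [set true] I).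
    by rewrite setTI.
  have := @measurable_fun_eqr _ _ _ setT _ _ b e => /(_ measurableT [set true] I).
  by rewrite setTI.
apply/seteqP; split => x /=; first by move=> ->; rewrite !eqxx.
by move=> [/eqP + /eqP +]; exact: complexP.
Qed.

Lemma cmeasurable_indic (E : set T) : measurable E -> cmeasurable (fun x => (\1_E x)%:C : R[i]).
Proof. by move=> mE; apply: cmeasurable_real; exact/measurable_indicP. Qed.

Lemma cabs_indic_le1 (E : set T) x : cabs ((\1_E x)%:C : R[i]) <= 1.
Proof. by rewrite cabsC indicE; case: (_ \in _); rewrite /= ?normr0 ?normr1. Qed.

Section fixed_measure.
Variable mu : {measure set T -> \bar R}.

Lemma cintegrable_measurable f : cintegrable mu setT f -> cmeasurable f.
Proof. by move=> [/measurable_int/measurable_EFinP a /measurable_int/measurable_EFinP b]. Qed.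

Lemma cintegrableP f : cintegrable mu setT f <->
  cmeasurable f /\ mu.-integrable setT (fun x => (cabs (f x))%:E).
Proof.
split=> [fi|[[mR mI] i]].
  have mf := cintegrable_measurable fi; split => //.
  case: fi => iR iI.
  apply: (le_integrable _ _ _ (integrableD measurableT (integrable_norm iR) (integrable_norm iI))) => //.
    by apply/measurable_EFinP; exact: measurable_cabs.
  move=> x _ /=; rewrite lee_fin ger0_norm ?cabs_ge0//.
  by rewrite (le_trans (cabs_le _))// ler_norm.
split; apply: (le_integrable _ _ _ i) => //.
- exact/measurable_EFinP.
- by move=> x _ /=; rewrite lee_fin (ger0_norm (cabs_ge0 _)) le_Re_cabs.
- exact/measurable_EFinP.
- by move=> x _ /=; rewrite lee_fin (ger0_norm (cabs_ge0 _)) le_Im_cabs.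
Qed.

Lemma cintegrable_le f (h : T -> R) : cmeasurable f ->
  mu.-integrable setT (EFin \o h) -> (forall x, cabs (f x) <= h x) ->
  cintegrable mu setT f.
Proof.
move=> mf ih le; apply/cintegrableP; split => //.
apply: (le_integrable _ _ _ ih) => //.
  by apply/measurable_EFinP; exact: measurable_cabs.
by move=> x _ /=; rewrite lee_fin ger0_norm ?cabs_ge0// (le_trans (le x))// ler_norm.
Qed.

Lemma cintegrable_lty f : cmeasurable f ->
  (\int[mu]_x (cabs (f x))%:E < +oo)%E -> cintegrable mu setT f.
Proof.
move=> mf h; apply/cintegrableP; split => //; apply/integrableP; split.
  by apply/measurable_EFinP; exact: measurable_cabs.
by under eq_integral do rewrite gee0_abs ?lee_fin ?cabs_ge0//.
Qed.

Lemma cintegrable0 : cintegrable mu setT (fun=> 0 : R[i]).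
Proof. by split; exact: integrable0. Qed.

Lemma cintegrableD f g : cintegrable mu setT f -> cintegrable mu setT g ->
  cintegrable mu setT (fun x => f x + g x).
Proof.
move=> [a b] [c e]; split.
  by under eq_fun do rewrite ReD EFinD; exact: integrableD.
by under eq_fun do rewrite ImD EFinD; exact: integrableD.
Qed.

Lemma cintegrableZ (c : R[i]) f : cintegrable mu setT f ->
  cintegrable mu setT (fun x => c * f x).
Proof.
move=> [a b]; split.
  under eq_fun do rewrite ReM EFinB !EFinM.
  by apply: integrableB => //; exact: integrableZl.
under eq_fun do rewrite ImM EFinD !EFinM.
by apply: integrableD => //; exact: integrableZl.
Qed.

Lemma cintegrable_sum (I : Type) (r : seq I) (P : pred I) (F : I -> T -> R[i]) :
  (forall i, P i -> cintegrable mu setT (F i)) ->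
  cintegrable mu setT (fun x => \sum_(i <- r | P i) F i x).
Proof.
move=> h; elim: r => [|i r ih].
  by under eq_fun do rewrite big_nil; exact: cintegrable0.
under eq_fun do rewrite big_cons.
by case: (boolP (P i)) => // Pi; apply: cintegrableD => //; exact: h.
Qed.

Lemma Re_cintegral f : Re (cintegral mu setT f) = fine (\int[mu]_x (Re (f x))%:E).
Proof. by []. Qed.
Lemma Im_cintegral f : Im (cintegral mu setT f) = fine (\int[mu]_x (Im (f x))%:E).
Proof. by []. Qed.

Let fineD (f g : T -> R) :
  mu.-integrable setT (EFin \o f) -> mu.-integrable setT (EFin \o g) ->
  fine (\int[mu]_x (f x + g x)%:E) = fine (\int[mu]_x (f x)%:E) + fine (\int[mu]_x (g x)%:E).
Proof.
move=> fi gi; under eq_integral do rewrite EFinD.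
by rewrite integralD// fineD//; exact: integrable_fin_num.
Qed.

Let fineZ (c : R) (f : T -> R) :
  mu.-integrable setT (EFin \o f) ->
  fine (\int[mu]_x (c * f x)%:E) = c * fine (\int[mu]_x (f x)%:E).
Proof.
move=> fi; under eq_integral do rewrite EFinM.
by rewrite integralZl// fineM//; exact: integrable_fin_num.
Qed.

Let integrableZ_EFin (c : R) (f : T -> R) :
  mu.-integrable setT (EFin \o f) -> mu.-integrable setT (EFin \o (fun x => c * f x)).
Proof. by move=> /(integrableZl measurableT c); apply: eq_integrable => // x _; rewrite /= EFinM. Qed.

Lemma cintegralD f g : cintegrable mu setT f -> cintegrable mu setT g ->
  cintegral mu setT (fun x => f x + g x) = cintegral mu setT f + cintegral mu setT g.
Proof.
move=> [a b] [c e]; apply: complexP; rewrite (ReD, ImD) !(Re_cintegral, Im_cintegral).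
  by under eq_integral do rewrite ReD; exact: fineD.
by under eq_integral do rewrite ImD; exact: fineD.
Qed.

Lemma cintegralZ (c : R[i]) f : cintegrable mu setT f ->
  cintegral mu setT (fun x => c * f x) = c * cintegral mu setT f.
Proof.
move=> [a b]; apply: complexP; rewrite (ReM, ImM) !(Re_cintegral, Im_cintegral).
  under eq_integral do rewrite ReM -mulNr.
  by rewrite fineD ?fineZ ?mulNr//; exact: integrableZ_EFin.
under eq_integral do rewrite ImM.
by rewrite fineD ?fineZ//; exact: integrableZ_EFin.
Qed.

Lemma cintegralZr (c : R[i]) f : cintegrable mu setT f ->
  cintegral mu setT (fun x => f x * c) = cintegral mu setT f * c.
Proof. by move=> fi; under eq_fun do rewrite mulrC; rewrite cintegralZ// mulrC. Qed.

Lemma cintegral0 : cintegral mu setT (fun=> 0 : R[i]) = 0.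
Proof. by apply: complexP; rewrite !(Re_cintegral, Im_cintegral) integral0. Qed.

Lemma cintegral_conj f : cintegrable mu setT f ->
  cintegral mu setT (fun x => conjc (f x)) = conjc (cintegral mu setT f).
Proof.
move=> [a b]; apply: complexP; rewrite (ReJ, ImJ) !(Re_cintegral, Im_cintegral).
  by under eq_integral do rewrite ReJ.
under eq_integral do rewrite ImJ -mulN1r.
by rewrite fineZ// mulN1r.
Qed.

Lemma cintegral_sum (I : Type) (r : seq I) (P : pred I) (F : I -> T -> R[i]) :
  (forall i, P i -> cintegrable mu setT (F i)) ->
  cintegral mu setT (fun x => \sum_(i <- r | P i) F i x) =
  \sum_(i <- r | P i) cintegral mu setT (F i).
Proof.
move=> h; elim: r => [|i r ih].
  by under eq_fun do rewrite big_nil; rewrite big_nil; exact: cintegral0.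
rewrite big_cons; under eq_fun do rewrite big_cons.
by case: (boolP (P i)) => // Pi; rewrite cintegralD ?ih//;[exact: h|exact: cintegrable_sum].
Qed.

Lemma cintegral_ae_eq f g : cmeasurable f -> cmeasurable g ->
  {ae mu, forall x, f x = g x} -> cintegral mu setT f = cintegral mu setT g.
Proof.
move=> [a b] [c e] fg; apply: complexP; rewrite !(Re_cintegral, Im_cintegral); congr fine;
 (apply: ae_eq_integral; first exact: measurableT).
- exact/measurable_EFinP.
- exact/measurable_EFinP.
- by apply: filterS fg => x /= ->.
- exact/measurable_EFinP.
- exact/measurable_EFinP.
- by apply: filterS fg => x /= ->.
Qed.

(** A unit complex factor rotates the integral onto the positive real axis; its modulus is then the
    integral of a real part, which the modulus of the integrand dominates. *)
Lemma cabs_cintegral f : cintegrable mu setT f ->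
  ((cabs (cintegral mu setT f))%:E <= \int[mu]_x (cabs (f x))%:E)%E.
Proof.
move=> fi; set w := cintegral _ _ _.
have [w0|w0] := eqVneq (cabs w) 0.
  by rewrite w0 integral_ge0// => x _; rewrite lee_fin cabs_ge0.
have [c [c1 ->]] := cabs_rotate w0.
rewrite -cintegralZ// Re_cintegral.
have [iR _] := cintegrableZ c fi.
rewrite fineK; last exact: integrable_fin_num.
apply: le_integral => //; first by have /cintegrableP[] := fi.
move=> x _; rewrite lee_fin (le_trans (ler_norm _))//.
by rewrite (le_trans (le_Re_cabs _))// cabsM c1 mul1r.
Qed.

Lemma cdominated (F : nat -> T -> R[i]) f (h : T -> R) :
  (forall n, cmeasurable (F n)) -> cmeasurable f ->
  {ae mu, forall x, ccvg (F^~ x) (f x)} ->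
  mu.-integrable setT (EFin \o h) ->
  {ae mu, forall x, forall n, cabs (F n x) <= h x} ->
  cintegrable mu setT f /\
  ccvg (fun n => cintegral mu setT (F n)) (cintegral mu setT f).
Proof.
move=> mF mf Ff hi Fh.
have aux (G : nat -> T -> R) (g : T -> R) : (forall n, measurable_fun setT (G n)) ->
    measurable_fun setT g -> {ae mu, forall x, (G ^~ x) @ \oo --> g x} ->
    {ae mu, forall x, forall n, `|G n x| <= h x} ->
    mu.-integrable setT (EFin \o g) /\
    (fun n => fine (\int[mu]_x (G n x)%:E)) @ \oo --> fine (\int[mu]_x (g x)%:E).
  move=> mG mg Gg Gh.
  have [||||| r1 _ r3] := @dominated_convergence _ _ _ mu setT measurableT
    (fun n x => (G n x)%:E) (EFin \o g) (EFin \o h) => //.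
  - by move=> n; exact/measurable_EFinP.
  - exact/measurable_EFinP.
  - by apply: filterS Gg => x ? _; apply: cvg_EFin => //; exact: nearW.
  - by apply: filterS Gh => x hx n _; rewrite lee_fin.
  by split=> //; apply: fine_cvg; rewrite fineK//; exact: integrable_fin_num.
have [r1 r2] : mu.-integrable setT (EFin \o (fun x => Re (f x))) /\
    (fun n => fine (\int[mu]_x (Re (F n x))%:E)) @ \oo --> fine (\int[mu]_x (Re (f x))%:E).
  apply: aux; [by move=> n; case: (mF n)|by case: mf|by apply: filterS Ff => x []|].
  by apply: filterS Fh => x hx n; rewrite (le_trans (le_Re_cabs _)).
have [i1 i2] : mu.-integrable setT (EFin \o (fun x => Im (f x))) /\
    (fun n => fine (\int[mu]_x (Im (F n x))%:E)) @ \oo --> fine (\int[mu]_x (Im (f x))%:E).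
  apply: aux; [by move=> n; case: (mF n)|by case: mf|by apply: filterS Ff => x []|].
  by apply: filterS Fh => x hx n; rewrite (le_trans (le_Im_cabs _)).
by [].
Qed.

(** The sum [H] of the moduli has finite integral by monotone convergence, hence is finite almost
    everywhere, and [fine (H x)] dominates all partial sums. Every later exchange of a series with
    an integral, or with another series, goes through this lemma. *)
Lemma cintegral_series (F : nat -> T -> R[i]) f :
  (forall n, cmeasurable (F n)) -> cmeasurable f ->
  {ae mu, forall x, ccvg (fun N => \sum_(n < N) F n x) (f x)} ->
  (\sum_(n <oo) \int[mu]_x (cabs (F n x))%:E < +oo)%E ->
  cintegrable mu setT f /\
  ccvg (fun N => \sum_(n < N) cintegral mu setT (F n)) (cintegral mu setT f).
Proof.
move=> mF mf Ff Fs.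
pose H x := (\sum_(n <oo) (cabs (F n x))%:E)%E.
have H0 x : (0 <= H x)%E by apply: nneseries_ge0 => n _ _; rewrite lee_fin cabs_ge0.
have mH : measurable_fun setT H.
  apply: ge0_emeasurable_sum => [n x _ _|n _]; first by rewrite lee_fin cabs_ge0.
  by apply/measurable_EFinP; exact: measurable_cabs.
have Hs : (\int[mu]_x H x < +oo)%E.
  rewrite integral_nneseries//; first by move=> n; apply/measurable_EFinP; exact: measurable_cabs.
  by move=> n x _; rewrite lee_fin cabs_ge0.
have Hi : mu.-integrable setT H.
  apply/integrableP; split; first exact: mH.
  by rewrite (eq_integral H) => [|x _]; [exact: Hs|rewrite gee0_abs].
have Hfin := integrable_ae measurableT Hi.
have Fi n : cintegrable mu setT (F n).
  apply: cintegrable_lty => //; apply: le_lt_trans Fs.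
  apply: le_trans (nneseries_lim_ge n.+1 _); first by rewrite big_nat_recr//= leeDr// sume_ge0// => i _; apply: integral_ge0 => x _; rewrite lee_fin cabs_ge0.
  by move=> i _ _; apply: integral_ge0 => x _; rewrite lee_fin cabs_ge0.
have [] := @cdominated (fun N x => \sum_(n < N) F n x) f (fun x => fine (H x)) _ _ _ _ _ => //.
- by move=> n; exact: cmeasurable_sum.
- apply: (le_integrable _ _ _ Hi) => //; first by apply/measurable_EFinP; exact: measurableT_comp.
  by move=> x _ /=; case: (H x) (H0 x) => //= *; rewrite ?normr0 ?leey.
- apply: filterS Hfin => x Hx N.
  rewrite -lee_fin fineK; last exact: Hx.
  rewrite (le_trans _ (nneseries_lim_ge N _))//; last by move=> i _ _; rewrite lee_fin cabs_ge0.
  by rewrite sumEFin lee_fin big_mkord cabs_sum.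
move=> fi cv; split => //; move: cv.
by under eq_fun do rewrite cintegral_sum//.
Qed.

End fixed_measure.
End complex_integral.

Section cmeasurable_projections.
Variables (R : realType) (d1 d2 : measure_display) (T1 : measurableType d1) (T2 : measurableType d2).

Lemma cmeasurable_fst (h : T1 -> R[i]) : cmeasurable h ->
  @cmeasurable _ _ (T1 * T2)%type (fun p => h p.1).
Proof. by move=> [a b]; split; [exact: (measurableT_comp a)|exact: (measurableT_comp b)]. Qed.

Lemma cmeasurable_snd (h : T2 -> R[i]) : cmeasurable h ->
  @cmeasurable _ _ (T1 * T2)%type (fun p => h p.2).
Proof. by move=> [a b]; split; [exact: (measurableT_comp a)|exact: (measurableT_comp b)]. Qed.

End cmeasurable_projections.

(** * Square-integrable functions *)

Section L2_theory.
Variables (R : realType) (d : measure_display) (T : measurableType d).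
Variable mu : {measure set T -> \bar R}.
Implicit Types (f g h : T -> R[i]).
Notation Re := complex.Re.
Notation Im := complex.Im.
Notation L2 := (L2 mu).
Notation sqnorm := (sqnorm mu).
Notation inner := (inner mu).

Lemma sqnormE g : sqnorm g = (\int[mu]_x (cabs (g x) ^+ 2)%:E)%E.
Proof. by apply: eq_integral => x _; rewrite cabs2. Qed.

Lemma sqnorm_ge0 g : (0 <= sqnorm g)%E.
Proof. by apply: integral_ge0 => x _; rewrite lee_fin addr_ge0// sqr_ge0. Qed.

Lemma L2_cintegrableM f g : L2 f -> L2 g -> cintegrable mu setT (fun x => f x * g x).
Proof.
move=> [mf nf] [mg ng]; apply: cintegrable_lty; first exact: cmeasurableM.
apply: (@le_lt_trans _ _ (\int[mu]_x ((cabs (f x) ^+ 2)%:E + (cabs (g x) ^+ 2)%:E))%E).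
  apply: ge0_le_integral => //.
  - by move=> x _; rewrite lee_fin cabs_ge0.
  - by apply/measurable_EFinP; apply: measurable_cabs; exact: cmeasurableM.
  - by apply/measurable_EFinP; apply: measurable_funD; apply: measurable_funX; exact: measurable_cabs.
  - move=> x _; rewrite -EFinD lee_fin cabsM.
    have := cabs_ge0 (f x); have := cabs_ge0 (g x).
    move: (cabs (f x)) (cabs (g x)) => a b b0 a0.
    have := sqr_ge0 (a - b); have := mulr_ge0 a0 b0; rewrite sqrrB; lra.
rewrite ge0_integralD//; last 4 first.
- by move=> x _; rewrite lee_fin sqr_ge0.
- by apply/measurable_EFinP; apply: measurable_funX; exact: measurable_cabs.
- by move=> x _; rewrite lee_fin sqr_ge0.
- by apply/measurable_EFinP; apply: measurable_funX; exact: measurable_cabs.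
by rewrite -!sqnormE lte_add_pinfty.
Qed.

Lemma L2_conj f : L2 f -> L2 (fun x => conjc (f x)).
Proof.
move=> [mf nf]; split; first exact: cmeasurable_conj.
by rewrite sqnormE; under eq_integral do rewrite cabsJ; rewrite -sqnormE.
Qed.

Lemma inner_cintegrable f g : L2 f -> L2 g -> cintegrable mu setT (fun x => f x * conjc (g x)).
Proof. by move=> lf lg; apply: L2_cintegrableM => //; exact: L2_conj. Qed.

Lemma L2_cabs2_integrable f : L2 f -> mu.-integrable setT (fun x => (cabs (f x) ^+ 2)%:E).
Proof.
move=> [mf nf]; apply/integrableP; split.
  by apply/measurable_EFinP; apply: measurable_funX; exact: measurable_cabs.
under eq_integral do rewrite gee0_abs ?lee_fin ?sqr_ge0//.
by rewrite -sqnormE.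
Qed.

Lemma L2_le f g : cmeasurable f -> L2 g -> (forall x, cabs (f x) <= cabs (g x)) -> L2 f.
Proof.
move=> mf [mg ng] le; split=> //; apply: le_lt_trans ng; rewrite !sqnormE.
apply: ge0_le_integral => //.
- by move=> x _; rewrite lee_fin sqr_ge0.
- by apply/measurable_EFinP; apply: measurable_funX; exact: measurable_cabs.
- by apply/measurable_EFinP; apply: measurable_funX; exact: measurable_cabs.
- by move=> x _; rewrite lee_fin lerXn2r ?nnegrE ?cabs_ge0.
Qed.

Lemma L2Z (c : R[i]) f : L2 f -> L2 (fun x => c * f x).
Proof.
move=> lf; have [mf nf] := lf; split.
  by apply: cmeasurableM => //; exact: cmeasurable_cst.
rewrite sqnormE; under eq_integral do rewrite cabsM exprMn EFinM.
have i := L2_cabs2_integrable lf.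
by rewrite integralZl// -sqnormE lte_mul_pinfty// lee_fin sqr_ge0.
Qed.

Lemma L2D f g : L2 f -> L2 g -> L2 (fun x => f x + g x).
Proof.
move=> lf lg; have [mf nf] := lf; have [mg ng] := lg; split; first exact: cmeasurableD.
apply: (@le_lt_trans _ _ (\int[mu]_x (2%:E * (cabs (f x) ^+ 2)%:E + 2%:E * (cabs (g x) ^+ 2)%:E))%E).
  rewrite sqnormE; apply: ge0_le_integral => //.
  - by move=> x _; rewrite lee_fin sqr_ge0.
  - by apply/measurable_EFinP; apply: measurable_funX; apply: measurable_cabs; exact: cmeasurableD.
  - by apply: emeasurable_funD; apply/measurable_funeM/measurable_EFinP; apply: measurable_funX; exact: measurable_cabs.
  - move=> x _; rewrite -!EFinM -EFinD lee_fin.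
    have := cabsD (f x) (g x); have := cabs_ge0 (f x + g x).
    move: (cabs (f x)) (cabs (g x)) (cabs (f x + g x)) => a b c c0 h.
    apply: (@le_trans _ _ ((a + b) ^+ 2)).
      by rewrite lerXn2r// nnegrE (le_trans c0).
    have := sqr_ge0 (a - b); rewrite sqrrB sqrrD; lra.
have i := L2_cabs2_integrable lf; have j := L2_cabs2_integrable lg.
rewrite integralD//; [|exact: integrableZl|exact: integrableZl].
by rewrite !integralZl// -!sqnormE lte_add_pinfty// lte_mul_pinfty// lee_fin.
Qed.

Lemma L20 : L2 (fun=> 0).
Proof.
split; first exact: cmeasurable_cst.
by rewrite sqnormE; under eq_integral do rewrite cabs0 expr0n /=; rewrite integral0.
Qed.

Lemma L2B f g : L2 f -> L2 g -> L2 (fun x => f x - g x).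
Proof.
move=> lf lg; under eq_fun do rewrite -mulN1r; apply: L2D => //; exact: L2Z.
Qed.

Lemma L2_sum (I : Type) (r : seq I) (P : pred I) (F : I -> T -> R[i]) :
  (forall i, P i -> L2 (F i)) -> L2 (fun x => \sum_(i <- r | P i) F i x).
Proof.
move=> h; elim: r => [|i r ih].
  by under eq_fun do rewrite big_nil; exact: L20.
under eq_fun do rewrite big_cons.
by case: (boolP (P i)) => // Pi; apply: L2D => //; exact: h.
Qed.

Lemma innerDl f g h : L2 f -> L2 g -> L2 h ->
  inner (fun x => f x + g x) h = inner f h + inner g h.
Proof.
move=> lf lg lh; rewrite /Defs.inner -cintegralD; [|exact: inner_cintegrable..].
by congr cintegral; apply/funext => x; rewrite mulrDl.
Qed.

Lemma innerZl (c : R[i]) f h : L2 f -> L2 h ->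
  inner (fun x => c * f x) h = c * inner f h.
Proof.
move=> lf lh; rewrite /Defs.inner -cintegralZ; last exact: inner_cintegrable.
by congr cintegral; apply/funext => x; rewrite mulrA.
Qed.

Lemma innerBl f g h : L2 f -> L2 g -> L2 h ->
  inner (fun x => f x - g x) h = inner f h - inner g h.
Proof.
move=> lf lg lh; under eq_fun do rewrite -mulN1r.
by rewrite innerDl//; [rewrite innerZl// mulN1r|exact: L2Z].
Qed.

Lemma inner_conj f g : L2 f -> L2 g -> inner g f = conjc (inner f g).
Proof.
move=> lf lg; rewrite /Defs.inner -cintegral_conj; last exact: inner_cintegrable.
by congr cintegral; apply/funext => x; rewrite rmorphM/= conjcK mulrC.
Qed.

Lemma inner0l h : inner (fun=> 0) h = 0.
Proof. by rewrite /Defs.inner; under eq_fun do rewrite mul0r; exact: cintegral0. Qed.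

Lemma inner_suml (I : Type) (r : seq I) (P : pred I) (F : I -> T -> R[i]) h :
  (forall i, P i -> L2 (F i)) -> L2 h ->
  inner (fun x => \sum_(i <- r | P i) F i x) h = \sum_(i <- r | P i) inner (F i) h.
Proof.
move=> lF lh; elim: r => [|i r ih].
  by under eq_fun do rewrite big_nil; rewrite big_nil; exact: inner0l.
rewrite big_cons; under eq_fun do rewrite big_cons.
case: (boolP (P i)) => // Pi; rewrite innerDl ?ih//; first exact: lF.
exact: L2_sum.
Qed.

Definition rsqnorm g : R := fine (sqnorm g).
Notation n2 := rsqnorm.

Lemma rsqnorm_ge0 g : 0 <= n2 g. Proof. by rewrite fine_ge0// sqnorm_ge0. Qed.

Lemma rsqnormK g : L2 g -> (n2 g)%:E = sqnorm g.
Proof. by move=> [_ h]; rewrite fineK// ge0_fin_numE// sqnorm_ge0. Qed.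

Lemma inner_self g : inner g g = (n2 g)%:C.
Proof.
apply: complexP; rewrite /Defs.inner.
  rewrite Re_cintegral ReC; congr fine; apply: eq_integral => x _.
  by rewrite ReM ReJ ImJ mulrN opprK -!expr2.
rewrite Im_cintegral ImC (eq_integral (cst 0%E)) ?integral0// => x _ /=.
by rewrite ImM ReJ ImJ mulrN mulrC addNr.
Qed.

Lemma rsqnorm_ext f g : (forall x, f x = g x) -> n2 f = n2 g.
Proof. by move=> /funext ->. Qed.

Lemma rsqnormB (c : R[i]) g h : L2 g -> L2 h ->
  n2 (fun x => g x - c * h x) =
  n2 g - 2 * Re (conjc c * inner g h) + cabs c ^+ 2 * n2 h.
Proof.
move=> lg lh; have lch := L2Z c lh.
have lB := L2B lg lch.
have : (n2 (fun x => g x - c * h x))%:C =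
    inner g g - conjc c * inner g h - c * conjc (inner g h) + c * conjc c * inner h h.
  rewrite -inner_self innerBl// (inner_conj lB lg) innerBl//.
  rewrite !innerZl// (inner_conj lB lh) innerBl// innerZl//.
  rewrite (inner_conj lg lh) !inner_self.
  move: (n2 g) (n2 h) (Defs.inner mu g h) => a b [p q]; case: (c) => u v.
  by apply: complexP => /=; ring.
move=> /(congr1 (@Re R)); rewrite !inner_self ReC => ->.
move: (n2 g) (n2 h) (Defs.inner mu g h) => a b [p q]; case: (c) => u v.
by rewrite cabs2 /=; ring.
Qed.

Lemma cauchy_schwarz g h : L2 g -> L2 h -> cabs (inner g h) ^+ 2 <= n2 g * n2 h.
Proof.
move=> lg lh; set z := inner g h.
(* For real t this is the squared norm of g - t <g, h> h, a quadratic polynomial in t. *)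
have key (t : R) : 0 <= n2 g - 2 * t * cabs z ^+ 2 + t ^+ 2 * cabs z ^+ 2 * n2 h.
  have := rsqnorm_ge0 (fun x => g x - (t%:C * z) * h x); rewrite rsqnormB// -/z.
  rewrite cabsM exprMn cabsC real_normK ?num_real//.
  suff -> : Re (conjc (t%:C * z) * z) = t * cabs z ^+ 2 by rewrite mulrA.
  by rewrite cabs2; case: z => a b /=; ring.
have b0 := rsqnorm_ge0 h; have a0 := rsqnorm_ge0 g.
move: key b0 a0; move: (n2 h) (n2 g) (cabs z ^+ 2) (sqr_ge0 (cabs z)) => b a p p0 key.
rewrite le_eqVlt => /predU1P[b0|b0] a0.
  rewrite -b0 mulr0 leNgt; apply/negP => pp.
  (* If h has norm 0 the polynomial is affine, and at this t its value would be -1. *)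
  have := key ((a + 1) / (2 * p)); rewrite -b0 mulr0 addr0.
  have -> : 2 * ((a + 1) / (2 * p)) * p = a + 1 by field; rewrite gt_eqF.
  lra.
have := key (b^-1).
have -> : a - 2 * b^-1 * p + b^-1 ^+ 2 * p * b = a - p / b by field; rewrite gt_eqF.
by rewrite subr_ge0 ler_pdivrMr.
Qed.

(** Fatou's lemma. The convergence holds only almost everywhere, so all functions are first
    multiplied by the indicator of the complement of a null set, after which it holds everywhere. *)
Lemma sqnorm_lim_le (F : nat -> T -> R[i]) f (B : \bar R) :
  (forall n, cmeasurable (F n)) -> cmeasurable f ->
  {ae mu, forall x, ccvg (F^~ x) (f x)} ->
  (forall n, (sqnorm (F n) <= B)%E) -> (sqnorm f <= B)%E.
Proof.
move=> mF mf [N [mN N0 Nsub]] FB.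
pose G n x : \bar R := ((\1_(~` N) x) * cabs (F n x) ^+ 2)%:E.
pose G' x : \bar R := ((\1_(~` N) x) * cabs (f x) ^+ 2)%:E.
have m1 : measurable_fun setT (\1_(~` N) : T -> R).
  by apply/measurable_indicP; exact: measurableC.
have mG' : measurable_fun setT G'.
  by apply/measurable_EFinP/measurable_funM => //; apply: measurable_funX; exact: measurable_cabs.
have mG n : measurable_fun setT (G n).
  by apply/measurable_EFinP/measurable_funM => //; apply: measurable_funX; exact: measurable_cabs.
have i01 x : 0 <= (\1_(~` N) x : R) <= 1 by rewrite indicE; case: (_ \in _); rewrite /= ?lexx ?ler01.
have -> : sqnorm f = (\int[mu]_x G' x)%E.
  rewrite sqnormE; apply: ge0_ae_eq_integral => //.
  - by apply/measurable_EFinP; apply: measurable_funX; exact: measurable_cabs.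
  - by move=> x _; rewrite lee_fin sqr_ge0.
  - by move=> x _; rewrite lee_fin mulr_ge0 ?sqr_ge0//; case/andP: (i01 x).
  exists N; split => // x /= /not_implyP[_ h]; apply: contrapT => xN; apply: h.
  by rewrite /G' indicE mem_set// mul1r.
have -> : (\int[mu]_x G' x = \int[mu]_x limn_einf (G^~ x))%E.
  apply: eq_integral => x _.
  have cv : (G^~ x) @ \oo --> G' x.
    rewrite /G /G'; apply: cvg_EFin; first exact: nearW.
    rewrite indicE; case: (boolP (x \in ~` N)) => xN.
      rewrite mul1r; under eq_fun do rewrite /= mul1r expr2.
      rewrite expr2; apply: cvgM; apply: ccvg_cabs;
        by apply: contrapT => h; move: xN; rewrite inE /=; apply; exact: Nsub.
    by rewrite mul0r; under eq_fun do rewrite /= mul0r; exact: cvg_cst.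
  rewrite is_cvg_limn_einfE; last by apply/cvg_ex; exists (G' x).
  exact/esym/cvg_lim.
apply: le_trans (fatou _ _ _ _) _ => //.
  by move=> n x _; rewrite lee_fin mulr_ge0 ?sqr_ge0//; case/andP: (i01 x).
rewrite limn_einf_lim; apply: lime_le; first exact: is_cvg_einfs.
apply: nearW => n; apply: (@le_trans _ _ (\int[mu]_x G n x)%E).
  by apply: ereal_inf_lbound; exists n => //=.
apply: le_trans (FB n); rewrite sqnormE; apply: ge0_le_integral => //.
- by move=> x _; rewrite lee_fin mulr_ge0 ?sqr_ge0//; case/andP: (i01 x).
- by apply/measurable_EFinP; apply: measurable_funX; exact: measurable_cabs.
- by move=> x _; rewrite lee_fin ler_piMl ?sqr_ge0//; case/andP: (i01 x).
Qed.

Lemma sqnorm0_ae f : cmeasurable f -> sqnorm f = 0%E -> {ae mu, forall x, f x = 0}.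
Proof.
move=> mf; rewrite sqnormE => h.
have : ae_eq mu setT (fun x => (cabs (f x) ^+ 2)%:E) (cst 0%E).
  apply/ae_eq_integral_abs => //.
    by apply/measurable_EFinP; apply: measurable_funX; exact: measurable_cabs.
  by under eq_integral do rewrite gee0_abs ?lee_fin ?sqr_ge0//.
apply: filterS => x /= /(_ I) [] /eqP; rewrite sqrf_eq0 => /eqP; exact: cabs_eq0.
Qed.

Lemma sqnorm_ae f g : cmeasurable f -> cmeasurable g -> {ae mu, forall x, f x = g x} ->
  sqnorm f = sqnorm g.
Proof.
move=> mf mg fg; rewrite !sqnormE; apply: ge0_ae_eq_integral => //.
- by apply/measurable_EFinP; apply: measurable_funX; exact: measurable_cabs.
- by apply/measurable_EFinP; apply: measurable_funX; exact: measurable_cabs.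
- by move=> x _; rewrite lee_fin sqr_ge0.
- by move=> x _; rewrite lee_fin sqr_ge0.
- by apply: filterS fg => x -> _.
Qed.

Lemma rsqnorm_conj g : n2 (fun x => conjc (g x)) = n2 g.
Proof. by rewrite /rsqnorm !sqnormE; congr fine; apply: eq_integral => x _; rewrite cabsJ. Qed.

Lemma sqnorm_indic (B : set T) : measurable B -> sqnorm (fun x => (\1_B x)%:C : R[i]) = mu B.
Proof.
move=> mB; rewrite sqnormE (eq_integral (fun x => (\1_B x)%:E)).
  by rewrite integral_indic// setIT.
by move=> x _; rewrite cabsC indicE; case: (_ \in _); rewrite /= ?normr0 ?normr1 ?expr0n ?expr1n.
Qed.

Lemma L2_indic (B : set T) : measurable B -> (mu B < +oo)%E -> L2 (fun x => (\1_B x)%:C).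
Proof. by move=> mB Bfin; split; [exact: cmeasurable_indic|rewrite sqnorm_indic]. Qed.

End L2_theory.
Arguments rsqnorm {R d T} mu g.

(** * Orthonormal sequences: Bessel, Riesz-Fischer, Parseval *)

Section riesz_fischer.
Variables (R : realType) (d : measure_display) (T : measurableType d).
Variable mu : {measure set T -> \bar R}.
Notation Re := complex.Re.
Notation Im := complex.Im.
Notation L2 := (L2 mu).
Notation sqnorm := (sqnorm mu).
Notation inner := (inner mu).
Notation n2 := (rsqnorm mu).
Variables (E : nat -> T -> R[i]) (b : nat -> bool).
Hypothesis lE : forall n, L2 (E n).
Hypothesis oE : forall n m, inner (E n) (E m) = (b n && (n == m))%:R.
Variable g : T -> R[i].
Hypothesis lg : L2 g.

Let c n := inner g (E n).
Let a n := cabs (c n) ^+ 2.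
Let P N M x : R[i] := \sum_(N <= n < M) c n * E n x.

Let a_ge0 n : 0 <= a n. Proof. exact: sqr_ge0. Qed.

(** Where [b n] is false, [E n] has norm 0. Such vectors are allowed because the enumeration of a
    countable basis by codes has gaps, which are filled with zero functions. *)
Let cb n : ~~ b n -> c n = 0.
Proof.
move=> bn; apply: cabs_eq0; apply/eqP; rewrite -sqrf_eq0 -/(a n) eq_le a_ge0 andbT.
apply: le_trans (cauchy_schwarz lg (lE n)) _.
suff -> : n2 (E n) = 0 by rewrite mulr0.
have := oE n n; rewrite inner_self (negbTE bn)/= => /(congr1 (@Re R)).
by rewrite ReC.
Qed.

Let lP N M : L2 (P N M).
Proof. by apply: L2_sum => n _; exact: L2Z. Qed.

Let innerPE N M m : inner (P N M) (E m) = if (N <= m < M)%N then c m else 0.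
Proof.
rewrite inner_suml//; last by move=> n _; exact: L2Z.
under eq_bigr do rewrite innerZl// oE.
rewrite big_mkcond/= (eq_bigr (fun n => if n == m then c m else 0)); last first.
  move=> n _; case: eqP => [->|_]; last by rewrite andbF mulr0.
  rewrite andbT; case: (boolP (b m)) => bm; first by rewrite mulr1.
  by rewrite cb// mul0r.
rewrite -big_mkcond/=; case: ifPn => Nm.
  rewrite -big_filter (perm_big [:: m])/= ?big_seq1//.
  apply: uniq_perm => //; first by rewrite filter_uniq// iota_uniq.
  by move=> i; rewrite mem_filter mem_index_iota inE; case: eqP => // ->.
rewrite big_seq_cond big1// => i; rewrite mem_index_iota => /andP[+ /eqP ie].
by rewrite ie (negbTE Nm).
Qed.

Let n2P N M : n2 (P N M) = \sum_(N <= n < M) a n.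
Proof.
have : inner (P N M) (P N M) = (\sum_(N <= n < M) a n)%:C.
  rewrite {1}/P inner_suml//; last by move=> n _; exact: L2Z.
  rewrite rmorph_sum/= big_nat [RHS]big_nat; apply: eq_bigr => n nM.
  rewrite innerZl// (inner_conj (lP _ _))// innerPE nM.
  by rewrite /a cabs2; case: (c n) => x y; apply: complexP => /=; ring.
by rewrite inner_self => /(congr1 (@Re R)); rewrite !ReC.
Qed.

Let n2gP N : n2 (fun x => g x - P 0 N x) = n2 g - \sum_(0 <= n < N) a n.
Proof.
have := rsqnormB 1 lg (lP 0 N); under rsqnorm_ext do rewrite mul1r.
move=> ->; rewrite cabs1 expr1n mul1r n2P.
have -> : inner g (P 0 N) = (\sum_(0 <= n < N) a n)%:C.
  rewrite (inner_conj (lP 0 N))// /P inner_suml//; last by move=> n _; exact: L2Z.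
  rewrite conjc_sum rmorph_sum; apply: eq_bigr => n _.
  rewrite innerZl// (inner_conj lg)// -/(c n) /a cabs2.
  by case: (c n) => x y; apply: complexP => /=; ring.
by rewrite ReM ReJ ImJ !ReC /=; ring.
Qed.

Lemma bessel N : \sum_(0 <= n < N) cabs (inner g (E n)) ^+ 2 <= n2 g.
Proof. by rewrite -subr_ge0 -n2gP rsqnorm_ge0. Qed.

Let cvg_a : cvgn (series a).
Proof.
apply: nondecreasing_is_cvgn.
  by apply/nondecreasing_seqP => n; rewrite !seriesEnat/= big_nat_recr//= lerDl.
by exists (n2 g) => _ [n _ <-]; rewrite seriesEnat/=; exact: bessel.
Qed.

Let tail (e : R) : 0 < e -> exists N, forall n m, (N <= n)%N -> (n <= m)%N ->
  \sum_(n <= i < m) a i <= e.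
Proof.
move=> e0; have /cvg_cauchy/cauchy_seriesP/(_ _ e0) := cvg_a.
move=> [[A B] [[N1 _ A1] [N2 _ B1]] AB].
exists (maxn N1 N2) => n m nN nm.
have := AB (n, m); rewrite /= => h; apply: ltW; apply: le_lt_trans (h _); first exact: ler_norm.
split => /=; first by apply: A1 => /=; rewrite (leq_trans _ nN)// leq_maxl.
by apply: B1 => /=; rewrite (leq_trans _ nm)// (leq_trans _ nN)// leq_maxr.
Qed.

(* The L^2 bounds [4^-k] on the increments of a subsequence, together with
   [2 |d_k| <= 2^-k + 2^k |d_k|^2], make it converge absolutely almost everywhere. *)
Lemma riesz_fischer : exists2 G, L2 G &
  forall e : R, 0 < e -> exists N0, forall N, (N0 <= N)%N ->
    n2 (fun x => G x - \sum_(0 <= n < N) c n * E n x) <= e.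
Proof.
have : forall k, exists N, forall n m, (N <= n)%N -> (n <= m)%N ->
    \sum_(n <= i < m) a i <= 4 ^- k.
  by move=> k; apply: tail; rewrite invr_gt0 exprn_gt0.
move=> /choice[phi phiP].
(* The sum makes [Nk] nondecreasing and at least [phi k]; the summand k makes it unbounded, which
   the comparison with an arbitrary index N below requires. *)
pose Nk k := (k + \sum_(i < k.+1) phi i)%N.
have Nk_mono k : (Nk k <= Nk k.+1)%N.
  by rewrite /Nk [in leqRHS]big_ord_recr/= leq_add// leq_addr.
have phiN k : (phi k <= Nk k)%N.
  by rewrite /Nk big_ord_recr/= addnA leq_addl.
have Nk_ge k : (k <= Nk k)%N by rewrite leq_addr.
pose D k := P (Nk k) (Nk k.+1).
have D2 k : n2 (D k) <= 4 ^- k by rewrite n2P; exact: phiP.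
have PD k x : P 0 (Nk k) x = P 0 (Nk 0) x + \sum_(i < k) D i x.
  elim: k => [|k ih]; first by rewrite big_ord0 addr0.
  by rewrite big_ord_recr/= addrA -ih /D /P -big_cat_nat//=.
pose H x := (\sum_(k <oo) (2 ^+ k * cabs (D k x) ^+ 2)%:E)%E.
have mD k : cmeasurable (D k) by case: (lP (Nk k) (Nk k.+1)).
have mDk k : measurable_fun setT (fun x => (2 ^+ k * cabs (D k x) ^+ 2)%:E).
  by apply/measurable_EFinP/measurable_funM => //; apply: measurable_funX; exact: measurable_cabs.
have D0 k x : (0 <= (2 ^+ k * cabs (D k x) ^+ 2)%:E)%E.
  by rewrite lee_fin mulr_ge0 ?sqr_ge0// exprn_ge0.
have mH : measurable_fun setT H by apply: ge0_emeasurable_sum.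
have H0 x : (0 <= H x)%E by apply: nneseries_ge0.
have iH : (\int[mu]_x H x < +oo)%E.
  rewrite integral_nneseries//.
  have geo k : (\int[mu]_x (2 ^+ k * cabs (D k x) ^+ 2)%:E <= (2 ^- k)%:E)%E.
    under eq_integral do rewrite EFinM.
    rewrite integralZl//; last by apply: L2_cabs2_integrable; exact: lP.
    rewrite -sqnormE -rsqnormK; last exact: lP.
    rewrite -EFinM lee_fin (le_trans (ler_wpM2l _ (D2 k)))// ?exprn_ge0//.
    have -> : (4 : R) = 2 * 2 by ring.
    by rewrite exprMn invfM mulrA divff ?mul1r// gt_eqF// exprn_gt0.
  apply: (@le_lt_trans _ _ (\sum_(k <oo) (2 ^- k)%:E)%E).
    apply: lee_nneseries => [k _ _|k _ //].
    by apply: integral_ge0 => x _; exact: D0.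
  have gc : (fun n => (\sum_(0 <= k < n) (2 ^- k : R)%:E)%E) @ \oo --> (2%:E : \bar R).
    rewrite (_ : (fun n => _) = (fun n => (2 - 2 * 2 ^- n : R)%:E)); last first.
      apply/funext => n; rewrite sumEFin; congr EFin.
      elim: n => [|n ih]; first by rewrite big_geq//= expr0 invr1; ring.
      by rewrite big_nat_recr//= ih exprS invfM; field; rewrite expf_neq0.
    apply: cvg_EFin; first exact: nearW.
    rewrite -[X in _ --> X]subr0; apply: cvgB; first exact: cvg_cst.
    rewrite -[X in _ --> X](mulr0 2); apply: cvgM; first exact: cvg_cst.
    by under eq_fun do rewrite -exprVn; apply: cvg_expr; rewrite ger0_norm ?invr_ge0// invf_lt1// ltr1n.
  by rewrite (cvg_lim _ gc)// ltry.
have Hi : mu.-integrable setT H.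
  apply/integrableP; split; first exact: mH.
  by rewrite (eq_integral H) => [|x _]; [exact: iH|rewrite gee0_abs].
have Hfin := integrable_ae measurableT Hi.
(* Outside [A], whose complement is null, the partial sums are replaced by 0; the limit [G] then
   exists at every point and is measurable. *)
pose A := [set x | H x \is a fin_num].
have mA : measurable A.
  by rewrite -[A]setTI; apply: (emeasurable_fin_num measurableT mH).
have sumD x : A x -> exists z, ccvg (fun N => \sum_(n < N) D n x) z.
  move=> Ax; suff [z zP _] : exists2 z, ccvg (fun N => \sum_(n < N) D n x) z &
      cabs z <= 2 + fine (H x) by exists z.
  apply: (@ccvg_bounded_series _ (fun n => D n x)) => n; rewrite -(big_mkord xpredT (fun i => cabs (D i x))).
  apply: (@le_trans _ _ (\sum_(0 <= i < n) (2 ^- i + 2 ^+ i * cabs (D i x) ^+ 2))).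
    apply: ler_sum => i _.
    have p0 : 0 < (2 : R) ^+ i by rewrite exprn_gt0.
    move: (2 ^+ i) p0 (cabs (D i x)) (cabs_ge0 (D i x)) => p p0 t t0.
    have := sqr_ge0 (p^-1 - t); rewrite -(pmulr_rge0 _ p0) sqrrB.
    have -> : p * (p^-1 ^+ 2 - p^-1 * t *+ 2 + t ^+ 2) = p^-1 - 2 * t + p * t ^+ 2.
      by field; rewrite gt_eqF.
    lra.
  rewrite big_split/= lerD//.
    suff -> : \sum_(0 <= i < n) (2 ^- i : R) = 2 - 2 * 2 ^- n by rewrite gerBl mulr_ge0// invr_ge0 exprn_ge0.
    elim: (n) => [|m ih]; first by rewrite big_geq//= expr0 invr1; ring.
    by rewrite big_nat_recr//= ih exprS invfM; field; rewrite expf_neq0.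
  rewrite -lee_fin fineK; last exact: Ax.
  by rewrite -sumEFin; apply: nneseries_lim_ge.
have GP x : exists z, ccvg (fun k => (\1_A x)%:C * P 0 (Nk k) x) z.
  rewrite indicE; case: (boolP (x \in A)) => xA; last first.
    by exists 0; under eq_fun do rewrite mul0r; exact: ccvg_cst.
  have [z zP] := sumD x (set_mem xA).
  exists (P 0 (Nk 0) x + z); under eq_fun do rewrite mul1r PD.
  by apply: ccvgD => //; exact: ccvg_cst.
have [G Gcv] := choice GP.
have mPA k : cmeasurable (fun x => (\1_A x)%:C * P 0 (Nk k) x).
  apply: cmeasurableM; last by case: (lP 0 (Nk k)).
  by exact: cmeasurable_indic.
have mG : cmeasurable G by apply: cmeasurable_lim Gcv.
(* Fatou along the subsequence turns a bound on the blocks from N onwards into one on the remainder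
   at N. The indices [Nk (N + k)] are used because they are at least N. *)
have key N (e : R) : 0 <= e -> (forall m, (N <= m)%N -> \sum_(N <= i < m) a i <= e) ->
    (sqnorm (fun x => G x - P 0 N x)%R <= e%:E)%E.
  move=> e0 he.
  apply: (@sqnorm_lim_le _ _ _ _ (fun k x => P 0 (Nk (N + k)) x - P 0 N x)).
  - by move=> n; apply: cmeasurableB; [case: (lP 0 (Nk (N + n)))|case: (lP 0 N)].
  - by apply: cmeasurableB => //; case: (lP 0 N).
  - apply: filterS Hfin => x /(_ I) Hx.
    have xA : x \in A by rewrite inE.
    have := Gcv x; rewrite indicE xA; under eq_fun do rewrite mul1r.
    move=> Gx; rewrite -[_ - _]/(G x + - P 0 N x); apply: ccvgD; last exact: ccvg_cst.
    case: Gx => Gr Gi; split.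
      by have := Gr; rewrite -(cvg_shiftn N); under eq_fun do rewrite addnC.
    by have := Gi; rewrite -(cvg_shiftn N); under eq_fun do rewrite addnC.
  move=> n; have NN : (N <= Nk (N + n))%N by rewrite (leq_trans _ (Nk_ge _))// leq_addr.
  have -> : (fun x => P 0 (Nk (N + n)) x - P 0 N x) = P N (Nk (N + n)).
    apply/funext => x; rewrite /P (big_cat_nat _ NN)//= [X in X - _]addrC addrK//.
  by rewrite -rsqnormK// n2P lee_fin he.
have lG : L2 G.
  have -> : G = (fun x => (G x - P 0 0 x) + P 0 0 x).
    by apply/funext => x; rewrite subrK.
  apply: L2D => //; split; first by apply: cmeasurableB => //; case: (lP 0 0).
  apply: le_lt_trans (key 0%N (n2 g) (rsqnorm_ge0 _ _) _) _; last by rewrite ltry.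
  by move=> m _; exact: bessel.
exists G => // e e0; have [N0 N0P] := tail e0.
exists N0 => N NN; rewrite -lee_fin (rsqnormK (L2B lG (lP 0 N))).
by apply: key => [|m Nm]; [exact: ltW|exact: N0P].
Qed.

(** The Riesz-Fischer limit [G] has the same coefficients as [g], so completeness gives g = G almost
    everywhere. The partial sums thus converge to [g] in norm, and Cauchy-Schwarz carries this over
    to the inner product with [h]. *)
Lemma parseval_complete : (forall G, L2 G -> (forall n, inner G (E n) = 0) ->
    {ae mu, forall x, G x = 0}) ->
  forall h, L2 h ->
  ccvg (fun N => \sum_(0 <= n < N) inner g (E n) * conjc (inner h (E n))) (inner g h).
Proof.
move=> complete h lh; have [G lG GP] := riesz_fischer.
have cG m : inner G (E m) = c m.
  apply/eqP; rewrite -subr_eq0; apply/eqP/cabs_eq0/eqP.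
  rewrite -sqrf_eq0 eq_le sqr_ge0 andbT; apply/ler_addgt0Pr => e e0.
  rewrite add0r.
  (* The bound is taken positive to allow division, as [E m] may have norm 0. *)
  have [K K0 Kn] : exists2 K : R, 0 < K & n2 (E m) <= K.
    by exists (n2 (E m) + 1); rewrite ?lerDl// ltr_wpDl// rsqnorm_ge0.
  have [N0 N0P] := GP (e / K) (divr_gt0 e0 K0).
  have := cauchy_schwarz (L2B lG (lP 0 (maxn N0 m.+1))) (lE m).
  rewrite innerBl// innerPE leq0n leq_max ltnSn orbT/=.
  move=> /le_trans; apply; rewrite -[leRHS](@divfK _ K) ?gt_eqF//.
  apply: ler_pM => //; [exact: rsqnorm_ge0|exact: rsqnorm_ge0|].
  by apply: N0P; rewrite leq_maxl.
have gG : {ae mu, forall x, g x - G x = 0}.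
  by apply: complete => [|n]; [exact: L2B|rewrite innerBl// cG subrr].
have n2e N : n2 (fun x => g x - P 0 N x) = n2 (fun x => G x - P 0 N x).
  congr fine; apply: sqnorm_ae.
  - by case: (L2B lg (lP 0 N)).
  - by case: (L2B lG (lP 0 N)).
  - by apply: filterS gG => x /eqP; rewrite subr_eq0 => /eqP ->.
apply: ccvg_cabs0; apply/cvgrPdist_le => e e0.
have [K K0 Kn] : exists2 K : R, 0 < K & n2 h <= K.
  by exists (n2 h + 1); rewrite ?lerDl// ltr_wpDl// rsqnorm_ge0.
have [N0 N0P] := GP (e ^+ 2 / K) (divr_gt0 (exprn_gt0 _ e0) K0).
exists N0 => // N /= NN; rewrite sub0r normrN ger0_norm ?cabs_ge0//.
have -> : \sum_(0 <= n < N) inner g (E n) * conjc (inner h (E n)) = inner (P 0 N) h.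
  rewrite /P inner_suml//; last by move=> n _; exact: L2Z.
  by apply: eq_bigr => n _; rewrite innerZl// -/(c n) (inner_conj lh (lE n)).
rewrite cabsB -innerBl// -(ler_pXn2r (n:=2)) ?nnegrE ?cabs_ge0// ?(ltW e0)//.
rewrite (le_trans (cauchy_schwarz (L2B lg (lP 0 N)) lh))//.
rewrite n2e -[leRHS](@divfK _ K) ?gt_eqF//.
by apply: ler_pM => //; [exact: rsqnorm_ge0|exact: rsqnorm_ge0|exact: N0P].
Qed.

End riesz_fischer.

Section parseval.
Variables (R : realType) (d : measure_display) (T : measurableType d).
Variable mu : {measure set T -> \bar R}.
Variables (J : countType) (e : J -> T -> R[i]).
Hypothesis onb : orthonormal_basis mu e.

Let E n : T -> R[i] := oapp e (fun=> 0) (pickle_inv n).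

Let lE n : L2 mu (E n).
Proof.
by rewrite /E; case: pickle_inv => [j|] /=; [case: onb => -[+ _] _; exact|exact: L20].
Qed.

Let oE n m : inner mu (E n) (E m) = ((isSome (@pickle_inv J n)) && (n == m))%:R.
Proof.
rewrite /E; have := @pickle_invK J n; have := @pickle_invK J m.
case: (pickle_inv n) => [i|] /=; last by rewrite inner0l.
case mE : (pickle_inv m) => [j|] /= mj ni; last first.
  rewrite (inner_conj (L20 mu)) ?inner0l ?conjc0; last by case: onb => -[+ _] _; exact.
  suff /negbTE -> : n != m by [].
  by apply: contraPneq mE => <-; rewrite -ni pickleK_inv.
have [[_ oe] _] := onb; rewrite oe//.
by rewrite -mj -ni (inj_eq (pcan_inj (@pickleK_inv J))).
Qed.

Lemma onb_bessel g N : L2 mu g ->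
  \sum_(n < N) oapp (fun j => cabs (inner mu g (e j)) ^+ 2) 0 (@pickle_inv J n) <= rsqnorm mu g.
Proof.
move=> lg; apply: le_trans (bessel lE oE lg N); rewrite big_mkord; apply: ler_sum => n _.
rewrite /E; case: pickle_inv => //=.
by rewrite (inner_conj (L20 mu))// inner0l conjc0 cabs0 expr0n.
Qed.

Lemma parseval g h : L2 mu g -> L2 mu h ->
  ccvg (fun N => \sum_(n < N) oapp (fun j => inner mu g (e j) * conjc (inner mu h (e j))) 0
    (@pickle_inv J n)) (inner mu g h).
Proof.
move=> lg lh.
have : ccvg (fun N => \sum_(0 <= n < N) inner mu g (E n) * conjc (inner mu h (E n))) (inner mu g h).
  apply: (parseval_complete lE oE lg _ lh) => G lG GE.
  case: onb => _; apply => // j.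
  by have := GE (choice.pickle j); rewrite /E pickleK_inv.
congr ccvg; apply/funext => N; rewrite big_mkord; apply: eq_bigr => n _.
rewrite /E; case: pickle_inv => //=.
by rewrite (inner_conj (L20 mu))// inner0l conjc0 mul0r.
Qed.

End parseval.

(** * Integrals against counting measure as series *)

Section counting_integral.
Variables (R : realType) (d : measure_display) (X : measurableType d).
Variables (code : X -> nat) (decode : nat -> option X).
Hypothesis codeK : pcancel code decode.
Hypothesis decodeK : ocancel decode code.
Hypothesis mX : forall A : set X, measurable A.
Let cnt : {measure set X -> \bar R} := counting.

Lemma measurable_fun_discrete d' (Y : measurableType d') (f : X -> Y) : measurable_fun setT f.
Proof. by []. Qed.

Lemma cmeasurable_discrete (f : X -> R[i]) : cmeasurable f.
Proof. by split; exact: measurable_fun_discrete. Qed.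

Lemma counting1 (x : X) : cnt [set x] = 1%E.
Proof. by rewrite /cnt /= /counting asboolT// fset_set1 cardfs1. Qed.

Let pt n : set X := [set x | decode n = Some x].

Let int_pt (f : X -> R) n : (\int[cnt]_x (f x * \1_(pt n) x)%:E = (oapp f 0 (decode n))%:E)%E.
Proof.
case nx : (decode n) => [x|] /=; last first.
  rewrite (eq_integral (cst 0%E)) ?integral0// => y _.
  by rewrite indicE memNset ?mulr0// /pt/= nx.
rewrite (eq_integral (fun y => (f x)%:E * (\1_[set x] y)%:E)%E); last first.
  move=> y _; rewrite -EFinM !indicE; have [->|yx] := eqVneq y x.
    by rewrite !mem_set.
  by rewrite !memNset ?mulr0//= /pt/= ?nx; [move/eqP: yx|case=> xy; rewrite xy eqxx in yx].
rewrite integralZl//; last first.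
  apply/integrableP; split => //.
  rewrite (eq_integral (fun y => (\1_[set x] y)%:E)); last first.
    by move=> y _; rewrite gee0_abs// lee_fin indicE.
  by rewrite integral_indic// setIT counting1 ltry.
by rewrite integral_indic// setIT counting1 mule1.
Qed.

Let sum_pt (f : X -> R) x : (fun N => \sum_(n < N) f x * \1_(pt n) x) @ \oo --> f x.
Proof.
apply: cvg_near_cst; exists (code x).+1 => // N /= xN.
rewrite (bigD1 (Ordinal xN))//= indicE mem_set ?mulr1 /pt/= ?codeK//.
rewrite big1 ?addr0// => i /eqP iN; rewrite indicE memNset ?mulr0//= => ix.
by apply: iN; apply/val_inj => /=; have := decodeK i; rewrite ix.
Qed.

Lemma ge0_integral_counting (f : X -> R) : (forall x, 0 <= f x) ->
  (\int[cnt]_x (f x)%:E = \sum_(n <oo) (oapp f 0 (decode n))%:E)%E.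
Proof.
move=> f0; under eq_eseriesr do rewrite -int_pt.
rewrite -integral_nneseries//; last by move=> n x _; rewrite lee_fin mulr_ge0// indicE.
  apply: eq_integral => x _; apply/esym/cvg_lim => //.
  under eq_fun do rewrite sumEFin big_mkord.
  by apply: cvg_EFin; [exact: nearW|exact: sum_pt].
by move=> n; exact: measurable_fun_discrete.
Qed.

Lemma ge0_integrable_counting (f : X -> R) (B : R) : (forall x, 0 <= f x) ->
  (forall N, \sum_(n < N) oapp f 0 (decode n) <= B) ->
  cnt.-integrable setT (EFin \o f) /\ (\int[cnt]_x (f x)%:E <= B%:E)%E.
Proof.
move=> f0 fB; have le : (\int[cnt]_x (f x)%:E <= B%:E)%E.
  rewrite ge0_integral_counting//; apply: lime_le.
    by apply: is_cvg_nneseries => n _ _; rewrite lee_fin; case: (decode n) => /=.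
  by apply: nearW => N; rewrite sumEFin lee_fin big_mkord.
split => //; apply/integrableP; split => //.
rewrite (eq_integral (EFin \o f)); last by move=> x _; rewrite gee0_abs// lee_fin.
by apply: le_lt_trans le _; rewrite ltry.
Qed.

(** The function is the series of its restrictions to the points coded by n = 0, 1, and so on. Sums
    over labels thus become integrals, and an exchange of two sums becomes an exchange of a sum with
    an integral. *)
Lemma cintegral_counting (z : X -> R[i]) (B : R) :
  (forall N, \sum_(n < N) oapp (cabs \o z) 0 (decode n) <= B) ->
  cintegrable cnt setT z /\
  ccvg (fun N => \sum_(n < N) oapp z 0 (decode n)) (cintegral cnt setT z).
Proof.
move=> zB; pose F n x := z x * (\1_(pt n) x)%:C.
have i01 n x : `|(\1_(pt n) x : R)| = \1_(pt n) x by rewrite ger0_norm// indicE.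
have intF n : cintegral cnt setT (F n) = oapp z 0 (decode n).
  apply: complexP; rewrite (Re_cintegral, Im_cintegral).
    under eq_integral do rewrite /F ReM ReC ImC mulr0 subr0.
    by rewrite int_pt; case: decode.
  under eq_integral do rewrite /F ImM ReC ImC mulr0 add0r.
  by rewrite int_pt; case: decode.
have [||||zi] := @cintegral_series _ _ _ cnt F z.
- by move=> n; exact: cmeasurable_discrete.
- exact: cmeasurable_discrete.
- apply: aeW => x; rewrite /F; split.
    rewrite (_ : (fun N => _) = (fun N => \sum_(n < N) complex.Re (z x) * \1_(pt n) x)).
      exact: (@sum_pt (fun y => complex.Re (z y)) x).
    by apply/funext => N; rewrite Re_sum; apply: eq_bigr => n _; rewrite ReM ReC ImC mulr0 subr0.
  rewrite (_ : (fun N => _) = (fun N => \sum_(n < N) complex.Im (z x) * \1_(pt n) x)).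
    exact: (@sum_pt (fun y => complex.Im (z y)) x).
  by apply/funext => N; rewrite Im_sum; apply: eq_bigr => n _; rewrite ImM ReC ImC mulr0 add0r.
- under eq_eseriesr => n _.
    rewrite (eq_integral (fun x => (cabs (z x) * \1_(pt n) x)%:E)); last first.
      by move=> x _; rewrite /F cabsM cabsC i01.
    rewrite int_pt; over.
  apply: (@le_lt_trans _ _ B%:E); last by rewrite ltry.
  apply: lime_le.
    by apply: is_cvg_nneseries => n _ _; rewrite lee_fin; case: (decode n) => //= x; rewrite cabs_ge0.
  by apply: nearW => N; rewrite sumEFin lee_fin big_mkord.
move=> zcv; split => //; congr (ccvg _ _): zcv.
by apply/funext => N; apply: eq_bigr => n _; rewrite intF.
Qed.

End counting_integral.

(** * Powers of a measure and integrals of alpha-determinants *)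

Section sigma_finite_pack.
Variables (d : measure_display) (T : measurableType d) (R : realType).
Variables (m : {measure set T -> \bar R}) (h : sigma_finite setT m).

(** Product measures and Fubini's theorem ask for the sigma-finite structure, while [lam] and
    counting measure come with a mere proof. The alias carries the structure and stays convertible
    to the given measure. *)
Definition sfmeasure_fun : set T -> \bar R := m.
HB.instance Definition _ := Measure.on sfmeasure_fun.
HB.instance Definition _ :=
  @Measure_isSigmaFinite.Build _ T R sfmeasure_fun h.
Definition sfmeasure : {sigma_finite_measure set T -> \bar R} := sfmeasure_fun.

End sigma_finite_pack.

Section set_function_integral.
Variables (d : measure_display) (T : measurableType d) (R : realType).
Import HBNNSimple.

(** A measure enters an integral only through the measurable fibres of simple functions. This is
    needed because [pow_measure] is a bare set function, known to agree with a measure on measurable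
    sets only. *)
Lemma eq_setfun_integral (m1 m2 : set T -> \bar R) (D : set T) (f : T -> \bar R) :
  (forall B, measurable B -> m1 B = m2 B) ->
  (\int[m1]_(x in D) f x = \int[m2]_(x in D) f x)%E.
Proof.
move=> m12.
have sE (h : {nnsfun T >-> R}) : sintegral m1 h = sintegral m2 h.
  rewrite /sintegral; apply: eq_fsbigr => x _; congr (_ * _)%E; apply: m12.
  exact: measurable_funPTI.
by rewrite /integral; congr (ereal_sup _ - ereal_sup _)%E;
  apply/seteqP; split => _ [h hf <-]; exists h => //; rewrite sE.
Qed.

End set_function_integral.
Arguments eq_setfun_integral {d T R m1} m2 {D f}.

Section product_measures.
Variables (d1 d2 : measure_display) (T1 : measurableType d1) (T2 : measurableType d2).
Variable R : realType.
Variables (m1 : {sigma_finite_measure set T1 -> \bar R}).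
Variables (m2 : {sigma_finite_measure set T2 -> \bar R}).

Lemma product_sigma_finite : sigma_finite setT (m1 \x m2)%E.
Proof.
have /sigma_finiteP[F [FT ndF Fm]] := sigma_finiteT m1.
have /sigma_finiteP[G [GT ndG Gm]] := sigma_finiteT m2.
exists (fun n => F n `*` G n).
  apply/seteqP; split => // -[x y] _.
  have : setT x by []. have : setT y by []. rewrite FT GT => -[n _ Gy] [k _ Fx].
  exists (maxn n k) => //; split => /=.
    by have /subsetPset := ndF k (maxn n k) (leq_maxr _ _); exact.
  by have /subsetPset := ndG n (maxn n k) (leq_maxl _ _); exact.
move=> n; have [mF Fo] := Fm n; have [mG Go] := Gm n; split; first exact: measurableX.
rewrite product_measure1E// lte_mul_pinfty// ?measure_ge0//.
by rewrite ge0_fin_numE ?measure_ge0.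
Qed.

Lemma cintegral_tensor (f : T1 -> R[i]) (g : T2 -> R[i]) :
  cintegrable m1 setT f -> cintegrable m2 setT g ->
  cintegrable (m1 \x m2)%E setT (fun p => f p.1 * g p.2) /\
  cintegral (m1 \x m2)%E setT (fun p => f p.1 * g p.2) =
  cintegral m1 setT f * cintegral m2 setT g.
Proof.
move=> /[dup] fi /cintegrableP[mf af] /[dup] gi /cintegrableP[mg ag].
have mfg : @cmeasurable _ _ (T1 * T2)%type (fun p => f p.1 * g p.2).
  by apply: cmeasurableM; [exact: cmeasurable_fst|exact: cmeasurable_snd].
have fgi : cintegrable (m1 \x m2)%E setT (fun p => f p.1 * g p.2).
  apply: cintegrable_lty => //.
  rewrite fubini_tonelli1/=; last 2 first.
    by apply/measurable_EFinP; exact: measurable_cabs.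
    by move=> p; rewrite lee_fin cabs_ge0.
  rewrite (eq_integral (fun x => (cabs (f x))%:E * \int[m2]_y (cabs (g y))%:E)%E); last first.
    move=> x _; rewrite /fubini_F -integralZl//=.
    by apply: eq_integral => y _; rewrite cabsM.
  have gf := integrable_fin_num measurableT ag.
  rewrite -(fineK gf) integralZr//.
  have ff := integrable_fin_num measurableT af.
  by rewrite -(fineK ff) -EFinM ltry.
split => //.
have [fgr fgI] := fgi.
apply: complexP; rewrite (Re_cintegral, Im_cintegral).
  rewrite -integral12_prod_meas1//; have [gr gI] := gi; have [fr fI] := fi.
  rewrite (eq_integral (fun x => (complex.Re (f x * cintegral m2 setT g))%:E)); last first.
    move=> x _; rewrite /fubini_F/= -cintegralZ// Re_cintegral fineK//.
    by apply: integrable_fin_num => //; case: (cintegrableZ (f x) gi).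
  by rewrite -Re_cintegral cintegralZr.
rewrite -integral12_prod_meas1//; have [gr gI] := gi; have [fr fI] := fi.
rewrite (eq_integral (fun x => (complex.Im (f x * cintegral m2 setT g))%:E)); last first.
  move=> x _; rewrite /fubini_F/= -cintegralZ// Im_cintegral fineK//.
  by apply: integrable_fin_num => //; case: (cintegrableZ (f x) gi).
by rewrite -Im_cintegral cintegralZr.
Qed.

End product_measures.

Section power_measure.
Variables (d : measure_display) (T : measurableType d) (R : realType).
Variable lam : {sigma_finite_measure set T -> \bar R}.

Definition cons_pair n (p : T * n.-tuple T) : n.+1.-tuple T := [tuple of p.1 :: p.2].

Lemma measurable_cons_pair n : measurable_fun setT (@cons_pair n).
Proof. exact: (measurable_cons (measurable_fst) (measurable_snd)). Qed.

Let uncons n (t : n.+1.-tuple T) : T * n.-tuple T := (thead t, [tuple of behead t]).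

Let measurable_uncons n : measurable_fun setT (@uncons n).
Proof.
apply/measurable_fun_pairP; split; last exact: measurable_behead.
exact: measurable_tnth.
Qed.

Let cons_pairK n : cancel (@cons_pair n) (@uncons n).
Proof. by case=> x t; rewrite /uncons; congr (_, _); exact/val_inj. Qed.

Let step_sigma_finite n (P : {sigma_finite_measure set (n.-tuple T) -> \bar R}) :
  sigma_finite setT (pushforward (lam \x P)%E (@cons_pair n)).
Proof.
have [F FT Fm] := product_sigma_finite lam P.
exists (fun k => @uncons n @^-1` F k).
  by rewrite -preimage_bigcup -FT preimage_setT.
move=> k; have [mF Fo] := Fm k; split.
  by rewrite -[X in measurable X]setTI; exact: measurable_uncons.
rewrite /pushforward -comp_preimage (_ : _ \o _ = id)//.
by apply/funext => p; exact: cons_pairK.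
Qed.

Definition pow_step n (P : {sigma_finite_measure set (n.-tuple T) -> \bar R}) :
    {sigma_finite_measure set (n.+1.-tuple T) -> \bar R} :=
  @sfmeasure _ _ _
    (@measure_function_pushforward__canonical__measure_function_Measure _ _ _ _ R
      (lam \x P)%E (@cons_pair n) (@measurable_cons_pair n))
    (step_sigma_finite P).

(** The counterpart of [pow_measure] as a genuine sigma-finite measure, obtained by pushing products
    forward along [cons_pair]; [pow_measureE] compares the two. *)
Fixpoint powm n : {sigma_finite_measure set (n.-tuple T) -> \bar R} :=
  match n with
  | 0%N => \d_([tuple] : 0.-tuple T)
  | k.+1 => pow_step (powm k)
  end.

Lemma powmS n (B : set (n.+1.-tuple T)) :
  powm n.+1 B = (\int[lam]_x powm n [set t : n.-tuple T | B [tuple of x :: t]])%E.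
Proof.
rewrite /= /sfmeasure/= /sfmeasure_fun/= /pushforward/= /product_measure1.
apply: eq_integral => x _; congr (powm n _); apply/seteqP; split => t.
  by rewrite /xsection/= inE.
by rewrite /xsection/= inE.
Qed.

Lemma measurable_cons_preimage n (B : set (n.+1.-tuple T)) (x : T) : measurable B ->
  measurable [set t : n.-tuple T | B [tuple of x :: t]].
Proof.
move=> mB.
have : measurable_fun setT (fun t : n.-tuple T => [tuple of x :: t]).
  exact: (measurable_cons (measurable_cst x) (@measurable_id _ _ _)).
by move=> /(_ measurableT B mB); rewrite setTI.
Qed.

Lemma pow_measureE n (B : set (n.-tuple T)) : measurable B ->
  pow_measure lam B = powm n B.
Proof.
elim: n B => [//|n ih] B mB; rewrite powmS; apply: eq_integral => x _.
by apply: ih; exact: measurable_cons_preimage.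
Qed.

Lemma integral_pow_measure n (D : set (n.-tuple T)) (f : n.-tuple T -> \bar R) :
  (\int[pow_measure lam (m := n)]_(t in D) f t = \int[powm n]_(t in D) f t)%E.
Proof. by apply: eq_setfun_integral => B; exact: pow_measureE. Qed.

(** The other coordinates may contribute an infinite total mass, but infinity times 0 is 0. This
    lemma and the next carry exceptional sets of one or two variables to tuples. *)
Lemma powm_null1 n (B : set T) (p : 'I_n) : measurable B -> lam B = 0%E ->
  powm n [set t | B (tnth t p)] = 0%E.
Proof.
elim: n p => [[]//|n ih] p mB B0; rewrite powmS.
have [->|[q ->]] : p = ord0 \/ exists q, p = lift ord0 q.
  by case: (unliftP ord0 p) => [q ->|->]; [right; exists q|left].
  rewrite (eq_integral (fun x => (powm n setT) * (\1_B x)%:E)%E); last first.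
    move=> x _; rewrite indicE /=; case: (boolP (x \in B)) => xB.
      by rewrite mule1; congr (powm n _); apply/seteqP; split=> // t _ /=; exact: set_mem.
    rewrite mule0 (_ : [set _ | _] = set0) ?measure0//; apply/seteqP; split=> // t /=.
    by move: xB; rewrite notin_setE.
  rewrite ge0_integralZl//; last by exact/measurable_EFinP/measurable_indicP.
  suff -> : (\int[lam]_x (\1_B x)%:E = 0)%E by rewrite mule0.
  by rewrite integral_indic// setIT; exact: B0.
rewrite (eq_integral (cst 0%E)) ?integral0// => x _ /=; rewrite -[RHS](ih q mB B0).
by congr (powm n _); apply/seteqP; split => t /=; rewrite tnthS.
Qed.

(** Either of the two coordinates may be the first one in the tuple, so almost all sections of [B]
    in both directions have to be null; the second direction uses the symmetry of the product
    measure. *)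
Lemma powm_null2 n (B : set (T * T)) (p q : 'I_n) : p != q ->
  measurable B -> (lam \x lam)%E B = 0%E ->
  powm n [set t | B (tnth t p, tnth t q)] = 0%E.
Proof.
move=> + mB B0.
have sec : {ae lam, forall x, lam (xsection B x) = 0%E}.
  move: B0; rewrite /product_measure1 => B0.
  have mx : measurable_fun setT (lam \o xsection B) by exact: measurable_fun_xsection.
  have : ae_eq lam setT (lam \o xsection B) (cst 0%E).
    apply/ae_eq_integral_abs => //.
    by rewrite (eq_integral (lam \o xsection B))//; move=> x _; rewrite gee0_abs ?measure_ge0.
  by apply: filterS => x /= /(_ I).
have sec' : {ae lam, forall x, lam (ysection B x) = 0%E}.
  have : (\int[lam]_y (lam (ysection B y)) = 0)%E.
    rewrite -[RHS]B0; apply/esym.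
    apply: (product_measure_unique (m' := (lam \x^ lam)%E) _ mB) => A1 A2 mA1 mA2.
    exact: product_measure2E.
  move=> B0'.
  have mx : measurable_fun setT (lam \o ysection B) by exact: measurable_fun_ysection.
  have : ae_eq lam setT (lam \o ysection B) (cst 0%E).
    apply/ae_eq_integral_abs => //.
    by rewrite (eq_integral (lam \o ysection B))//; move=> x _; rewrite gee0_abs ?measure_ge0.
  by apply: filterS => x /= /(_ I).
have ae0 (F : T -> \bar R) : measurable_fun setT F -> (forall x, 0 <= F x)%E ->
    {ae lam, forall x, F x = 0%E} -> (\int[lam]_x F x = 0)%E.
  move=> mF F0 F1; rewrite (ge0_ae_eq_integral _ _ (measurable_cst 0%E)) ?integral0//.
  by apply: filterS F1 => x h _.
have msec k (C : set (k.+1.-tuple T)) : measurable C ->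
    measurable_fun setT (fun x => powm k [set t : k.-tuple T | C [tuple of x :: t]]).
  move=> mC.
  have mC' : measurable (@cons_pair k @^-1` C).
    by rewrite -[X in measurable X]setTI; exact: measurable_cons_pair.
  have := measurable_fun_xsection (powm k) mC'; apply: eq_measurable_fun => x _ /=.
  congr (powm k _); apply/seteqP; split => t; rewrite /xsection/= inE//.
elim: n p q => [[]//|n ih] p q pq.
have mS k (p' q' : 'I_k) : measurable [set t : k.-tuple T | B (tnth t p', tnth t q')].
  have : measurable_fun setT (fun t : k.-tuple T => (tnth t p', tnth t q')).
    by apply: measurable_fun_pair; exact: measurable_tnth.
  by move=> /(_ measurableT _ mB); rewrite setTI.
rewrite powmS; move: (@msec n _ (mS n.+1 p q)) => mm.
case: (unliftP ord0 p) => [p'|] pE; case: (unliftP ord0 q) => [q'|] qE; subst p q.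
- rewrite (eq_integral (cst 0%E)) ?integral0// => x _ /=.
  rewrite -[RHS](ih p' q'); last by apply: contra pq => /eqP ->.
  by congr (powm n _); apply/seteqP; split => t /=; rewrite !tnthS.
- apply: ae0 => //.
  apply: filterS sec' => x x0 /=.
  rewrite -[RHS](@powm_null1 n (ysection B x) p'); last by [].
    by congr (powm n _); apply/seteqP; split => t /=; rewrite !tnthS /ysection/= inE.
  exact: measurable_ysection.
- apply: ae0 => //.
  apply: filterS sec => x x0 /=.
  rewrite -[RHS](@powm_null1 n (xsection B x) q'); last by [].
    by congr (powm n _); apply/seteqP; split => t /=; rewrite !tnthS /xsection/= inE.
  exact: measurable_xsection.
- by rewrite eqxx in pq.
Qed.

Lemma cintegral_pushforward d' (Y : measurableType d') (m : {measure set T -> \bar R})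
    (phi : T -> Y) (mphi : measurable_fun setT phi) (f : Y -> R[i]) :
  cmeasurable f -> cintegrable m setT (f \o phi) ->
  cintegrable (pushforward m phi) setT f /\
  cintegral (pushforward m phi) setT f = cintegral m setT (f \o phi).
Proof.
move=> [mr mi] [ir ii]; split.
  by split; apply: integrable_pushforward => //; exact/measurable_EFinP.
apply: complexP; rewrite !(Re_cintegral, Im_cintegral); congr fine;
  by rewrite (integral_pushforward mphi)//; exact/measurable_EFinP.
Qed.

End power_measure.

Section power_integral.
Variables (d : measure_display) (T : measurableType d) (R : realType).
Variable lam : {sigma_finite_measure set T -> \bar R}.

Lemma cmeasurable_tnth n (g : T -> R[i]) (p : 'I_n) : cmeasurable g ->
  cmeasurable (fun t : n.-tuple T => g (tnth t p)).
Proof.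
move=> [a b]; have m := @measurable_tnth _ T _ p.
by split; [exact: (measurableT_comp a m)|exact: (measurableT_comp b m)].
Qed.

Lemma cintegral_powm_prod n (g : 'I_n -> T -> R[i]) :
  (forall p, cintegrable lam setT (g p)) ->
  cintegrable (powm lam n) setT (fun t => \prod_p g p (tnth t p)) /\
  cintegral (powm lam n) setT (fun t => \prod_p g p (tnth t p)) =
  \prod_p cintegral lam setT (g p).
Proof.
elim: n g => [|n ih] g gi.
  rewrite big_ord0; under eq_fun do rewrite big_ord0.
  split; first by split; exact: finite_measure_integrable_cst.
  have c1 (c : R) : (\int[powm lam 0]_t c%:E = c%:E)%E.
    by rewrite integral_cst// [X in (_ * X)%E](_ : _ = 1%E) ?mule1//; exact: diracT.
  by apply: complexP; rewrite !(Re_cintegral, Im_cintegral) c1.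
have [hi hE] := ih (fun p => g (lift ord0 p)) (fun p => gi (lift ord0 p)).
have [ti tE] := cintegral_tensor (gi ord0) hi.
have m : cmeasurable (fun t : n.+1.-tuple T => \prod_p g p (tnth t p)).
  by apply: cmeasurable_prod => p; apply: cmeasurable_tnth; exact: cintegrable_measurable (gi p).
have fE : (fun t : n.+1.-tuple T => \prod_p g p (tnth t p)) \o @cons_pair _ T n =
    (fun p => g ord0 p.1 * \prod_q g (lift ord0 q) (tnth p.2 q)).
  apply/funext => -[x t] /=; rewrite big_ord_recl /cons_pair; congr (_ * _).
  by apply: eq_bigr => q _; rewrite tnthS.
have [|r1 r2] := @cintegral_pushforward _ _ _ _ _ (lam \x powm lam n)%E _
  (@measurable_cons_pair _ T n) _ m; first by rewrite fE.
split; first exact: r1.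
by rewrite [LHS]r2 fE tE hE big_ord_recl.
Qed.

End power_integral.

(** At t = p / b the polynomial equals a - p^2 / b. If b = 0 and p is nonzero, it is affine and
    takes the value -1. *)
Lemma discriminant_le (R : realType) (a b p : R) : 0 <= a -> 0 <= b ->
  (forall t, 0 <= a - 2 * t * p + t ^+ 2 * b) -> p ^+ 2 <= a * b.
Proof.
move=> a0; rewrite le_eqVlt => /predU1P[<-|b0] key.
  rewrite mulr0 leNgt; apply/negP => p0.
  have pn0 : p != 0 by apply: contraTneq p0 => ->; rewrite expr0n ltxx.
  have := key ((a + 1) / (2 * p)); rewrite mulr0 addr0.
  have -> : 2 * ((a + 1) / (2 * p)) * p = a + 1 by field.
  lra.
have := key (p / b).
have -> : a - 2 * (p / b) * p + (p / b) ^+ 2 * b = a - p ^+ 2 / b by field; rewrite gt_eqF.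
by rewrite subr_ge0 ler_pdivrMr.
Qed.

(** * Integrals of alpha-determinants as limits of finite sums *)

Section moments.
Variables (d : measure_display) (T : measurableType d) (R : realType).
Variable lam : {sigma_finite_measure set T -> \bar R}.
Variables (s : nat -> R) (v u : nat -> T -> R[i]) (V U : T -> R) (k : T -> T -> R[i]).
Hypothesis s0 : forall n, 0 <= s n.
Hypothesis lv : forall n, L2 lam (v n).
Hypothesis lu : forall n, L2 lam (u n).
Hypothesis vV : forall x N, \sum_(n < N) s n * cabs (v n x) ^+ 2 <= V x.
Hypothesis uU : forall x N, \sum_(n < N) s n * cabs (u n x) ^+ 2 <= U x.
Hypothesis iV : lam.-integrable setT (EFin \o V).
Hypothesis iU : lam.-integrable setT (EFin \o U).
Let kN N x y : R[i] := \sum_(n < N) (s n)%:C * v n x * conjc (u n y).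
Hypothesis kcv : forall x y, ccvg (fun N => kN N x y) (k x y).
Variables (m : nat) (B : 'I_m -> set T).
Hypothesis mB : forall p, measurable (B p).

Let V0 x : 0 <= V x. Proof. by have := vV x 0; rewrite big_ord0. Qed.
Let U0 x : 0 <= U x. Proof. by have := uU x 0; rewrite big_ord0. Qed.
Let W x := (V x + U x) / 2.
Let W0 x : 0 <= W x. Proof. by rewrite divr_ge0// addr_ge0. Qed.

(** Cauchy-Schwarz for sums with weights [s n], derived from the discriminant. *)
Let kN_le N x y : cabs (kN N x y) <= Num.sqrt (V x) * Num.sqrt (U y).
Proof.
apply: le_trans (cabs_sum _ _ _) _.
under eq_bigr do rewrite !cabsM cabsJ cabsC ger0_norm ?s0//.
set p := \sum_(n < N) _.
have p0 : 0 <= p by apply: sumr_ge0 => n _; rewrite !mulr_ge0 ?cabs_ge0.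
rewrite -(ler_pXn2r (n:=2)) ?nnegrE ?mulr_ge0 ?sqrtr_ge0// exprMn !sqr_sqrtr//.
set a := \sum_(n < N) s n * cabs (v n x) ^+ 2.
set b := \sum_(n < N) s n * cabs (u n y) ^+ 2.
have a0 : 0 <= a by apply: sumr_ge0 => n _; rewrite mulr_ge0 ?sqr_ge0.
have b0 : 0 <= b by apply: sumr_ge0 => n _; rewrite mulr_ge0 ?sqr_ge0.
apply: (@le_trans _ _ (a * b)); last by apply: ler_pM; rewrite ?vV ?uU.
apply: discriminant_le => // t.
rewrite /a /b /p !mulr_sumr -sumrB -big_split/=; apply: sumr_ge0 => n _.
have -> : s n * cabs (v n x) ^+ 2 - 2 * t * (s n * cabs (v n x) * cabs (u n y)) +
  t ^+ 2 * (s n * cabs (u n y) ^+ 2) = s n * (cabs (v n x) - t * cabs (u n y)) ^+ 2 by ring.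
by rewrite mulr_ge0 ?sqr_ge0.
Qed.

(** Each coordinate occurs once as a first and once as a second argument of the kernel. After
    reindexing by [sg], the factor at p is the geometric mean of V and U at one point, hence at most
    their arithmetic mean W. The majorant depends neither on [sg] nor on the truncation N. *)
Let prod_le (sg : 'S_m) (t : m.-tuple T) :
  \prod_p (Num.sqrt (V (tnth t p)) * Num.sqrt (U (tnth t (sg p)))) <= \prod_p W (tnth t p).
Proof.
rewrite big_split/= -(reindex_inj (@perm_inj _ sg) (P := xpredT) (F := fun p => Num.sqrt (U (tnth t p))))/=.
rewrite -big_split/=; apply: ler_prod => p _; rewrite mulr_ge0 ?sqrtr_ge0//=.
have := sqr_ge0 (Num.sqrt (V (tnth t p)) - Num.sqrt (U (tnth t p))).
by rewrite sqrrB !sqr_sqrtr// /W; lra.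
Qed.

Let ind p x : R[i] := (\1_(B p) x)%:C.
Let ind_le p x : cabs (ind p x) <= 1.
Proof. exact: cabs_indic_le1. Qed.
Let mind p : cmeasurable (ind p).
Proof. by exact: cmeasurable_indic. Qed.

(** Besides the numbers [s n], these are the only data of the space that survive in the expanded
    moments; the comparison of the two processes reduces to them. *)
Definition box_inner p n n' := cintegral lam setT (fun x => ind p x * (v n x * conjc (u n' x))).

Let i_box p n n' : cintegrable lam setT (fun x => ind p x * (v n x * conjc (u n' x))).
Proof.
have vi := inner_cintegrable (lv n) (lu n'); have /cintegrableP[mi ci] := vi.
apply: (cintegrable_le (h := fun x => cabs (v n x * conjc (u n' x)))) => //.
  exact: cmeasurableM.
by move=> x; rewrite cabsM ler_piMl ?cabs_ge0.
Qed.

(* The integral of the product over p of K(t_p, t_(sg p)), after expansion of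
   each kernel: the factor u comes from the index of sg^-1 p. *)
Definition box_sum (sg : 'S_m) N : R[i] :=
  \sum_(phi : {ffun 'I_m -> 'I_N})
    ((\prod_p s (phi p))%:C * \prod_p box_inner p (phi p) (phi (sg^-1%g p))).

Let FN (sg : 'S_m) N (t : m.-tuple T) : R[i] :=
  \prod_p (ind p (tnth t p) * kN N (tnth t p) (tnth t (sg p))).
Let F (sg : 'S_m) (t : m.-tuple T) : R[i] :=
  \prod_p (ind p (tnth t p) * k (tnth t p) (tnth t (sg p))).

Let FNE sg N t : FN sg N t =
  \sum_(phi : {ffun 'I_m -> 'I_N}) ((\prod_p s (phi p))%:C *
    \prod_p (ind p (tnth t p) * (v (phi p) (tnth t p) * conjc (u (phi (sg^-1%g p)) (tnth t p))))).
Proof.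
rewrite /FN /kN; under eq_bigr do rewrite mulr_sumr.
rewrite (bigA_distr_bigA (fun (p : 'I_m) (n : 'I_N) => ind p (tnth t p) * ((s n)%:C * v n (tnth t p) * conjc (u n (tnth t (sg p)))))).
apply: eq_bigr => phi _; rewrite rmorph_prod/= -big_split/=.
rewrite [RHS](eq_bigr (fun p => ((s (phi p))%:C * ind p (tnth t p) * v (phi p) (tnth t p)) *
  conjc (u (phi (sg^-1%g p)) (tnth t p)))); last by move=> p _; rewrite !mulrA.
(* Replacing p by [sg p] in the factors u alone turns [phi (sg^-1 p)] into [phi p], as in the
   expanded product. *)
rewrite [RHS]big_split/= [X in _ = _ * X](reindex_inj (@perm_inj _ sg))/=.
rewrite -big_split/=; apply: eq_bigr => p _; rewrite permK.
by ring.
Qed.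

Let cFN sg N : cintegrable (powm lam m) setT (FN sg N) /\
  cintegral (powm lam m) setT (FN sg N) = box_sum sg N.
Proof.
have h phi := cintegral_powm_prod (fun p : 'I_m => i_box p (phi p) (phi (sg^-1%g p))).
have -> : FN sg N = (fun t => FN sg N t) by [].
under eq_fun do rewrite FNE.
split.
  by apply: cintegrable_sum => phi _; apply: cintegrableZ; case: (h (fun p => phi p)).
rewrite cintegral_sum; last first.
  by move=> phi _; apply: cintegrableZ; case: (h (fun p => phi p)).
apply: eq_bigr => phi _; have [h1 h2] := h (fun p => phi p).
by rewrite cintegralZ// h2.
Qed.

Let iW : lam.-integrable setT (EFin \o W).
Proof.
have := integrableZl measurableT (2^-1) (integrableD measurableT iV iU).
by apply: eq_integrable => // x _; rewrite /= /W -EFinD -EFinM mulrC.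
Qed.
Let iWC : cintegrable lam setT (fun x => (W x)%:C).
Proof. by split => //; under eq_fun do rewrite ImC; exact: integrable0. Qed.
Let w := fine (\int[lam]_x (W x)%:E).
Let WCE : cintegral lam setT (fun x => (W x)%:C) = w%:C.
Proof. by apply: complexP => //; rewrite Im_cintegral (eq_integral (cst 0%E)) ?integral0. Qed.

Let prodW : (powm lam m).-integrable setT (fun t => (\prod_p W (tnth t p))%:E) /\
  (\int[powm lam m]_t (\prod_p W (tnth t p))%:E = (w ^+ m)%:E)%E.
Proof.
have [h1 h2] := cintegral_powm_prod (fun _ : 'I_m => iWC).
have E : (fun t : m.-tuple T => \prod_p (W (tnth t p))%:C) = (fun t => (\prod_p W (tnth t p))%:C).
  by apply/funext => t; rewrite rmorph_prod.
rewrite E in h1 h2; case: h1 => h1 _.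
split; first exact: h1.
rewrite -[LHS]fineK; last exact: integrable_fin_num.
congr EFin; move: h2 => /(congr1 (@complex.Re R)); rewrite Re_cintegral => ->.
by rewrite (eq_bigr (fun=> w%:C))// -rmorph_prod ReC prodr_const card_ord.
Qed.

Let mF sg : cmeasurable (F sg).
Proof.
apply: (@cmeasurable_lim _ _ _ (FN sg)) => [N|t].
  by have [/cintegrable_measurable] := cFN sg N.
by apply: ccvg_prod => p _; apply: ccvgM; [exact: ccvg_cst|exact: kcv].
Qed.

Let FN_le sg N t : cabs (FN sg N t) <= \prod_p W (tnth t p).
Proof.
rewrite cabs_prod; apply: le_trans (prod_le sg t); apply: ler_prod => p _.
rewrite cabs_ge0/= cabsM; apply: le_trans (kN_le N _ _).
by rewrite ler_piMl ?cabs_ge0.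
Qed.

(** Dominated convergence with the product of the W as majorant. By Fubini its integral is w^m,
    which also bounds the limit uniformly in [sg]. *)
Lemma box_integral (sg : 'S_m) :
  [/\ cintegrable (powm lam m) setT (F sg),
      ccvg (box_sum sg) (cintegral (powm lam m) setT (F sg)) &
      cabs (cintegral (powm lam m) setT (F sg)) <= w ^+ m].
Proof.
have [iP PE] := prodW.
have [|||||r1 r2] := @cdominated _ _ _ (powm lam m) (FN sg) (F sg) (fun t => \prod_p W (tnth t p)).
- by move=> N; have [/cintegrable_measurable] := cFN sg N.
- exact: mF.
- by apply: aeW => t; apply: ccvg_prod => p _; apply: ccvgM; [exact: ccvg_cst|exact: kcv].
- exact: iP.
- by apply: aeW => t N; exact: FN_le.
split => //.
  by move: r2; congr ccvg; apply/funext => N; case: (cFN sg N).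
rewrite -lee_fin; apply: le_trans (cabs_cintegral r1) _.
rewrite -PE; apply: ge0_le_integral => //.
- by move=> t _; rewrite lee_fin cabs_ge0.
- by apply/measurable_EFinP; apply: measurable_cabs.
- exact: (measurable_int _ iP).
move=> t _; rewrite lee_fin; apply: (@ccvg_le _ (fun N => FN sg N t)) => [|N]; last exact: FN_le.
by apply: ccvg_prod => p _; apply: ccvgM; [exact: ccvg_cst|exact: kcv].
Qed.

Variables (K : T -> T -> R[i]) (BB : set T) (alpha : R) (rho : m.-tuple T -> R).
Hypothesis BBB : forall p, B p `<=` BB.
Hypothesis Kk2 : {ae (lam \x lam)%E, forall q, BB q.1 -> BB q.2 -> K q.1 q.2 = k q.1 q.2}.
Hypothesis Kk1 : {ae lam, forall x, BB x -> K x x = k x x}.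
Hypothesis mrho : measurable_fun setT rho.
Hypothesis rhoE : forall t, (rho t)%:C = det_alpha alpha (\matrix_(i, j) K (tnth t i) (tnth t j)).

Let box := [set t : m.-tuple T | forall p, B p (tnth t p)].

(** Pairs with p = q are treated apart: they involve the diagonal, which the hypothesis on the
    product measure does not control. *)
Let ae_box : {ae powm lam m, forall t, box t -> forall p q,
  K (tnth t p) (tnth t q) = k (tnth t p) (tnth t q)}.
Proof.
have h p q : {ae powm lam m, forall t, box t ->
    K (tnth t p) (tnth t q) = k (tnth t p) (tnth t q)}.
  have [->|pq] := eqVneq q p.
    have [N [mN N0 Ns]] := Kk1.
    exists [set t | N (tnth t p)]; split.
    - by rewrite -[X in measurable X]setTI; exact: measurable_tnth.
    - exact: powm_null1.
    move=> t /= /not_implyP[bt kt]; apply: Ns => /= /(_ (BBB (bt p))); exact: kt.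
  have [N [mN N0 Ns]] := Kk2.
  exists [set t | N (tnth t p, tnth t q)]; split.
  - have mt : measurable_fun setT (fun t : m.-tuple T => (tnth t p, tnth t q)).
      by apply: measurable_fun_pair; exact: measurable_tnth.
    by move: (mt measurableT _ mN); rewrite setTI.
  - by apply: powm_null2 => //; rewrite eq_sym.
  move=> t /= /not_implyP[bt kt]; apply: Ns => /= /(_ (BBB (bt p)) (BBB (bt q))); exact: kt.
have : {ae powm lam m, forall t, forall pq : 'I_m * 'I_m, box t ->
    K (tnth t pq.1) (tnth t pq.2) = k (tnth t pq.1) (tnth t pq.2)}.
  by apply: filter_forall => -[p q]; exact: h.
by apply: filterS => t ht bt p q; exact: (ht (p, q) bt).
Qed.

Definition box_det_sum N : R[i] :=
  \sum_(sg : 'S_m) (alpha ^+ (m - #|porbits sg|))%:C * box_sum sg N.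

(** On the box [K] may be replaced by [k] almost everywhere, and [rho] is the real part of the sum
    [G] over permutations; off the box [G] vanishes because one of its indicator factors does. Each
    permutation is then handled by [box_integral]. *)
Theorem box_det_integral : exists2 r : R,
  (\int[pow_measure lam (m := m)]_(t in box) (rho t)%:E = r%:E)%E /\
  (fun N => complex.Re (box_det_sum N)) @ \oo --> r &
  `|r| <= \sum_(sg : 'S_m) `|alpha| ^+ (m - #|porbits sg|) * w ^+ m.
Proof.
pose G t := \sum_(sg : 'S_m) (alpha ^+ (m - #|porbits sg|))%:C * F sg t.
have iG : cintegrable (powm lam m) setT G.
  by apply: cintegrable_sum => sg _; apply: cintegrableZ; case: (box_integral sg).
have GE : cintegral (powm lam m) setT G =
    \sum_(sg : 'S_m) (alpha ^+ (m - #|porbits sg|))%:C * cintegral (powm lam m) setT (F sg).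
  rewrite cintegral_sum; last by move=> sg _; apply: cintegrableZ; case: (box_integral sg).
  by apply: eq_bigr => sg _; rewrite cintegralZ//; case: (box_integral sg).
have mbox : measurable box.
  have -> : box = \bigcap_(p in setT) [set t : m.-tuple T | B p (tnth t p)].
    by apply/seteqP; split => [t bt p _|t bt p]; exact: bt.
  apply: fin_bigcap_measurable => // p _.
  by rewrite -[X in measurable X]setTI; exact: measurable_tnth.
exists (complex.Re (cintegral (powm lam m) setT G)); first split.
- rewrite integral_pow_measure integral_mkcond Re_cintegral fineK; last first.
    by apply: integrable_fin_num => //; case: iG.
  apply: ae_eq_integral => //.
  + by apply/(measurable_restrictT _ _).1 => //; exact/measurable_EFinP/measurable_funTS.
  + by apply: (measurable_int (powm lam m)); case: iG.
  apply: filterS ae_box => t ht _; rewrite patchE; case: (boolP (t \in box)) => tb.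
    have := rhoE t; rewrite /det_alpha => /(congr1 (@complex.Re R)); rewrite ReC => ->.
    congr EFin; congr complex.Re; apply: eq_bigr => sg _; congr (_ * _).
    have bt : box t := set_mem tb.
    by apply: eq_bigr => p _; rewrite mxE (ht bt) /ind indicE mem_set ?mul1r.
  congr EFin; suff -> : G t = 0 by [].
  apply: big1 => sg _; suff -> : F sg t = 0 by rewrite mulr0.
  move: tb; rewrite notin_setE => /existsNP[p Bp].
  by rewrite /F (bigD1 p)//= /ind indicE memNset// !mul0r.
- have [+ _] : ccvg box_det_sum (cintegral (powm lam m) setT G); last by [].
  rewrite GE; apply: ccvg_sum => sg _; apply: ccvgM; first exact: ccvg_cst.
  by case: (box_integral sg).
apply: le_trans (le_Re_cabs _) _; rewrite GE; apply: le_trans (cabs_sum _ _ _) _.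
apply: ler_sum => sg _; rewrite cabsM cabsC normrX ler_wpM2l ?exprn_ge0//.
by case: (box_integral sg).
Qed.

End moments.

(** * Kernels of trace class operators *)

Section integral_uniqueness.
Variables (d : measure_display) (T : measurableType d) (R : realType).
Variable mu : {measure set T -> \bar R}.
Variable gs : nat -> set T.
Hypothesis gsE : @measurable _ T = <<s range gs >>.
Hypothesis gsI : setI_closed (range gs).
Variable cov : nat -> set T.
Hypothesis covG : forall n, range gs (cov n).
Hypothesis covI : trivIset setT cov.
Hypothesis covT : \bigcup_n cov n = setT.

(** Dynkin's theorem for the sets over which f has integral 0. Stability under complements needs the
    whole space, which is reached as a countable disjoint union of generators. *)
Lemma integral_pi_eq0 (f : T -> \bar R) : mu.-integrable setT f ->
  (forall n, (\int[mu]_(x in gs n) f x = 0)%E) -> ae_eq mu setT f (cst 0%E).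
Proof.
move=> fi f0.
have mgs n : measurable (gs n) by rewrite gsE; apply: sub_gen_smallest; exists n.
have mcov n : measurable (cov n) by have [k _ <-] := covG n.
have fiE E : measurable E -> mu.-integrable E f.
  by move=> mE; exact: (integrableS measurableT mE).
have bigU (F : nat -> set T) : (forall n, measurable (F n)) -> trivIset setT F ->
    (forall n, (\int[mu]_(x in F n) f x = 0)%E) -> (\int[mu]_(x in \bigcup_n F n) f x = 0)%E.
  move=> mF tF F0; rewrite integral_bigcup//; last by apply: fiE; exact: bigcup_measurable.
  by rewrite eseries0// => n _ _; exact: F0.
have fT : (\int[mu]_(x in setT) f x = 0)%E.
  by rewrite -covT; apply: bigU => // n; have [k _ <-] := covG n.
have all0 E : measurable E -> (\int[mu]_(x in E) f x = 0)%E.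
  move=> mE; have := mE; rewrite gsE; move: E {mE}.
  apply: (dynkin_induction (P := fun E => (\int[mu]_(x in E) f x = 0)%E) gsE gsI) => //.
  - by move=> _ [n _ <-].
  - move=> E mE E0; have mEc := measurableC mE.
    have := integral_setU mu mE mEc (f := f).
    rewrite setUv E0 add0e fT => <- //; first exact: measurable_int fi.
    by apply/disj_setPS; rewrite setICr.
apply: integral_ae_eq => // E _ mE; rewrite all0// integral0//.
Qed.

Lemma cintegral_pi_eq (f g : T -> R[i]) : cintegrable mu setT f -> cintegrable mu setT g ->
  (forall n, cintegral mu setT (fun x => (\1_(gs n) x)%:C * f x) =
             cintegral mu setT (fun x => (\1_(gs n) x)%:C * g x)) ->
  {ae mu, forall x, f x = g x}.
Proof.
move=> fi gi fg.
have mgs n : measurable (gs n) by rewrite gsE; apply: sub_gen_smallest; exists n.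
have [hr hi] := cintegrableD fi (cintegrableZ (-1) gi).
have mulE n (x : T) (z : R[i]) : (\1_(gs n) x)%:C * z =
    (complex.Re z * \1_(gs n) x) +i* (complex.Im z * \1_(gs n) x).
  by apply: complexP; rewrite (ReM, ImM) ReC ImC /=; ring.
have ii (h : T -> R[i]) n : cintegrable mu setT h -> cintegrable mu setT (fun x => (\1_(gs n) x)%:C * h x).
  move=> /cintegrableP[mh ih]; apply: (cintegrable_le (h := fun x => cabs (h x))) => //.
    by apply: cmeasurableM => //; exact: cmeasurable_indic.
  by move=> x; rewrite cabsM ler_piMl ?cabs_ge0 ?cabs_indic_le1.
have d0 n : cintegral mu setT (fun x => (\1_(gs n) x)%:C * (f x + -1 * g x)) = 0.
  under eq_fun do rewrite mulrDr mulrCA.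
  rewrite cintegralD ?cintegralZ ?fg ?mulN1r ?subrr//; do ?apply: ii => //.
  by apply: cintegrableZ; exact: ii.
have real0 (h : T -> R) n : mu.-integrable setT (EFin \o h) ->
    fine (\int[mu]_x (h x * \1_(gs n) x)%:E) = 0 -> (\int[mu]_(x in gs n) (h x)%:E = 0)%E.
  move=> ih h0; rewrite integral_mkcond.
  rewrite (eq_integral (fun x => (h x * \1_(gs n) x)%:E)); last first.
    by move=> x _; rewrite patchE indicE; case: ifPn => _; rewrite ?mulr1 ?mulr0.
  rewrite -[LHS]fineK ?h0//; apply: integrable_fin_num => //.
  apply: (le_integrable _ _ _ ih) => //.
    by apply/measurable_EFinP/measurable_funM; [exact/measurable_EFinP/(measurable_int _ ih)|exact/measurable_indicP].
  move=> x _ /=; rewrite lee_fin normrM ler_piMr// indicE.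
  by case: (_ \in _); rewrite /= ?normr0 ?normr1.
have r0 : ae_eq mu setT (fun x => (complex.Re (f x + -1 * g x))%:E) (cst 0%E).
  apply: integral_pi_eq0 => // n; apply: real0 => //.
  have := congr1 (@complex.Re R) (d0 n); rewrite Re_cintegral => h; rewrite -[RHS]h.
  by congr fine; apply: eq_integral => x _; rewrite mulE.
have i0 : ae_eq mu setT (fun x => (complex.Im (f x + -1 * g x))%:E) (cst 0%E).
  apply: integral_pi_eq0 => // n; apply: real0 => //.
  have := congr1 (@complex.Im R) (d0 n); rewrite Im_cintegral => h; rewrite -[RHS]h.
  by congr fine; apply: eq_integral => x _; rewrite mulE.
apply: filterS2 r0 i0 => x /(_ I)[xr] /(_ I)[xi].
by apply/eqP; rewrite -subr_eq0 -mulN1r; apply/eqP/complexP.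
Qed.

End integral_uniqueness.

(** * Singular value decompositions controlled at every point *)

Section svd.
Variables (d : measure_display) (T : measurableType d) (R : realType).
Variable mu : {measure set T -> \bar R}.
Notation L2 := (L2 mu).
Notation inner := (inner mu).
Notation n2 := (rsqnorm mu).

(* A singular value decomposition with everywhere defined functions: outside a
   null set, where v and u are put to 0, the weighted sums of |v_n|^2 and
   |u_n|^2 have the integrable majorants V and U. *)
Record svd (K : T -> T -> R[i]) (C : set T) (B : R) (s : nat -> R) (v u : nat -> T -> R[i])
    (V U : T -> R) : Prop := SVD {
  svd_s0 : forall n, 0 <= s n ;
  svd_sB : forall N, \sum_(n < N) s n <= B ;
  svd_lv : forall n, L2 (v n) ;
  svd_lu : forall n, L2 (u n) ;
  svd_nv : forall n, n2 (v n) <= 1 ;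
  svd_nu : forall n, n2 (u n) <= 1 ;
  svd_Cu : forall n x, ~ C x -> u n x = 0 ;
  svd_vV : forall x N, \sum_(n < N) s n * cabs (v n x) ^+ 2 <= V x ;
  svd_uU : forall x N, \sum_(n < N) s n * cabs (u n x) ^+ 2 <= U x ;
  svd_iV : mu.-integrable setT (EFin \o V) ;
  svd_iU : mu.-integrable setT (EFin \o U) ;
  svd_kop : forall g, L2 g -> cmeasurable (kop mu (restr_kernel C K) g) /\
    {ae mu, forall x, ccvg (fun N => \sum_(n < N) (s n)%:C * inner g (u n) * v n x)
                        (kop mu (restr_kernel C K) g x)} }.

(** The full weighted sum of squares has integral at most B, as the w n have norm at most 1. Thus it
    is finite on a set [D] of null complement, and [V] is its finite part. *)
Lemma summable_cut (s : nat -> R) (w : nat -> T -> R[i]) (B : R) :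
  (forall n, 0 <= s n) -> (forall N, \sum_(n < N) s n <= B) ->
  (forall n, L2 (w n)) -> (forall n, n2 (w n) <= 1) ->
  exists D V, [/\ measurable D, mu (~` D) = 0%E, mu.-integrable setT (EFin \o V),
    (forall x, 0 <= V x) & forall x N, D x -> \sum_(n < N) s n * cabs (w n x) ^+ 2 <= V x].
Proof.
move=> s0 sB lw nw; pose H x := (\sum_(n <oo) (s n * cabs (w n x) ^+ 2)%:E)%E.
have t0 n x : (0 <= (s n * cabs (w n x) ^+ 2)%:E)%E by rewrite lee_fin mulr_ge0 ?sqr_ge0.
have mt n : measurable_fun setT (fun x => (s n * cabs (w n x) ^+ 2)%:E).
  apply/measurable_EFinP/measurable_funM => //; apply: measurable_funX; apply: measurable_cabs.
  by case: (lw n).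
have mH : measurable_fun setT H by apply: ge0_emeasurable_sum.
have H0 x : (0 <= H x)%E by apply: nneseries_ge0.
have iH : (\int[mu]_x H x < +oo)%E.
  rewrite integral_nneseries//.
  apply: (@le_lt_trans _ _ B%:E); last by rewrite ltry.
  apply: lime_le.
    by apply: is_cvg_nneseries => n _ _; apply: integral_ge0.
  apply: nearW => N; rewrite big_mkord; apply: (@le_trans _ _ (\sum_(n < N) (s n)%:E)%E); last first.
    by rewrite sumEFin lee_fin.
  apply: lee_sum => n _; under eq_integral do rewrite EFinM.
  rewrite integralZl//; last exact: L2_cabs2_integrable.
  by rewrite -sqnormE -rsqnormK// -EFinM lee_fin ler_piMr.
have Hi : mu.-integrable setT H.
  apply/integrableP; split; first exact: mH.
  by rewrite (eq_integral H) => [|x _]; [exact: iH|rewrite gee0_abs].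
have mD : measurable [set x | H x \is a fin_num].
  by rewrite -[X in measurable X]setTI; apply: (emeasurable_fin_num measurableT mH).
exists [set x | H x \is a fin_num], (fun x => fine (H x)); split => //.
- have [N [mN N0 Ns]] := integrable_ae measurableT Hi.
  apply: (subset_measure0 _ mN _ N0) => //; first exact: measurableC.
  by move=> x /= Hx; apply: Ns => /= /(_ I).
- apply: (le_integrable _ _ _ Hi) => //; first by apply/measurable_EFinP; exact: measurableT_comp.
  by move=> x _ /=; case: (H x) (H0 x) => //= *; rewrite ?normr0 ?leey.
- by move=> x; exact: fine_ge0.
move=> x N /= Hx; rewrite -lee_fin fineK// -sumEFin -(big_mkord xpredT (fun n => (s n * cabs (w n x) ^+ 2)%:E)).
exact: nneseries_lim_ge.
Qed.

Lemma L2_restr (E : set T) g : measurable E -> L2 g -> L2 (fun x => (\1_E x)%:C * g x).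
Proof.
move=> mE lg; apply: (@L2_le _ _ _ _ _ g) => //.
  by apply: cmeasurableM; [exact: cmeasurable_indic|case: lg].
by move=> x; rewrite cabsM ler_piMl ?cabs_ge0 ?cabs_indic_le1.
Qed.

Lemma rsqnorm_restr (E : set T) g : measurable E -> L2 g -> n2 (fun x => (\1_E x)%:C * g x) <= n2 g.
Proof.
move=> mE lg; rewrite -lee_fin !rsqnormK//; last exact: L2_restr.
rewrite !sqnormE; apply: ge0_le_integral => //.
- by move=> x _; rewrite lee_fin sqr_ge0.
- apply/measurable_EFinP; apply: measurable_funX; apply: measurable_cabs.
  by case: (L2_restr mE lg).
- by apply/measurable_EFinP; apply: measurable_funX; apply: measurable_cabs; case: lg.
move=> x _; rewrite lee_fin lerXn2r ?nnegrE ?cabs_ge0// cabsM.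
by rewrite ler_piMl ?cabs_ge0 ?cabs_indic_le1.
Qed.

Lemma inner_restr (E : set T) g h :
  inner (fun x => (\1_E x)%:C * g x) h = inner g (fun x => (\1_E x)%:C * h x).
Proof.
rewrite /Defs.inner; congr cintegral; apply/funext => x.
by rewrite indicE; case: (_ \in _); rewrite /= ?mul1r// !mul0r conjc0 mulr0.
Qed.

(** The definition of trace class gives convergence in norm only. With the pointwise bounds the
    partial sums converge at every point, and Fatou identifies their limit with the operator almost
    everywhere. *)
Lemma trace_class_svd (K : T -> T -> R[i]) (C : set T) : measurable C ->
  trace_class mu (restr_kernel C K) -> exists B s v u V U, svd K C B s v u V U.
Proof.
move=> mC [dom [s [u0 [v0 [s0 sfin [lu0 ou0] [lv0 ov0] sv]]]]].
(* Vectors with singular value 0 are arbitrary functions, not even known to be square-integrable;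
   they are replaced by 0. *)
pose z (w : nat -> T -> R[i]) n x : R[i] := if s n == 0 then 0 else w n x.
have zL w : (forall n, s n != 0 -> L2 (w n)) -> forall n, L2 (z w n).
  by move=> lw n; rewrite /z; case: eqP => [_|/eqP sn]; [exact: L20|exact: lw].
have n20 : n2 (fun=> 0) = 0.
  have := inner_self mu (fun=> 0); rewrite inner0l => /(congr1 (@complex.Re R)).
  by rewrite ReC.
have zn w : (forall n, s n != 0 -> inner (w n) (w n) = 1) -> forall n, n2 (z w n) <= 1.
  move=> nw n; rewrite /z; case: eqP => [_|/eqP sn]; first by rewrite n20.
  by have := nw n sn; rewrite inner_self => /(congr1 (@complex.Re R)); rewrite ReC => ->.
have lv1 := zL v0 lv0; have lu1 := zL u0 lu0.
have nv1 : forall n, n2 (z v0 n) <= 1 by apply: zn => n sn; rewrite ov0// eqxx.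
have nu1 : forall n, n2 (z u0 n) <= 1 by apply: zn => n sn; rewrite ou0// eqxx.
pose B := fine (\sum_(n <oo) (s n)%:E)%E.
have sB N : \sum_(n < N) s n <= B.
  rewrite -lee_fin fineK; last first.
    by rewrite ge0_fin_numE//; apply: nneseries_ge0 => n _ _; rewrite lee_fin.
  rewrite -sumEFin -(big_mkord xpredT (fun n => (s n)%:E)).
  by apply: nneseries_lim_ge => n _ _; rewrite lee_fin.
have [DV [V [mDV DV0 iV V0 vV]]] := summable_cut s0 sB lv1 nv1.
have [DU [U [mDU DU0 iU U0 uU]]] := summable_cut s0 sB lu1 nu1.
(* The restriction to [C] is harmless: the operator ignores its argument off [C], and its values
   vanish there. The restriction to [DV] and [DU] affects null sets only and makes the weighted sums
   bounded at every point. *)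
pose v n x : R[i] := (\1_(C `&` DV) x)%:C * z v0 n x.
pose u n x : R[i] := (\1_(C `&` DU) x)%:C * z u0 n x.
have mCV : measurable (C `&` DV) by exact: measurableI.
have mCU : measurable (C `&` DU) by exact: measurableI.
have lv n : L2 (v n) by exact: L2_restr.
have lu n : L2 (u n) by exact: L2_restr.
have nv n : n2 (v n) <= 1 by apply: le_trans (nv1 n); exact: rsqnorm_restr.
have nu n : n2 (u n) <= 1 by apply: le_trans (nu1 n); exact: rsqnorm_restr.
have cut (D : set T) (w : nat -> T -> R[i]) (W : T -> R) : (forall x, 0 <= W x) ->
    (forall x N, D x -> \sum_(n < N) s n * cabs (w n x) ^+ 2 <= W x) ->
    forall x N, \sum_(n < N) s n * cabs ((\1_(C `&` D) x)%:C * w n x) ^+ 2 <= W x.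
  move=> W0 wW x N; rewrite indicE; case: (boolP (x \in _)) => xD.
    under eq_bigr do rewrite mul1r.
    by apply: wW; case: (set_mem xD).
  by rewrite big1// => n _; rewrite mul0r cabs0 expr0n mulr0.
exists B, s, v, u, V, U; split => //.
- by move=> n x xC; rewrite /u indicE memNset ?mul0r// => -[].
- exact: cut.
- exact: cut.
move=> g lg; set Kg := kop _ _ g; have [_ _ [mKg nKg]] := dom g lg.
split=> //.
have innerE n : s n != 0 -> inner (fun x => (\1_C x)%:C * g x) (u0 n) = inner g (u n).
  move=> sn; rewrite inner_restr /Defs.inner.
  apply: cintegral_ae_eq.
  - by apply: cmeasurableM; [case: lg|apply: cmeasurable_conj; case: (L2_restr mC (lu0 n sn))].
  - by apply: cmeasurableM; [case: lg|apply: cmeasurable_conj; case: (lu n)].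
  exists (~` DU); split => //; first exact: measurableC.
  move=> x /= /eqP ne Dx; move: ne; apply/negP; rewrite negbK; apply/eqP.
  by rewrite /u /z (negbTE sn) !indicE in_setI (mem_set Dx) andbT.
have KgC : kop mu (restr_kernel C K) (fun x => (\1_C x)%:C * g x) = Kg.
  apply/funext => x; rewrite /Kg /kop; congr cintegral; apply/funext => y.
  rewrite /restr_kernel -!mulrA; congr (_ * (_ * _)); rewrite mulrA; congr (_ * _).
  by rewrite indicE; case: (_ \in _); rewrite ?mulr1 ?mulr0.
have := sv _ (L2_restr mC lg); rewrite KgC => cv.
pose T_ N x := \sum_(n < N) (s n)%:C * inner g (u n) * v n x.
have lT N : L2 (T_ N).
  apply: L2_sum => n _.
  exact: L2Z.
have cvT : (fun N => sqnorm mu (fun x => Kg x - T_ N x)) @ \oo --> 0%E.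
  apply: (squeeze_cvge _ (cvg_cst 0%E) cv); apply: nearW => N.
  rewrite sqnorm_ge0/=.
  have lS : L2 (fun x => \sum_(n < N) (s n)%:C * inner (fun x0 => (\1_C x0)%:C * g x0) (u0 n) * v0 n x).
    apply: L2_sum => n _; have [sn|sn] := eqVneq (s n) 0.
      by under eq_fun do rewrite sn !mul0r; exact: L20.
    by apply: L2Z; exact: lv0.
  have lB := L2B (conj mKg nKg) lS.
  have -> : sqnorm mu (fun x => Kg x - T_ N x) = sqnorm mu (fun x => (\1_(C `&` DV) x)%:C * (Kg x -
      \sum_(n < N) (s n)%:C * inner (fun x0 => (\1_C x0)%:C * g x0) (u0 n) * v0 n x)).
    apply: sqnorm_ae.
    - by case: (L2B (conj mKg nKg) (lT N)).
    - by case: (L2_restr mCV lB).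
    exists (~` DV); split => //; first exact: measurableC.
    move=> x /= /eqP ne Dx; move: ne; apply/negP; rewrite negbK; apply/eqP.
    have -> : Kg x - T_ N x = (\1_(C `&` DV) x)%:C * Kg x - T_ N x.
      congr (_ - _); rewrite indicE in_setI (mem_set Dx) andbT.
      case: (boolP (x \in C)) => xC; first by rewrite mul1r.
      rewrite mul0r /Kg /kop /restr_kernel; under eq_fun do rewrite indicE (negbTE xC) !mul0r.
      exact: cintegral0.
    rewrite mulrBr; congr (_ - _); rewrite mulr_sumr; apply: eq_bigr => n _.
    have [sn|sn] := eqVneq (s n) 0; first by rewrite sn !mul0r mulr0.
    by rewrite innerE// /v /z (negbTE sn) mulrCA.
  by rewrite -!rsqnormK//; [rewrite lee_fin; exact: rsqnorm_restr|exact: L2_restr].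
(* The n-th term is at most s_n (|g|^2 + |v_n(x)|^2), where |g| is the norm of g; this is summable
   at every x. *)
have cvh x : exists h, ccvg (fun N => T_ N x) h.
  suff [h hP _] : exists2 h, ccvg (fun N => T_ N x) h & cabs h <= B * n2 g + V x by exists h.
  apply: (@ccvg_bounded_series _ (fun n => (s n)%:C * inner g (u n) * v n x)) => N.
  apply: (@le_trans _ _ (\sum_(n < N) (s n * n2 g + s n * cabs (v n x) ^+ 2))); last first.
    rewrite big_split/= lerD//; last exact: (cut _ _ _ V0 vV).
    by rewrite -mulr_suml; apply: ler_wpM2r; [exact: rsqnorm_ge0|exact: sB].
  apply: ler_sum => n _; rewrite cabsM [X in X * _]cabsM cabsC ger0_norm// -mulrA -mulrDr ler_wpM2l//.
  have := cauchy_schwarz lg (lu n).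
  have := nu n; have := rsqnorm_ge0 mu g; have := rsqnorm_ge0 mu (u n).
  move: (n2 (u n)) (n2 g) => a b a0 b0 a1 h.
  have : cabs (inner g (u n)) ^+ 2 <= b by rewrite (le_trans h)// ler_piMr.
  have := sqr_ge0 (cabs (inner g (u n)) - cabs (v n x)); rewrite sqrrB.
  have := mulr_ge0 (cabs_ge0 (inner g (u n))) (cabs_ge0 (v n x)).
  lra.
have [h hP] := choice cvh.
have mh : cmeasurable h by apply: cmeasurable_lim hP => N; case: (lT N).
have mKh : cmeasurable (fun x => Kg x - h x) by exact: cmeasurableB.
have : sqnorm mu (fun x => Kg x - h x) = 0%E.
  apply/eqP; rewrite eq_le sqnorm_ge0 andbT; apply/lee_addgt0Pr => e e0; rewrite add0e.
  have [N0 _ N0P] : \forall N \near \oo, (sqnorm mu (fun x => Kg x - T_ N x)%R <= e%:E)%E.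
    have /fine_cvgP[_ /cvgrPdist_le/(_ _ e0)] := cvT; apply: filterS => N /=.
    rewrite sub0r normrN -rsqnormK; last exact: (L2B (conj mKg nKg) (lT N)).
    by rewrite lee_fin; apply: le_trans; exact: ler_norm.
  apply: (@sqnorm_lim_le _ _ _ _ (fun N x => Kg x - T_ (N0 + N)%N x)) => //.
  - by move=> n; case: (L2B (conj mKg nKg) (lT (N0 + n)%N)).
  - apply: aeW => x; rewrite -[_ - h x]/(Kg x + - h x); apply: ccvgD; first exact: ccvg_cst.
    have [hr hi] := hP x; split.
      rewrite ReN; under eq_fun do rewrite ReN.
      by apply: cvgN; have := hr; rewrite -(cvg_shiftn N0); under eq_fun do rewrite addnC.
    rewrite ImN; under eq_fun do rewrite ImN.
    by apply: cvgN; have := hi; rewrite -(cvg_shiftn N0); under eq_fun do rewrite addnC.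
  - by move=> n; apply: N0P; rewrite /= leq_addr.
move=> /(sqnorm0_ae mKh); apply: filterS => x /eqP; rewrite subr_eq0 => /eqP ->.
exact: hP.
Qed.

End svd.

Section cintegral_restr.
Variables (d : measure_display) (T : measurableType d) (R : realType).
Variable mu : {measure set T -> \bar R}.

Lemma indicM_complex (D : set T) (z : R[i]) x :
  (\1_D x)%:C * z = (if x \in D then complex.Re z else 0) +i* (if x \in D then complex.Im z else 0).
Proof. by apply: complexP; rewrite (ReM, ImM) ReC ImC indicE; case: ifPn => _ /=; ring. Qed.

Lemma cintegral_mkcond (D : set T) (f : T -> R[i]) :
  cintegral mu D f = cintegral mu setT (fun x => (\1_D x)%:C * f x).
Proof.
apply: complexP; rewrite /cintegral /=; congr fine; rewrite integral_mkcond;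
  apply: eq_integral => x _; rewrite indicM_complex patchE; case: ifPn => //.
Qed.

Lemma cintegrable_mkcond (D : set T) (f : T -> R[i]) : measurable D ->
  cintegrable mu D f -> cintegrable mu setT (fun x => (\1_D x)%:C * f x).
Proof.
move=> mD [a b]; split.
  move/(integrable_mkcond _ mD).1 : a; apply: eq_integrable => // x _.
  by rewrite indicM_complex patchE; case: ifPn.
move/(integrable_mkcond _ mD).1 : b; apply: eq_integrable => // x _.
by rewrite indicM_complex patchE; case: ifPn.
Qed.

End cintegral_restr.

Lemma has_sum_ccvg (R : realType) (J : countType) (z : J -> R[i]) (w : R[i]) :
  has_sum z w -> ccvg (fun M => \sum_(m < M) oapp z 0 (@pickle_inv J m)) w.
Proof.
move=> zw; apply: ccvg_cabs0; apply/cvgrPdist_le => e e0.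
have [F0 F0P] := zw e e0.
pose F M : {fset J} := [fset j in pmap (@pickle_inv J) (iota 0 M)]%fset.
have FE M : \sum_(m < M) oapp z 0 (@pickle_inv J m) = \sum_(j <- F M) z j.
  rewrite -(big_mkord xpredT (fun m => oapp z 0 (@pickle_inv J m))) -big_pmap.
  apply: perm_big; apply: uniq_perm.
  - by apply: pmap_uniq; [exact: pickle_invK|rewrite /index_iota iota_uniq].
  - exact: fset_uniq.
  - by move=> j; rewrite /F !inE /index_iota subn0.
(* This number exceeds the code of every element of [F0], so from there on [F M] contains [F0]. *)
exists (\sum_(j <- F0) (choice.pickle j).+1)%N => // M /= FM.
rewrite sub0r normrN ger0_norm ?cabs_ge0// FE; apply: ltW.
have F0M : (F0 `<=` F M)%fset.
  apply/fsubsetP => j jF0; rewrite !inE mem_pmap; apply/mapP.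
  exists (choice.pickle j); last by rewrite pickleK_inv.
  rewrite mem_iota add0n; apply: leq_trans FM.
  by rewrite (big_rem j)//= leq_addr.
by have := F0P _ F0M; rewrite normc_def ltcR.
Qed.

(** * The kernel defined by the decomposition, and its identification *)

Section kernel_sum.
Variables (d : measure_display) (T : measurableType d) (R : realType).
Variable lam : {sigma_finite_measure set T -> \bar R}.
Notation L2 := (L2 lam).
Notation inner := (inner lam).
Notation n2 := (rsqnorm lam).
Variables (K : T -> T -> R[i]) (C : set T) (B : R) (s : nat -> R) (v u : nat -> T -> R[i]).
Variables (V U : T -> R).
Hypothesis mC : measurable C.
Hypothesis H : svd lam K C B s v u V U.

Let s0 := svd_s0 H.
Let lv := svd_lv H.
Let lu := svd_lu H.

Lemma cabs_inner_le1 g h : L2 g -> L2 h -> n2 g <= 1 -> n2 h <= 1 -> cabs (inner g h) <= 1.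
Proof.
move=> lg lh ng nh; rewrite -(ler_pXn2r (n:=2)) ?nnegrE ?cabs_ge0// expr1n.
apply: le_trans (cauchy_schwarz lg lh) _.
by rewrite mulr_ile1 ?rsqnorm_ge0.
Qed.

Lemma int_cabsM_le g h : L2 g -> L2 h ->
  (\int[lam]_x (cabs (g x * h x))%:E <= ((n2 g + n2 h) / 2)%:E)%E.
Proof.
move=> lg lh.
apply: (@le_trans _ _ (\int[lam]_x ((2^-1)%:E * ((cabs (g x) ^+ 2)%:E + (cabs (h x) ^+ 2)%:E)))%E).
  apply: ge0_le_integral => //.
  - by move=> x _; rewrite lee_fin cabs_ge0.
  - apply/measurable_EFinP; apply: measurable_cabs; apply: cmeasurableM; by [case: lg|case: lh].
  - by apply/measurable_funeM/measurable_EFinP/measurable_funD; apply: measurable_funX; apply: measurable_cabs; [case: lg|case: lh].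
  - move=> x _; rewrite -EFinD -EFinM lee_fin cabsM.
    have := sqr_ge0 (cabs (g x) - cabs (h x)); rewrite sqrrB; lra.
have ig := L2_cabs2_integrable lg; have ih := L2_cabs2_integrable lh.
rewrite integralZl//; last exact: integrableD.
rewrite integralD// -!sqnormE -!rsqnormK// -EFinD -EFinM lee_fin mulrC//.
Qed.

(** The majorants V and U give absolute convergence at every pair of points, so that [k] has
    definite values on the diagonal as well. *)
Lemma kernel_sum : exists k : T -> T -> R[i],
  forall x y, ccvg (fun N => \sum_(n < N) (s n)%:C * v n x * conjc (u n y)) (k x y).
Proof.
have h x y : exists z, ccvg (fun N => \sum_(n < N) (s n)%:C * v n x * conjc (u n y)) z.
  suff [z zP _] : exists2 z, ccvg (fun N => \sum_(n < N) (s n)%:C * v n x * conjc (u n y)) z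
    & cabs z <= V x + U y by exists z.
  apply: (@ccvg_bounded_series _ (fun n => (s n)%:C * v n x * conjc (u n y))) => N.
  apply: (@le_trans _ _ (\sum_(n < N) (s n * cabs (v n x) ^+ 2 + s n * cabs (u n y) ^+ 2))); last first.
    by rewrite big_split/= lerD// ?(svd_vV H) ?(svd_uU H).
  apply: ler_sum => n _; rewrite cabsM [X in X * _]cabsM cabsC ger0_norm// cabsJ -mulrA -mulrDr ler_wpM2l//.
  have := sqr_ge0 (cabs (v n x) - cabs (u n y)); rewrite sqrrB.
  have := mulr_ge0 (cabs_ge0 (v n x)) (cabs_ge0 (u n y)); lra.
have h' x : exists f : T -> R[i], forall y,
    ccvg (fun N => \sum_(n < N) (s n)%:C * v n x * conjc (u n y)) (f y).
  by have [f fP] := choice (h x); exists f.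
by have [k kP] := choice h'; exists k.
Qed.

Variable k : T -> T -> R[i].
Hypothesis kcv : forall x y, ccvg (fun N => \sum_(n < N) (s n)%:C * v n x * conjc (u n y)) (k x y).

Lemma kernel_sum_cmeasurable : @cmeasurable _ _ (T * T)%type (fun p => k p.1 p.2).
Proof.
apply: (@cmeasurable_lim _ _ _ (fun N p => \sum_(n < N) (s n)%:C * v n p.1 * conjc (u n p.2))) => [N|p]; last exact: kcv.
apply: cmeasurable_sum => n; apply: cmeasurableM; last by apply: cmeasurable_conj; apply: cmeasurable_snd; case: (lu n).
by apply: cmeasurableM; [exact: cmeasurable_cst|apply: cmeasurable_fst; case: (lv n)].
Qed.

Let sum_lty_le (F : nat -> \bar R) (c : R) : 0 <= c -> (forall n, 0 <= F n)%E -> (forall n, F n <= (s n * c)%:E)%E ->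
  (\sum_(n <oo) F n < +oo)%E.
Proof.
move=> c0 F0 FB; apply: (@le_lt_trans _ _ (B * c)%:E); last by rewrite ltry.
apply: lime_le; first exact: is_cvg_nneseries.
apply: nearW => N; rewrite big_mkord.
apply: (@le_trans _ _ (\sum_(n < N) (s n * c)%:E)%E); first by apply: lee_sum => n _.
by rewrite sumEFin lee_fin -mulr_suml ler_wpM2r// (svd_sB H).
Qed.

(** Each term is a tensor product, and the integral of its modulus is at most a constant times
    [s n]. With basis functions for phi and psi, this expands the kernel of the process of
    labels. *)
Lemma kernel_sum_form (phi psi : T -> R[i]) : L2 phi -> L2 psi ->
  ccvg (fun N => \sum_(n < N) (s n)%:C * (cintegral lam setT (fun x => v n x * phi x) *
      cintegral lam setT (fun y => conjc (u n y) * psi y)))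
    (cintegral (lam \x lam)%E setT (fun p => k p.1 p.2 * phi p.1 * psi p.2)).
Proof.
move=> lphi lpsi.
have luj n : L2 (fun y => conjc (u n y)) by exact: L2_conj.
have tens n := cintegral_tensor (L2_cintegrableM (lv n) lphi) (L2_cintegrableM (luj n) lpsi).
have [||||_ r2] := @cintegral_series _ _ _ (lam \x lam)%E
  (fun n (p : T * T) => (s n)%:C * ((v n p.1 * phi p.1) * (conjc (u n p.2) * psi p.2)))
  (fun p => k p.1 p.2 * phi p.1 * psi p.2).
- move=> n; apply: cmeasurableM; first exact: cmeasurable_cst.
  by have [/cintegrable_measurable] := tens n.
- apply: cmeasurableM; last by apply: cmeasurable_snd; case: lpsi.
  by apply: cmeasurableM; [exact: kernel_sum_cmeasurable|apply: cmeasurable_fst; case: lphi].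
- apply: aeW => p.
  have := ccvgM (ccvgM (kcv p.1 p.2) (ccvg_cst (phi p.1))) (ccvg_cst (psi p.2)).
  congr ccvg; apply/funext => N; rewrite !mulr_suml; apply: eq_bigr => n _; ring.
- apply: (@sum_lty_le _ ((1 + n2 phi) / 2 * ((1 + n2 psi) / 2))).
  + by rewrite mulr_ge0// divr_ge0// addr_ge0// rsqnorm_ge0.
  + by move=> n; apply: integral_ge0 => p _; rewrite lee_fin cabs_ge0.
  move=> n; under eq_integral do rewrite cabsM cabsC ger0_norm// EFinM.
  have [ti _] := tens n; have /cintegrableP[mt it] := ti.
  rewrite integralZl// EFinM lee_wpmul2l ?lee_fin//.
  rewrite fubini_tonelli1/=; last 2 first.
    by apply/measurable_EFinP; exact: measurable_cabs.
    by move=> p; rewrite lee_fin cabs_ge0.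
  have /cintegrableP[ma ia] := L2_cintegrableM (lv n) lphi.
  have /cintegrableP[mb ib] := L2_cintegrableM (luj n) lpsi.
  rewrite (eq_integral (fun x => (cabs (v n x * phi x))%:E * \int[lam]_y (cabs (conjc (u n y) * psi y))%:E)%E); last first.
    move=> x _; rewrite /fubini_F -integralZl//=.
    by apply: eq_integral => y _; rewrite cabsM.
  have gf := integrable_fin_num measurableT ib.
  rewrite -(fineK gf) integralZr// EFinM.
  have ff := integrable_fin_num measurableT ia.
  rewrite -(fineK ff) -!EFinM lee_fin; apply: ler_pM.
  + by apply/fine_ge0/integral_ge0 => x _; rewrite lee_fin cabs_ge0.
  + by apply/fine_ge0/integral_ge0 => x _; rewrite lee_fin cabs_ge0.
  + rewrite -lee_fin fineK//; apply: le_trans (int_cabsM_le (lv n) lphi) _.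
    by rewrite lee_fin ler_wpM2r// lerD2r (svd_nv H).
  rewrite -lee_fin fineK//; apply: le_trans (int_cabsM_le (luj n) lpsi) _.
  rewrite lee_fin ler_wpM2r// lerD2r.
  by rewrite rsqnorm_conj; exact: (svd_nu H).
move: r2; congr ccvg; apply/funext => N; apply: eq_bigr => n _.
have [t1 t2] := tens n.
by rewrite cintegralZ// t2.
Qed.

(** As the series converges at every point, its diagonal can be integrated term by term. *)
Lemma kernel_sum_diag (D : set T) : measurable D ->
  cintegrable lam setT (fun x => (\1_D x)%:C * k x x) /\
  ccvg (fun N => \sum_(n < N) (s n)%:C * inner (fun x => (\1_D x)%:C * v n x) (u n))
    (cintegral lam setT (fun x => (\1_D x)%:C * k x x)).
Proof.
move=> mD; have lDv n := L2_restr mD (lv n).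
have mk : cmeasurable (fun x => k x x).
  apply: (@cmeasurable_lim _ _ _ (fun N x => \sum_(n < N) (s n)%:C * v n x * conjc (u n x))) => [N|p]; last exact: kcv.
  apply: cmeasurable_sum => n; apply: cmeasurableM; last by apply: cmeasurable_conj; case: (lu n).
  by apply: cmeasurableM; [exact: cmeasurable_cst|case: (lv n)].
have m1 : cmeasurable (fun x : T => (\1_D x)%:C : R[i]) by exact: cmeasurable_indic.
have ii n := inner_cintegrable (lDv n) (lu n).
have [||||r1 r2] := @cintegral_series _ _ _ lam
  (fun n x => (s n)%:C * ((\1_D x)%:C * v n x * conjc (u n x))) (fun x => (\1_D x)%:C * k x x).
- by move=> n; apply: cmeasurableM; [exact: cmeasurable_cst|exact: cintegrable_measurable (ii n)].
- exact: cmeasurableM.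
- apply: aeW => x; have := ccvgM (ccvg_cst (\1_D x)%:C) (kcv x x).
  congr ccvg; apply/funext => N; rewrite mulr_sumr; apply: eq_bigr => n _; ring.
- apply: (@sum_lty_le _ 1) => // [n|n].
    by apply: integral_ge0 => p _; rewrite lee_fin cabs_ge0.
  under eq_integral do rewrite cabsM cabsC ger0_norm// EFinM.
  have /cintegrableP[mi ci] := ii n.
  rewrite integralZl// EFinM lee_wpmul2l ?lee_fin//.
  apply: le_trans (int_cabsM_le (lDv n) (L2_conj (lu n))) _; rewrite lee_fin.
  rewrite rsqnorm_conj.
  have := le_trans (rsqnorm_restr mD (lv n)) (svd_nv H n); have := svd_nu H n; lra.
split => //; move: r2; congr ccvg; apply/funext => N; apply: eq_bigr => n _.
by rewrite cintegralZ.
Qed.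

Section identification.
Variable gs : nat -> set T.
Hypothesis gsE : @measurable _ T = <<s range gs >>.
Hypothesis gsI : setI_closed (range gs).
Variable cov : nat -> set T.
Hypothesis covG : forall n, range gs (cov n).
Hypothesis covI : trivIset setT cov.
Hypothesis covT : \bigcup_n cov n = setT.
Hypothesis gsfin : forall n, (lam (gs n) < +oo)%E.
Hypothesis Cfin : (lam C < +oo)%E.
Hypothesis mK : @cmeasurable _ _ (T * T)%type (fun p => K p.1 p.2).
Hypothesis KC1 : {ae lam, forall x, cintegrable lam setT (restr_kernel C K x)}.

Let mgs n : measurable (gs n).
Proof. by rewrite gsE; apply: sub_gen_smallest; exists n. Qed.

Let restr_eq x y : C x -> C y -> restr_kernel C K x y = K x y.
Proof. by move=> Cx Cy; rewrite /restr_kernel !indicE !mem_set// mul1r mulr1. Qed.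

(** The operator is tested on the indicators of the countably many generators. For almost every x
    all these tests hold at once, and they say that the two sections at x have equal integrals over
    a generating pi-system. *)
Let section_eq : {ae lam, forall x, {ae lam, forall y, restr_kernel C K x y = k x y}}.
Proof.
have hk : {ae lam, forall x, forall m,
    ccvg (fun N => \sum_(n < N) (s n)%:C * inner (fun y => (\1_(gs m) y)%:C) (u n) * v n x)
      (kop lam (restr_kernel C K) (fun y => (\1_(gs m) y)%:C) x)}.
  apply: ae_foralln => m.
  by have [_] := svd_kop H (L2_indic (mgs m) (gsfin m)).
apply: filterS2 hk KC1 => x hx ix.
have mkx : cmeasurable (k x).
  apply: (@cmeasurable_lim _ _ _ (fun N y => \sum_(n < N) (s n)%:C * v n x * conjc (u n y))) => [N|p]; last exact: kcv.
  apply: cmeasurable_sum => n; apply: cmeasurableM; last by apply: cmeasurable_conj; case: (lu n).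
  exact: cmeasurable_cst.
have LC := L2_indic mC Cfin.
(* As [u n] vanishes off [C], which has finite measure, it is integrable and not merely
   square-integrable. *)
have uC n y : conjc (u n y) = (\1_C y)%:C * conjc (u n y).
  rewrite indicE; case: (boolP (y \in C)) => yC; first by rewrite mul1r.
  by rewrite (svd_Cu H) ?conjc0 ?mulr0//; move: yC; rewrite notin_setE.
have ser (g : T -> R[i]) : cmeasurable g -> (forall y, cabs (g y) <= 1) ->
    cintegrable lam setT (fun y => g y * k x y) /\
    ccvg (fun N => \sum_(n < N) cintegral lam setT (fun y => g y * ((s n)%:C * v n x * conjc (u n y))))
      (cintegral lam setT (fun y => g y * k x y)).
  move=> mg g1; have ui n : cintegrable lam setT (fun y => (\1_C y)%:C * conjc (u n y)).
    exact: inner_cintegrable.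
  apply: (@cintegral_series _ _ _ lam (fun n y => g y * ((s n)%:C * v n x * conjc (u n y)))
    (fun y => g y * k x y)).
  - move=> n; apply: cmeasurableM => //; apply: cmeasurableM; first exact: cmeasurable_cst.
    by apply: cmeasurable_conj; case: (lu n).
  - exact: cmeasurableM.
  - apply: aeW => y; have := ccvgM (ccvg_cst (g y)) (kcv x y).
    by congr ccvg; apply/funext => N; rewrite mulr_sumr.
  pose c := (n2 (fun x => (\1_C x)%:C) + 1) / 2.
  have c0 : 0 <= c by rewrite divr_ge0// addr_ge0// rsqnorm_ge0.
  have bnd n : (\int[lam]_y (cabs (g y * ((s n)%:C * v n x * conjc (u n y))))%:E <=
      ((s n * cabs (v n x)) * c)%:E)%E.
    have /cintegrableP[mu1 iu1] := ui n.
    apply: (@le_trans _ _ (\int[lam]_y ((s n * cabs (v n x))%:E * (cabs ((\1_C y)%:C * conjc (u n y)))%:E))%E).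
      apply: ge0_le_integral => //.
      + by move=> y _; rewrite lee_fin cabs_ge0.
      + apply/measurable_EFinP/measurable_cabs; apply: cmeasurableM => //; apply: cmeasurableM; first exact: cmeasurable_cst.
        by apply: cmeasurable_conj; case: (lu n).
      + by apply: measurable_funeM; exact: (measurable_int _ iu1).
      + move=> y _; rewrite -EFinM lee_fin cabsM -uC [cabs (_ * _ * _)]cabsM [cabs (_ * v n x)]cabsM cabsC ger0_norm//.
        by rewrite ler_piMl// mulr_ge0 ?cabs_ge0// mulr_ge0 ?cabs_ge0.
    rewrite integralZl// [leRHS]EFinM lee_wpmul2l ?lee_fin ?mulr_ge0 ?cabs_ge0//.
    apply: le_trans (int_cabsM_le LC (L2_conj (lu n))) _.
    rewrite lee_fin ler_wpM2r// lerD2l.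
    rewrite rsqnorm_conj.
    exact: (svd_nu H).
  apply: (@le_lt_trans _ _ ((B + V x) * c)%:E); last by rewrite ltry.
  apply: lime_le.
    by apply: is_cvg_nneseries => n _ _; apply: integral_ge0 => y _; rewrite lee_fin cabs_ge0.
  apply: nearW => N; rewrite big_mkord.
  apply: (@le_trans _ _ (\sum_(n < N) ((s n * cabs (v n x)) * c)%:E)%E); first by apply: lee_sum => n _.
  rewrite sumEFin lee_fin -mulr_suml ler_wpM2r//.
  apply: (@le_trans _ _ (\sum_(n < N) (s n + s n * cabs (v n x) ^+ 2))).
    apply: ler_sum => n _; rewrite -[X in _ <= X + _]mulr1 -mulrDr ler_wpM2l//.
    have := sqr_ge0 (1 - cabs (v n x)); rewrite sqrrB expr1n mul1r; have := cabs_ge0 (v n x); lra.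
  by rewrite big_split/= lerD// ?(svd_sB H) ?(svd_vV H).
apply: (cintegral_pi_eq gsE gsI covG covI covT ix).
  have [+ _] := ser (fun=> 1) (cmeasurable_cst _ 1) (fun _ => ltac:(by rewrite cabs1)).
  by under eq_fun do rewrite mul1r.
move=> m; have m1 : cmeasurable (fun y : T => (\1_(gs m) y)%:C : R[i]).
  by exact: cmeasurable_indic.
have [_ sc] := ser _ m1 (cabs_indic_le1 R (gs m)).
apply: (ccvg_unique _ sc); have := hx m; rewrite /kop.
have -> : (fun y => restr_kernel C K x y * (\1_(gs m) y)%:C) = (fun y => (\1_(gs m) y)%:C * restr_kernel C K x y).
  by apply/funext => y; rewrite mulrC.
congr ccvg; apply/funext => N; apply: eq_bigr => n _.
have -> : (fun y => (\1_(gs m) y)%:C * ((s n)%:C * v n x * conjc (u n y))) =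
  (fun y => ((s n)%:C * v n x) * ((\1_(gs m) y)%:C * conjc (u n y))).
  by apply/funext => y; rewrite mulrCA.
rewrite cintegralZ; last by apply: inner_cintegrable; [exact: (L2_indic (mgs m) (gsfin m))|].
by rewrite /Defs.inner; ring.
Qed.

Lemma kernel_ae_eq : {ae (lam \x lam)%E, forall q, C q.1 -> C q.2 -> K q.1 q.2 = k q.1 q.2}.
Proof.
pose N : set (T * T) := (C `*` C) `&` ~` [set q | K q.1 q.2 = k q.1 q.2].
have mN : measurable N.
  apply: measurableI; first exact: measurableX.
  by apply: measurableC; apply: measurable_set_ceq => //; exact: kernel_sum_cmeasurable.
exists N; split => //; last first.
  move=> q /= /not_implyP[C1 /not_implyP[C2 ne]]; split => //.
rewrite /product_measure1 /=.
rewrite (ge0_ae_eq_integral _ _ (measurable_cst 0%E)) ?integral0//.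
- exact: measurable_fun_xsection.
- apply: filterS section_eq => x [M [mM M0 Ms]] _ /=.
  apply: (subset_measure0 _ mM _ M0) => //; first exact: measurable_xsection.
  move=> y; rewrite /xsection/= inE => -[[Cx Cy] /= ne]; apply: Ms => /=.
  by rewrite restr_eq.
Qed.

Variables (J : countType) (e : J -> T -> R[i]).
Hypothesis onb : orthonormal_basis lam e.
Hypothesis KV : forall D, measurable D -> D `<=` C -> cintegrable lam D (fun x => K x x) /\
  is_trace lam (restr_kernel D K) (cintegral lam D (fun x => K x x)).

Let le_e j : L2 (e j). Proof. by case: onb => -[+ _] _; exact. Qed.

(** The j-th diagonal coefficient is the sum over n of s_n <1_D v_n, e_j> conj(<1_D u_n, e_j>). By
    Bessel the double series in n and j converges absolutely, with row sums at most s_n. Summing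
    over j first, Parseval leaves s_n <1_D v_n, u_n>, and [kernel_sum_diag] adds these up to the
    integral of k(x, x) over D. *)
Lemma trace_kernel_sum (D : set T) (w : R[i]) : measurable D -> D `<=` C ->
  is_trace lam (restr_kernel D K) w ->
  w = cintegral lam setT (fun x => (\1_D x)%:C * k x x).
Proof.
move=> mD DC /(_ J e onb) /has_sum_ccvg zw.
have [_ dcv] := kernel_sum_diag mD.
pose Dv n x := (\1_D x)%:C * v n x.
pose Du n x := (\1_D x)%:C * u n x.
have lDv n : L2 (Dv n) by exact: L2_restr.
have lDu n : L2 (Du n) by exact: L2_restr.
have nDv n : n2 (Dv n) <= 1 by apply: le_trans (svd_nv H n); exact: rsqnorm_restr.
have nDu n : n2 (Du n) <= 1 by apply: le_trans (svd_nu H n); exact: rsqnorm_restr.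
have abs_le n j : cabs (inner (Dv n) (e j) * conjc (inner (Du n) (e j))) <=
    cabs (inner (Dv n) (e j)) ^+ 2 / 2 + cabs (inner (Du n) (e j)) ^+ 2 / 2.
  rewrite cabsM cabsJ; have := sqr_ge0 (cabs (inner (Dv n) (e j)) - cabs (inner (Du n) (e j))).
  rewrite sqrrB; lra.
pose z j := inner (kop lam (restr_kernel D K) (e j)) (e j).
have zE j : ccvg (fun N => \sum_(n < N) (s n)%:C * (inner (Dv n) (e j) * conjc (inner (Du n) (e j)))) (z j).
  have lDe : L2 (fun x => (\1_D x)%:C * e j x) by exact: L2_restr.
  have [mk kcvj] := svd_kop H lDe.
  have kopE : kop lam (restr_kernel D K) (e j) =
      (fun x => (\1_D x)%:C * kop lam (restr_kernel C K) (fun x => (\1_D x)%:C * e j x) x).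
    apply/funext => x; rewrite /kop /restr_kernel [\1_D x]indicE.
    case: (boolP (x \in D)) => xD; last first.
      by rewrite mul0r; under eq_fun do rewrite !mul0r; exact: cintegral0.
    rewrite mul1r; congr cintegral; apply/funext => y.
    rewrite mul1r [\1_C x]indicE (mem_set (DC _ (set_mem xD))) mul1r -!mulrA; congr (_ * _).
    rewrite !indicE; case: (boolP (y \in D)) => yD; last by rewrite !mul0r mulr0.
    by rewrite (mem_set (DC _ (set_mem yD))) !mul1r.
  have m1 : cmeasurable (fun x : T => (\1_D x)%:C : R[i]) by exact: cmeasurable_indic.
  have [||||_] := @cintegral_series _ _ _ lam
    (fun n x => ((s n)%:C * conjc (inner (Du n) (e j))) * (Dv n x * conjc (e j x)))
    (fun x => kop lam (restr_kernel D K) (e j) x * conjc (e j x)).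
  - move=> n; apply: cmeasurableM; first exact: cmeasurable_cst.
    exact: (cintegrable_measurable (inner_cintegrable (lDv n) (le_e j))).
  - rewrite kopE; apply: cmeasurableM; last by apply: cmeasurable_conj; case: (le_e j).
    exact: cmeasurableM.
  - apply: filterS kcvj => x hx; rewrite kopE.
    have := ccvgM (ccvgM (ccvg_cst (\1_D x)%:C) hx) (ccvg_cst (conjc (e j x))).
    congr ccvg; apply/funext => N; rewrite mulr_sumr mulr_suml; apply: eq_bigr => n _.
    rewrite inner_restr (inner_conj (lDu n) (le_e j)) /Dv; ring.
  - apply: (@sum_lty_le _ 1) => // [n|n].
      by apply: integral_ge0 => p _; rewrite lee_fin cabs_ge0.
    have [[_ oe] _] := onb.
    have ne : n2 (e j) = 1.
      by have := oe j j I I; rewrite inner_self eqxx => /(congr1 (@complex.Re R)); rewrite ReC.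
    under eq_integral do rewrite cabsM EFinM.
    have /cintegrableP[mi ci] := inner_cintegrable (lDv n) (le_e j).
    rewrite integralZl// [cabs (_ * _)]cabsM cabsC ger0_norm// cabsJ.
    rewrite EFinM [leRHS]EFinM -muleA lee_wpmul2l ?lee_fin//.
    have h1 : cabs (inner (Du n) (e j)) <= 1 by apply: cabs_inner_le1 => //; rewrite ne.
    have h2 : (\int[lam]_x (cabs (Dv n x * conjc (e j x)))%:E <= 1)%E.
      apply: le_trans (int_cabsM_le (lDv n) (L2_conj (le_e j))) _; rewrite lee_fin.
      rewrite rsqnorm_conj.
      by rewrite ne; have := nDv n; lra.
    have := @lee_pmul _ (cabs (inner (Du n) (e j)))%:E 1%:E _ _ _ _ _ h2.
    rewrite mule1; apply; rewrite ?lee_fin ?cabs_ge0//.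
    by apply: integral_ge0 => x _; rewrite lee_fin cabs_ge0.
  congr ccvg; apply/funext => N; apply: eq_bigr => n _.
  rewrite cintegralZ; last exact: inner_cintegrable.
  by rewrite /Defs.inner; ring.
pose t n m : R[i] := (s n)%:C * oapp (fun j => inner (Dv n) (e j) * conjc (inner (Du n) (e j))) 0 (@pickle_inv J m).
have tB n M : \sum_(m < M) cabs (t n m) <= s n.
  apply: (@le_trans _ _ (\sum_(m < M) s n * (oapp (fun j => cabs (inner (Dv n) (e j)) ^+ 2) 0 (@pickle_inv J m) / 2 +
     oapp (fun j => cabs (inner (Du n) (e j)) ^+ 2) 0 (@pickle_inv J m) / 2))).
    apply: ler_sum => m _; rewrite /t cabsM cabsC ger0_norm// ler_wpM2l//.
    by case: (pickle_inv _) => [j|] /=; rewrite ?cabs0 ?mul0r ?addr0//.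
  rewrite -mulr_sumr ler_piMr// big_split/= -!mulr_suml.
  have := onb_bessel onb M (lDv n); have := onb_bessel onb M (lDu n).
  have := nDv n; have := nDu n; lra.
(* The sum over the basis is written as an integral over the codes m, so that [cintegral_series]
   exchanges it with the sum over n. *)
pose cnt : {measure set nat -> \bar R} := counting.
have codeK : pcancel (@id nat) (@Some nat) by [].
have decK : ocancel (@Some nat) (@id nat) by [].
have mnat (A : set nat) : measurable A by [].
have tI n : cintegrable cnt setT (t n) /\
    ccvg (fun M => \sum_(m < M) t n m) (cintegral cnt setT (t n)).
  exact: (cintegral_counting codeK decK mnat (z := t n) (tB n)).
have tint n : cintegral cnt setT (t n) = (s n)%:C * inner (Dv n) (u n).
  have [_ tc] := tI n; apply: (ccvg_unique tc).
  have := ccvgM (ccvg_cst (s n)%:C) (parseval onb (lDv n) (lDu n)).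
  have -> : inner (Dv n) (Du n) = inner (Dv n) (u n).
    rewrite -inner_restr; congr Defs.inner; apply/funext => x.
    by rewrite /Dv indicE; case: (_ \in _); rewrite ?mul1r ?mul0r.
  by congr ccvg; apply/funext => M; rewrite mulr_sumr.
pose z' m := oapp z 0 (@pickle_inv J m).
have z'E m : ccvg (fun N => \sum_(n < N) t n m) (z' m).
  rewrite /z' /t; case: (pickle_inv m) => [j|] /=; first exact: zE.
  under eq_fun do under eq_bigr do rewrite mulr0.
  by under eq_fun do rewrite big1//; exact: ccvg_cst.
have z'B M : \sum_(m < M) cabs (z' m) <= B.
  have cv : (fun N => \sum_(m < M) cabs (\sum_(n < N) t n m)) @ \oo --> \sum_(m < M) cabs (z' m).
    elim: M => [|M IH].
      by rewrite big_ord0; under eq_fun do rewrite big_ord0; exact: cvg_cst.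
    rewrite big_ord_recr; under eq_fun do rewrite big_ord_recr.
    by apply: cvgD IH _; exact: ccvg_cabs.
  rewrite -(cvg_lim (@Rhausdorff R) cv); apply: limr_le.
    by apply/cvg_ex; eexists; exact: cv.
  apply: nearW => N; apply: le_trans (svd_sB H N).
  apply: (@le_trans _ _ (\sum_(m < M) \sum_(n < N) cabs (t n m))).
    by apply: ler_sum => m _; exact: cabs_sum.
  by rewrite exchange_big/=; apply: ler_sum => n _; exact: tB.
have [||||_ zc] := @cintegral_series _ _ _ cnt t z'.
- by move=> n; exact: cmeasurable_discrete.
- exact: cmeasurable_discrete.
- by apply: aeW => m; exact: z'E.
- apply: (@sum_lty_le _ 1) => // [n|n].
    by apply: integral_ge0 => p _; rewrite lee_fin cabs_ge0.
  have [] := @ge0_integrable_counting _ _ _ id Some codeK decK mnat (fun m => cabs (t n m)) (s n) _ (tB n).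
    by move=> m; exact: cabs_ge0.
  by rewrite mulr1.
have [_ zc'] := @cintegral_counting _ _ _ id Some codeK decK mnat z' B z'B.
rewrite -(ccvg_unique zc' zw); apply: (ccvg_unique zc).
by move: dcv; congr ccvg; apply/funext => N; apply: eq_bigr => n _; rewrite tint.
Qed.

(** Both diagonals integrate over D to the trace of the operator restricted to D, for every
    measurable D inside C. The sets [gs n] cut down to C are enough to separate integrable functions
    on C. *)
Lemma kernel_diag_ae_eq : {ae lam, forall x, C x -> K x x = k x x}.
Proof.
have [iC _] := KV mC (@subset_refl _ C).
have iKC := cintegrable_mkcond mC iC.
have [ikC _] := kernel_sum_diag mC.
have : {ae lam, forall x, (\1_C x)%:C * K x x = (\1_C x)%:C * k x x}.
  apply: (cintegral_pi_eq gsE gsI covG covI covT iKC ikC) => n.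
  have mgC : measurable (gs n `&` C) by exact: measurableI.
  have E (f : T -> R[i]) : (fun x => (\1_(gs n) x)%:C * ((\1_C x)%:C * f x)) = (fun x => (\1_(gs n `&` C) x)%:C * f x).
    apply/funext => x; rewrite mulrA -rmorphM/= !indicE in_setI -natrM mulnb//.
  rewrite !E -cintegral_mkcond; apply: trace_kernel_sum => //.
  by have [_] := KV mgC (@subIsetr _ _ _).
apply: filterS => x + Cx; rewrite indicE mem_set// !mul1r.
by [].
Qed.

End identification.
End kernel_sum.

(** * The basis of a level *)

Section cells.
Variables (R : realType) (S : ptopologicalType) (I : pcountType).
Variable lam : {measure set (borel S) -> \bar R}.
Variables (A : I -> seq bool -> set S).
Hypothesis HA : nested_partitions lam A.

Lemma cell_sub i w w' : prefix w w' -> A i w' `<=` A i w.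
Proof.
move=> pw; have [sw|] := ltnP (size w) (size w').
  by apply/(cells_nested HA _ _ sw).
move=> ws; suff -> : w = w' by [].
move: pw; rewrite prefixE => /eqP <-.
by rewrite take_oversize.
Qed.

Lemma cell_eq i w i' w' x : size w = size w' -> A i w x -> A i' w' x -> (i, w) = (i', w').
Proof.
move=> sw Ax A'x; apply: (@cells_disjoint _ _ _ _ _ HA (size w)) => //=.
by exists x.
Qed.

Lemma cell_level l x : exists i w, size w = l /\ A i w x.
Proof.
have : [set: S] x by [].
by rewrite -(cells_cover HA l) => -[_ [[i w]/= wl <-] Aiw]; exists i, w.
Qed.

Lemma cell_child i w x : A i w x -> exists b, A i (rcons w b) x.
Proof.
move=> Ax; have [i' [w' [sw' Ax']]] := cell_level (size w).+1 x.
have w'E : w' = rcons (take (size w) w') (last false w').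
  elim/last_ind : w' sw' {Ax'} => // w' b _; rewrite size_rcons => -[sw].
  by rewrite last_rcons -cats1 take_size_cat// cats1.
have Axt : A i' (take (size w) w') x by apply: cell_sub Ax'; exact: prefix_take.
have := @cell_eq _ _ _ _ _ _ Ax Axt; rewrite size_take sw' ltnSn => /(_ erefl) [ii ww].
by exists (last false w'); rewrite ii {1}ww -w'E.
Qed.

Lemma cell_below i w i' w' x : (size w <= size w')%N -> A i w x -> A i' w' x ->
  i = i' /\ take (size w) w' = w.
Proof.
move=> sw Ax A'x.
have Axt : A i' (take (size w) w') x by apply: cell_sub A'x; exact: prefix_take.
have := @cell_eq _ _ _ _ _ _ Ax Axt; rewrite size_takel// => /(_ erefl) [-> ww].
by split => //; rewrite -ww.
Qed.

Lemma cell_nonempty i w : exists x, A i w x.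
Proof.
apply: contrapT => /forallNP h; have := cells_pos HA i w.
rewrite (_ : A i w = set0) ?measure0 ?ltxx//.
by apply/seteqP; split => // x; exact: h.
Qed.

(** The sets that contain or avoid a fixed cell form a sigma-algebra, and the cells of coarser or
    equal level belong to it since cells are nested or disjoint. *)
Lemma level_sigma_cell k C i w : (k <= size w)%N -> <<s level_cells A k >> C ->
  A i w `<=` C \/ A i w `&` C = set0.
Proof.
move=> kw; move: C; apply: smallest_sub.
  split.
  - by right; rewrite setI0.
  - move=> C [h|h]; rewrite setTD; [right|left].
      by rewrite -subset0 => x [/h].
    by move=> x Ax Cx; have : (A i w `&` C) x by []; rewrite h.
  - move=> F hF; have [[n An]|h] := pselect (exists n, A i w `<=` F n).
      by left; apply: subset_trans An _; exact: bigcup_sup.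
    right; rewrite setI_bigcupr bigcup0// => n _.
    by case: (hF n) => // An; exfalso; apply: h; exists n.
move=> _ [[i' w']/= w'k <-].
have [/eqP h|/set0P[x [Ax A'x]]] := eqVneq (A i w `&` A i' w') set0; first by right; exact/eqP.
left; have [|-> tw] := cell_below _ A'x Ax; first by rewrite w'k.
by apply: cell_sub; rewrite prefixE tw.
Qed.

Variable f : I -> seq bool -> S -> R.
Hypothesis Hf : adapted_basis lam A f.
Hypothesis Afin : forall i w, (lam (A i w) < +oo)%E.

Let ind (B : set (borel S)) (x : borel S) : R[i] := (\1_B x)%:C.
Notation inner := (@inner R _ (borel S) lam).
Notation L2 := (@L2 R _ (borel S) lam).
Let F (j : basis_index I) (x : borel S) : R[i] := (f (val j).1 (val j).2 x)%:C.

Let LA i w : L2 (ind (A i w)).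
Proof. by apply: L2_indic; [exact: (cells_measurable HA)|exact: Afin]. Qed.

Let LF j : L2 (F j).
Proof. by case: (basis_onb Hf) => -[+ _] _; exact. Qed.

(** The fibre of the function through a point of the cell belongs to the sigma-algebra of its level;
    as it meets the cell, it contains it. *)
Lemma basis_cell_const (j : basis_index I) i w : (size (val j).2 <= size w)%N ->
  exists c, forall x, A i w x -> f (val j).1 (val j).2 x = c.
Proof.
move=> jw; have [x0 Ax0] := cell_nonempty i w.
exists (f (val j).1 (val j).2 x0) => x Ax.
have : <<s level_cells A (size (val j).2) >>
    (f (val j).1 (val j).2 @^-1` [set f (val j).1 (val j).2 x0]).
  rewrite -(basis_sigma Hf); apply: sub_sigma_algebra.
  by exists j, [set f (val j).1 (val j).2 x0].
move=> /(level_sigma_cell i jw) [/(_ _ Ax)//|h].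
by have : (A i w `&` f (val j).1 (val j).2 @^-1` [set f (val j).1 (val j).2 x0]) x0 by [];
  rewrite h.
Qed.

Let child_index i w : basis_index I :=
  exist _ (i, rcons w false) (introT negPf (last_rcons false w false)).

Lemma ind_split i w x : ind (A i w) x = ind (A i (rcons w false)) x + ind (A i (rcons w true)) x.
Proof.
have sub b : A i (rcons w b) `<=` A i w by apply: cell_sub; rewrite -cats1 prefix_prefix.
rewrite /ind !indicE -rmorphD/=; congr (_%:C); rewrite -natrD; congr (_%:R).
have [xA|xA] := boolP (x \in A i w); last first.
  have nA : ~ A i w x by move: xA; rewrite notin_setE.
  by rewrite !memNset// => /sub/nA.
have [b xb] := cell_child (set_mem xA).
have nb : x \notin A i (rcons w (~~ b)).
  rewrite notin_setE => xb'; have := @cell_eq _ _ _ _ x _ xb xb'.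
  by rewrite !size_rcons => /(_ erefl) []; apply/eqP; rewrite eqseq_rcons negb_and; case: (b); rewrite orbT.
by have := mem_set xb; case: (b) nb => /= /negbTE -> ->.
Qed.

(** The function is constant on both children of (i, w). The coefficient [a0] is nonzero because the
    support is the entire parent cell. *)
Lemma child_fun i w : exists a0 a1 : R, a0 != 0 /\ forall x,
  (f i (rcons w false) x)%:C = a0%:C * ind (A i (rcons w false)) x + a1%:C * ind (A i (rcons w true)) x.
Proof.
have [a0 h0] := @basis_cell_const (child_index i w) i (rcons w false) (leqnn _).
have [a1 h1] := @basis_cell_const (child_index i w) i (rcons w true)
  (eq_leq (etrans (size_rcons _ _) (esym (size_rcons _ _)))).
rewrite /= in h0 h1.
have supp x : (f i (rcons w false) x != 0) <-> A i w x.
  have := basis_support Hf (child_index i w); rewrite /basis_supp/= size_rcons/=.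
  rewrite -cats1 take_size_cat// cats1 => /seteqP[s1 s2].
  by split => [/s1|/s2].
exists a0, a1; split.
  have [x Ax] := cell_nonempty i (rcons w false); rewrite -(h0 x Ax).
  by apply/supp; apply: cell_sub Ax; rewrite -cats1 prefix_prefix.
move=> x; have [xA|xA] := pselect (A i w x); last first.
  have sub b : A i (rcons w b) `<=` A i w by apply: cell_sub; rewrite -cats1 prefix_prefix.
  rewrite /ind !indicE !memNset ?mulr0 ?addr0; [|by move/sub|by move/sub].
  by congr (_%:C); apply/eqP/negPn/negP => /supp.
have [b xb] := cell_child xA.
have nb : x \notin A i (rcons w (~~ b)).
  rewrite notin_setE => xb'; have := @cell_eq _ _ _ _ x _ xb xb'.
  by rewrite !size_rcons => /(_ erefl) []; apply/eqP; rewrite eqseq_rcons negb_and; case: (b); rewrite orbT.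
rewrite /ind !indicE; have := mem_set xb; case: (b) nb xb => /= /negbTE -> xb -> /=.
  by rewrite mulr0 add0r mulr1 (h1 x xb).
by rewrite mulr0 addr0 mulr1 (h0 x xb).
Qed.

Let innerDr g h h' : L2 g -> L2 h -> L2 h' ->
  inner g (fun x => h x + h' x) = inner g h + inner g h'.
Proof.
move=> lg lh lh'; rewrite (inner_conj (L2D lh lh') lg) innerDl//.
by rewrite (inner_conj lh lg) (inner_conj lh' lg); exact: rmorphD.
Qed.

Let innerZr (c : R) g h : L2 g -> L2 h -> inner g (fun x => c%:C * h x) = c%:C * inner g h.
Proof.
move=> lg lh; rewrite (inner_conj (L2Z c%:C lh) lg) innerZl// (inner_conj lh lg).
by rewrite -[in RHS](conjc_real c); exact: rmorphM.
Qed.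

Let inner_ind i w : inner (ind (A i w)) (ind (A i w)) = (fine (lam (A i w)))%:C.
Proof.
by rewrite inner_self /rsqnorm [sqnorm _ _]sqnorm_indic//; exact: (cells_measurable HA).
Qed.

Let inner_ind0 i w i' w' : size w = size w' -> (i, w) != (i', w') ->
  inner (ind (A i w)) (ind (A i' w')) = 0.
Proof.
move=> sw ne; rewrite /Defs.inner (_ : (fun x => _) = fun=> 0) ?cintegral0//.
apply/funext => x; have [Ax|Ax] := boolP (x \in A i w); last first.
  by rewrite /ind indicE (negbTE Ax) mul0r.
rewrite /ind [\1_(A i' w') x]indicE memNset ?conjc0 ?mulr0// => A'x.
by move: ne; rewrite (cell_eq sw (set_mem Ax) A'x) eqxx.
Qed.

Let lamE i w : 0 < fine (lam (A i w)).
Proof. by rewrite fine_gt0// (cells_pos HA) Afin. Qed.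

(** In effect, indicators of cells of a level lie in the span of the basis functions up to that
    level. By induction g is orthogonal to the parent indicator; together with the basis function on
    the parent this gives a 2 by 2 linear system for the inner products with the two children, of
    determinant a1 - a0. *)
Lemma perp_cell l g : L2 g -> (forall j, (size (val j).2 <= l)%N -> inner g (F j) = 0) ->
  forall i w, size w = l -> inner g (ind (A i w)) = 0.
Proof.
elim: l g => [|l ih] g lg gF i w.
  move=> /size0nil ->.
  have := gF (exist _ (i, [::]) isT) (leqnn _); rewrite /F/= (basis_rank1 Hf).
  set c : R := (Num.sqrt (fine (lam (A i [::]))))^-1.
  have -> : (fun x => (normalized_indic lam (A i [::]) x)%:C) = (fun x => c%:C * ind (A i [::]) x) :> (S -> R[i]).
    by apply/funext => x; rewrite /normalized_indic mulrC rmorphM.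
  rewrite innerZr// => /eqP; rewrite mulf_eq0 => /orP[/eqP h|/eqP//].
  by have := lamE i [::]; rewrite -sqrtr_gt0 -invr_gt0 -/c (_ : c = 0) ?ltxx//; move/(congr1 (@complex.Re R)): h.
elim/last_ind : w => // w b _; rewrite size_rcons => -[wl].
have [a0 [a1 [a0n hE]]] := child_fun i w.
set P0 := A i (rcons w false); set P1 := A i (rcons w true).
have spl : ind (A i w) = (fun x => ind P0 x + ind P1 x) by apply/funext => x; exact: ind_split.
have Fh : F (child_index i w) = (fun x => a0%:C * ind P0 x + a1%:C * ind P1 x).
  by apply/funext => x; exact: hE.
have G0 : inner g (ind P0) + inner g (ind P1) = 0.
  have : inner g (ind (A i w)) = 0.
    by apply: ih => // j jl; apply: gF; rewrite (leq_trans jl).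
  by rewrite spl innerDr//; exact: LA.
have G1 : a0%:C * inner g (ind P0) + a1%:C * inner g (ind P1) = 0.
  have : inner g (F (child_index i w)) = 0 by apply: gF; rewrite /= size_rcons wl.
  by rewrite Fh innerDr ?innerZr//; do ?apply: L2Z; exact: LA.
(* The induction hypothesis is applied to the basis function itself: being orthogonal to all basis
   functions of lower level, it is orthogonal to the indicator of the parent. *)
have H1 : a0 * fine (lam P0) + a1 * fine (lam P1) = 0.
  have : inner (F (child_index i w)) (ind (A i w)) = 0.
    apply: ih => // j jl; have [[_ oe] _] := basis_onb Hf; rewrite oe//.
    case: eqP => // jE; move: jl; rewrite -jE /= size_rcons wl ltnn//.
  rewrite Fh innerDl//; [|exact/L2Z/LA|exact/L2Z/LA].
  rewrite !innerZl//; [|exact: LA|exact: LA].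
  rewrite spl !innerDr//; do ?exact: LA.
  rewrite !inner_ind.
  rewrite !inner_ind0 ?size_rcons// ?addr0 ?add0r; last 2 first.
    by rewrite xpair_eqE eqseq_rcons andbF ?andbF.
    by rewrite xpair_eqE eqseq_rcons andbF ?andbF.
  by rewrite -!rmorphM -rmorphD/= => /(congr1 (@complex.Re R)).
have l0 : 0 < fine (lam P0) by exact: lamE.
have l1 : 0 < fine (lam P1) by exact: lamE.
(* Both children have positive measure, so a0 = a1 would force a0 = 0 in the preceding relation. *)
have a01 : a0 - a1 != 0.
  apply/negP; rewrite subr_eq0 => /eqP a01; move: H1; rewrite -a01 -mulrDr => /eqP.
  by rewrite mulf_eq0 (negbTE a0n)/= gt_eqF// addr_gt0.
have G00 : inner g (ind P0) = 0.
  have : (a0 - a1)%:C * inner g (ind P0) = 0.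
    rewrite rmorphB/= mulrBl; move/eqP: G0; rewrite addr_eq0 => /eqP G0.
    have G0' : inner g (ind P1) = - inner g (ind P0) by rewrite G0 opprK.
    by rewrite -[RHS]G1 G0' mulrN.
  move/eqP; rewrite mulf_eq0 => /orP[|/eqP//].
  by move=> /eqP /(congr1 (@complex.Re R)) /= /eqP; rewrite (negbTE a01).
case: b => //.
by move: G0; rewrite G00 add0r.
Qed.

(** Induction on the number of levels between the cell and level l: an indicator is the sum of those
    of the two children. *)
Lemma perp_cell_up g l : L2 g -> (forall i w, size w = l -> inner g (ind (A i w)) = 0) ->
  forall i w, (size w <= l)%N -> inner g (ind (A i w)) = 0.
Proof.
move=> lg gA i w; elim: {w}(l - size w)%N {-2}w (erefl (l - size w)%N) => [|n ih] w.
  move=> /eqP; rewrite subn_eq0 => lw wl; apply: gA; apply/eqP; rewrite eqn_leq wl.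
  exact: lw.
move=> wn wl.
have -> : ind (A i w) = (fun x => ind (A i (rcons w false)) x + ind (A i (rcons w true)) x).
  by apply/funext => x; exact: ind_split.
by rewrite innerDr// !ih ?addr0// ?size_rcons; lia.
Qed.

Lemma lvl_fun_cons l i (w : l.-tuple bool) b v :
  forall h : ~~ last false ((i, w), b :: v).2,
  exists j : basis_index I, [/\ val j = (i, w ++ b :: v), (l < size (val j).2)%N &
    (fun x => (lvl_fun lam A f (exist _ ((i, w), b :: v) h) x)%:C) = F j].
Proof.
move=> h; have h' : ~~ last false (i, w ++ b :: v).2 by rewrite /= last_cat.
exists (exist _ (i, w ++ b :: v) h'); split => //=.
by rewrite size_cat size_tuple/= addnS ltnS leq_addr.
Qed.

(** A finer basis function is orthogonal to all coarser ones, hence to the level l indicators by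
    [perp_cell]. For completeness, orthogonality to these indicators passes to all coarser cells by
    [perp_cell_up], and so to the coarse basis functions, which are combinations of such
    indicators. *)
Lemma lvl_onb l : @orthonormal_basis R _ (borel S) lam (lvl_index I l)
  (fun j x => (lvl_fun lam A f j x)%:C).
Proof.
have Lnil i (w : l.-tuple bool) h : L2 (fun x => (lvl_fun lam A f (exist _ ((i, w), [::]) h) x)%:C) /\
    (fun x => (lvl_fun lam A f (exist _ ((i, w), [::]) h : lvl_index I l) x)%:C) =
    (fun x => ((Num.sqrt (fine (lam (A i w))))^-1)%:C * ind (A i w) x).
  have E : (fun x => (lvl_fun lam A f (exist _ ((i, w), [::]) h : lvl_index I l) x)%:C) =
    (fun x => ((Num.sqrt (fine (lam (A i w))))^-1)%:C * ind (A i w) x).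
    by apply/funext => x; rewrite /lvl_fun/= /normalized_indic mulrC rmorphM.
  by split => //; rewrite E; exact: L2Z.
have LL (j : lvl_index I l) : L2 (fun x => (lvl_fun lam A f j x)%:C).
  case: j => -[[i w] [|b v]] h; first by case: (Lnil i w h).
  by have [j [_ _ ->]] := lvl_fun_cons h.
have mixed i (w : l.-tuple bool) h i' (w' : l.-tuple bool) b v h' :
    inner (fun x => (lvl_fun lam A f (exist _ ((i', w'), b :: v) h' : lvl_index I l) x)%:C)
      (fun x => (lvl_fun lam A f (exist _ ((i, w), [::]) h : lvl_index I l) x)%:C) = 0.
  have [j [_ lj ->]] := lvl_fun_cons h'; have [_ ->] := Lnil i w h.
  rewrite innerZr// (@perp_cell l) ?mulr0 ?size_tuple// => j' j'l.
  have [[_ oe] _] := basis_onb Hf; rewrite oe//.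
  by case: eqP => // jE; move: lj; rewrite jE ltnNge j'l.
split; first split.
- by move=> j _; exact: LL.
- move=> j j' _ _; case: j => -[[i w] [|b v]] h; case: j' => -[[i' w'] [|b' v']] h'.
  + have [_ ->] := Lnil i w h; have [_ ->] := Lnil i' w' h'.
    rewrite innerZl ?innerZr//; last exact: L2Z.
    have [e|ne] := eqVneq (i, w) (i', w').
      case: e h' => <- <- h'; rewrite inner_ind (bool_irrelevance h h') eqxx.
      rewrite -!rmorphM/=; congr (_%:C); have := lamE i w.
      move=> /[dup] lp /ltW l0; rewrite mulrA -invfM -expr2 sqr_sqrtr// mulVf// gt_eqF//.
    rewrite inner_ind0 ?size_tuple// !mulr0.
    by case: eqP => // -[e1 e2]; move: ne; rewrite e1 e2 eqxx.
  + by rewrite (inner_conj (LL _) (LL _)) mixed conjc0; case: eqP.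
  + by rewrite mixed; case: eqP.
  + have [j [jv _ ->]] := lvl_fun_cons h; have [j' [jv' _ ->]] := lvl_fun_cons h'.
    have [[_ oe] _] := basis_onb Hf; rewrite oe//; congr (_%:R); congr nat_of_bool.
    apply/eqP/eqP => [jj|[e1 e2 e3 e4]]; last first.
      apply/val_inj; rewrite jv jv' e1 e3 e4; congr (_, _ ++ _).
      by move: e2 => [->].
    apply/val_inj => /=; move: (congr1 val jj); rewrite jv jv' => -[-> /eqP].
    by rewrite eqseq_cat ?size_tuple// => /andP[/eqP/val_inj -> /eqP ->].
move=> g lg gl; case: (basis_onb Hf) => _; apply => // j.
have gcell : forall i w, (size w <= l)%N -> inner g (ind (A i w)) = 0.
  apply: perp_cell_up => // i w wl.
  have wl' : size w == l by apply/eqP.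
  have := gl (exist _ ((i, Tuple wl'), [::]) isT); have [_ ->] := Lnil i (Tuple wl') isT.
  rewrite innerZr// => /eqP; rewrite mulf_eq0 => /orP[/eqP h|/eqP//].
  have := lamE i w; rewrite -sqrtr_gt0 -invr_gt0.
  by move/(congr1 (@complex.Re R)): h => /= ->; rewrite ltxx.
case: j => -[i w] wlast; rewrite /=.
have [wl|lw] := leqP (size w) l.
  elim/last_ind : w wlast wl => [|w b _] wlast wl.
    rewrite (basis_rank1 Hf).
    have -> : (fun x => (normalized_indic lam (A i [::]) x)%:C) =
      (fun x => ((Num.sqrt (fine (lam (A i [::]))))^-1)%:C * ind (A i [::]) x) :> (S -> R[i]).
      by apply/funext => x; rewrite /normalized_indic mulrC rmorphM.
    by rewrite innerZr// gcell ?mulr0.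
  have b0 : b = false by move: wlast; rewrite /= last_rcons => /negbTE.
  rewrite b0; have [a0 [a1 [_ hE]]] := child_fun i w.
  rewrite (_ : (fun x => _) = (fun x => a0%:C * ind (A i (rcons w false)) x +
    a1%:C * ind (A i (rcons w true)) x)); last by apply/funext => x; exact: hE.
  rewrite innerDr//; [|exact: L2Z|exact: L2Z].
  by rewrite !innerZr// !gcell ?mulr0 ?addr0// size_rcons -(size_rcons w b).
have sw : size (take l w) == l by rewrite size_takel// ltnW.
have dw : drop l w = head false (drop l w) :: behead (drop l w).
  have : (0 < size (drop l w))%N by rewrite size_drop subn_gt0.
  by case: (drop l w).
have h' : ~~ last false ((i, Tuple sw), drop l w).2.
  suff -> : last false ((i, Tuple sw), drop l w).2 = last false w by [].
  by rewrite /= -[in RHS](cat_take_drop l w) last_cat; case: (drop l w) dw.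
have := gl (exist _ ((i, Tuple sw), drop l w) h').
rewrite /lvl_fun/=; case: (drop l w) dw (cat_take_drop l w) => // b v _ wE.
by rewrite wE.
Qed.

End cells.

(** * Factorial moments of the cell counts *)

(** The index [i] does not depend on [g]; thus the power boxes of cells and of label sets show
    corresponding sets at every position. *)
Lemma nth_flatten_nseq (r m : nat) (k : 'I_r -> nat) (p : 'I_m) : (\sum_i k i)%N = m ->
  exists i, forall (T : Type) (g : 'I_r -> T) (x0 : T),
    nth x0 (flatten [seq nseq (k i) (g i) | i <- enum 'I_r]) p = g i.
Proof.
move=> km; pose q := flatten [seq nseq (k i) i | i <- enum 'I_r].
have sq : size q = m.
  rewrite /q size_flatten /shape -map_comp sumnE big_map big_enum/= -km.
  by apply: eq_bigr => i _; rewrite size_nseq.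
have pq : (p < size q)%N by rewrite sq ltn_ord.
have [i0 _] : exists i0 : 'I_r, i0 \in q.
  by case: q pq {sq} => // i q' _; exists i; rewrite mem_head.
exists (nth i0 q p) => T g x0; rewrite -(nth_map i0 x0 g pq); congr nth.
rewrite /q map_flatten -map_comp; congr flatten; apply: eq_map => i /=.
by rewrite map_nseq.
Qed.

Section matching.
Variables (R : realType) (S : ptopologicalType).
Hypothesis S_hausdorff : hausdorff_space S.
Variables (lam : {measure set (borel S) -> \bar R}).
Hypothesis lam_radon : radon lam.
Variables (K : S -> S -> R[i]) (alpha : R).
Hypothesis K_alpha : kernel_assumptions lam K alpha.
Variables (I : pcountType) (A : I -> seq bool -> set S).
Hypothesis HA : nested_partitions lam A.
Variable f : I -> seq bool -> S -> R.
Hypothesis Hf : adapted_basis lam A f.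
Variable l : nat.

Lemma measurable_closed (C : set S) : closed C -> measurable (C : set (borel S)).
Proof.
move=> cC; rewrite -(setCK C); apply: measurableC.
by apply: sub_sigma_algebra; exact: closed_openC.
Qed.

Lemma cell_compact_sub i w : compact (closure (A i w)).
Proof. by rewrite -precompactE; exact: (cells_precompact HA). Qed.

Lemma cell_finite i w : (lam (A i w) < +oo)%E.
Proof.
have cC := @cell_compact_sub i w.
apply: (@le_lt_trans _ _ (lam (closure (A i w)))); last exact: (radon_compact lam_radon cC).
apply: le_measure; rewrite ?inE.
- exact: (cells_measurable HA).
- by apply: measurable_closed; exact: closed_closure.
- exact: subset_closure.
Qed.

Let cov (n : nat) : set (borel S) := oapp (fun i => A i [::]) set0 (@pickle_inv I n).

Let covT : \bigcup_n cov n = setT.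
Proof.
apply/seteqP; split => // x _.
have [i [w [/size0nil -> Ax]]] := cell_level HA 0 x.
by exists (choice.pickle i) => //; rewrite /cov pickleK_inv.
Qed.

Let covI : trivIset setT cov.
Proof.
move=> n n' _ _ [x []]; rewrite /cov.
have := @pickle_invK I n; have := @pickle_invK I n'.
case: (pickle_inv n) => [i|] //=; case: (pickle_inv n') => [i'|] //= <- <- Ax A'x.
by have [->] := cell_eq HA (erefl (size [::])) Ax A'x.
Qed.

Let mcov n : measurable (cov n).
Proof.
by rewrite /cov; case: pickle_inv => [i|] //=; exact: (cells_measurable HA).
Qed.

Lemma cells_sigma_finite : sigma_finite setT lam.
Proof.
exists cov; first by rewrite covT.
move=> n; split => //; rewrite /cov; case: pickle_inv => [i|] /=; first exact: cell_finite.
by rewrite measure0 ltry.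
Qed.

(** The generators are the cells of all levels. Two cells are nested or disjoint, so adding the
    empty set makes the family closed under intersection. *)
Let gs (n : nat) : set (borel S) :=
  if n is n'.+1 then oapp (fun p => A p.1 p.2) set0 (@pickle_inv (I * seq bool)%type n') else set0.

Let range_gs i w : range gs (A i w).
Proof.
exists (choice.pickle (i, w)).+1 => //.
by rewrite /gs pickleK_inv.
Qed.

Let gsP n : gs n = set0 \/ exists i w, gs n = A i w.
Proof.
case: n => [|n]; first by left.
rewrite /gs; case: pickle_inv => [[i w]|] /=; last by left.
by right; exists i, w.
Qed.

Let mgs n : measurable (gs n).
Proof. by case: (gsP n) => [->|[i [w ->]]] //; exact: (cells_measurable HA). Qed.

Let gsE : @measurable _ (borel S) = <<s range gs >>.
Proof.
apply/seteqP; split; last first.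
  apply: smallest_sub; last by move=> _ [n _ <-].
  exact: sigma_algebra_measurable.
rewrite -(cells_generate HA); apply: smallest_sub; first exact: smallest_sigma_algebra.
move=> B [m _]; move: B; apply: smallest_sub; first exact: smallest_sigma_algebra.
by move=> _ [[i w] _ <-]; apply: sub_sigma_algebra; exact: range_gs.
Qed.

Let gsI : setI_closed (range gs).
Proof.
have r0 : range gs set0 by exists 0%N.
move=> _ _ [n _ <-] [n' _ <-].
case: (gsP n) => [->|[i [w ->]]]; first by rewrite set0I.
case: (gsP n') => [->|[i' [w' ->]]]; first by rewrite setI0.
have [->//|/set0P[x [Ax A'x]]] := eqVneq (A i w `&` A i' w') set0.
have [ww|/ltnW ww] := leqP (size w) (size w').
  have [-> tw] := cell_below HA ww Ax A'x.
  rewrite (_ : _ `&` _ = A i' w'); first exact: range_gs.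
  by apply/setIidPr; apply: (cell_sub HA); rewrite -tw prefix_take.
have [<- tw] := cell_below HA ww A'x Ax.
rewrite (_ : _ `&` _ = A i' w); first exact: range_gs.
by apply/setIidPl; apply: (cell_sub HA); rewrite -tw prefix_take.
Qed.

Let covG n : range gs (cov n).
Proof.
rewrite /cov; case: pickle_inv => [i|] /=; first exact: range_gs.
by exists 0%N.
Qed.

Let gsfin n : (lam (gs n) < +oo)%E.
Proof.
by case: (gsP n) => [->|[i [w ->]]]; [rewrite measure0 ltry|exact: cell_finite].
Qed.

Notation X := (borel (lvl_space I l)).

Lemma measurable_lvl (B : set X) : measurable B.
Proof. by apply: sub_sigma_algebra; exact: discrete_open. Qed.

Let code : X -> nat := @choice.pickle (lvl_index I l).
Let decode : nat -> option X := @pickle_inv (lvl_index I l).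
Let codeK : pcancel code decode. Proof. exact: pickleK_inv. Qed.
Let decodeK : ocancel decode code. Proof. exact: pickle_invK. Qed.
Let cnt : {measure set X -> \bar R} := counting.

Lemma counting_lvl_sigma_finite : sigma_finite setT cnt.
Proof.
exists (fun n => if decode n is Some x then [set x] else set0).
  by apply/seteqP; split => [x _|x _]; [exists (code x); [|rewrite codeK]|].
move=> n; split; first exact: measurable_lvl.
by case: (decode n) => [x|]; rewrite ?measure0 ?counting1 ?ltry.
Qed.

Definition lvl_cell (c : I * l.-tuple bool) : set X :=
  [set j : lvl_index I l | (val j).1 = c].

Let onb := lvl_onb HA Hf cell_finite l.
Let e (j : lvl_index I l) : borel S -> R[i] := fun x => (lvl_fun lam A f j x)%:C.
Let le_e j : L2 lam (e j). Proof. by case: onb => -[+ _] _; exact. Qed.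
Let n2e j : rsqnorm lam (e j) = 1.
Proof.
have [[_ oe] _] := onb; have := oe j j Logic.I Logic.I.
by rewrite inner_self eqxx => /(congr1 (@complex.Re R)); rewrite ReC.
Qed.

Lemma lvl_supp_sub (j : lvl_index I l) : lvl_supp A j `<=` A (val j).1.1 (val j).1.2.
Proof.
case: j => -[[i w] v] h /=; rewrite /lvl_supp /=; case: v h => [|b v] h; first exact: subset_refl.
rewrite /basis_supp; apply: (cell_sub HA).
rewrite size_cat/= addnS/= take_cat ifN; first exact: prefix_prefix.
by rewrite -leqNgt leq_addr.
Qed.

Lemma lvl_fun_supp (j : lvl_index I l) x : lvl_fun lam A f j x != 0 <-> lvl_supp A j x.
Proof.
case: j => -[[i w] v] h /=; rewrite /lvl_supp/lvl_fun /=; case: v h => [|b v] h.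
  rewrite /normalized_indic indicE.
  have /negbTE s0 : Num.sqrt (fine (lam (A i w))) != 0.
    by rewrite gt_eqF// sqrtr_gt0 fine_gt0// (cells_pos HA) cell_finite.
  rewrite mulf_eq0 invr_eq0 s0 orbF; split; last by move=> /mem_set ->; exact: oner_neq0.
  by case: (boolP (x \in _)) => [/set_mem//|]; rewrite eqxx.
have h' : ~~ last false (i, w ++ b :: v).2 by rewrite /= last_cat.
by have <- := basis_support Hf (exist _ (i, tval w ++ b :: v) h').
Qed.

(** Each function of the level basis lives in a single cell of the level, so multiplication by the
    indicator of a cell is diagonal in this basis, with entries 0 and 1. *)
Lemma inner_lvl_cell (g : borel S -> R[i]) (c : I * l.-tuple bool) (j : lvl_index I l) :
  inner lam (fun x => (\1_(A c.1 c.2) x)%:C * g x) (e j) =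
  (\1_(lvl_cell c) (j : X))%:C * inner lam g (e j).
Proof.
rewrite inner_restr [\1_(lvl_cell c) _]indicE; case: (boolP ((j : X) \in lvl_cell c)) => jc.
  rewrite mul1r; congr inner; apply/funext => x; rewrite indicE.
  case: (boolP (x \in _)) => [_|xA]; first by rewrite mul1r.
  rewrite /e (_ : lvl_fun lam A f j x = 0) ?mulr0//.
  apply/eqP/negPn/negP => /(lvl_fun_supp j x).1 /lvl_supp_sub.
  by rewrite (set_mem jc); move: xA; rewrite notin_setE.
rewrite mul0r /inner (_ : (fun x => _) = fun=> 0) ?cintegral0//; apply/funext => x.
rewrite indicE; case: (boolP (x \in _)) => [xA|xA]; last by rewrite mul0r conjc0 mulr0.
rewrite mul1r /e (_ : lvl_fun lam A f j x = 0) ?conjc0 ?mulr0//.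
apply/eqP/negPn/negP => /(lvl_fun_supp j x).1 /lvl_supp_sub.
move=> Aj; move: jc; rewrite notin_setE; apply; rewrite /lvl_cell/=.
have := cell_eq HA (etrans (size_tuple _) (esym (size_tuple _))) Aj (set_mem xA).
by move: (val j).1 c {xA Aj} => [i w] [i' w']/= [-> /val_inj ->].
Qed.

Variables (r : nat) (c : 'I_r -> I * l.-tuple bool).
(** Closures are taken because the trace class property and the finiteness of [lam] are given for
    compact sets. *)
Let C : set S := \big[setU/set0]_(i < r) closure (A (c i).1 (c i).2).
Let compC : compact C.
Proof. by apply: bigsetU_compact => i _; exact: cell_compact_sub. Qed.
Let mC : measurable (C : set (borel S)).
Proof. by apply: measurable_closed; exact: compact_closed. Qed.
Let Cfin : (lam C < +oo)%E := radon_compact lam_radon compC.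
Let subC i : A (c i).1 (c i).2 `<=` C.
Proof. by rewrite /C (bigD1 i)//= => x Ax; left; exact: subset_closure. Qed.
Let lamS : {sigma_finite_measure set (borel S) -> \bar R} := sfmeasure cells_sigma_finite.
Let cntS : {sigma_finite_measure set X -> \bar R} := sfmeasure counting_lvl_sigma_finite.

Lemma cell_moments_match : exists2 D : R, 0 <= D &
  forall (k : 'I_r -> nat) (m : nat) (rho : m.-tuple (borel S) -> R)
    (rho' : m.-tuple X -> R), (\sum_i k i)%N = m ->
  measurable_fun setT rho -> measurable_fun setT rho' ->
  (forall t, (rho t)%:C = det_alpha alpha (\matrix_(i, j) K (tnth t i) (tnth t j))) ->
  (forall t, (rho' t)%:C =
     det_alpha alpha (\matrix_(i, j) lvl_kernel lam A f K (tnth t i) (tnth t j))) ->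
  exists2 z : R,
    (\int[pow_measure lam (m := m)]_(t in power_box (fun i => A (c i).1 (c i).2) k) (rho t)%:E = z%:E)%E /\
    (\int[pow_measure counting (m := m)]_(t in power_box (fun i => lvl_cell (c i)) k) (rho' t)%:E = z%:E)%E &
    `|z| <= m`!%:R * D ^+ m.
Proof.
have tc := kernel_trace_class K_alpha compC.
have [B [s [v [u [V [U H]]]]]] := @trace_class_svd _ (borel S) _ lamS K C mC tc.
have [k kcv] := kernel_sum H.
(* The indicator of [C] lies in the domain of the operator, which includes the integrability of
   almost every section against it. *)
have KC1 : {ae lam, forall x : borel S, cintegrable lam setT (restr_kernel C K x : borel S -> R[i])}.
  have [dom _] := tc; have [_ + _] := dom _ (L2_indic mC Cfin).
  apply: filterS => x; congr cintegrable; apply/funext => y.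
  by rewrite /restr_kernel [\1_C y]indicE; case: (_ \in _); rewrite ?mulr1 ?mulr0.
have mK : @cmeasurable _ _ (borel S * borel S)%type (fun p => K p.1 p.2) := kernel_measurable K_alpha.
have Kk2 := @kernel_ae_eq _ (borel S) _ lamS K C B s v u V U mC H k kcv gs gsE gsI cov covG covI covT gsfin Cfin mK KC1.
have KV (D : set (borel S)) : measurable D -> D `<=` C -> cintegrable lam D (fun x => K x x) /\
  is_trace lam (restr_kernel D K) (cintegral lam D (fun x => K x x)).
  move=> mD DC; apply: (kernel_version K_alpha) => //.
  by apply: (precompact_subset DC); rewrite precompact_closed//; exact: compact_closed.
have Kk1 := @kernel_diag_ae_eq _ (borel S) _ lamS K C B s v u V U mC H k kcv gs gsE gsI cov covG covI covT _ _ onb KV.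
have s0 := svd_s0 H; have lv := svd_lv H; have lu := svd_lu H.
(* With the same [s n], the coefficients of [v n] and [u n] in the level basis are the data of a
   decomposition on the labels; Bessel keeps their norms at most 1. *)
pose co (g : nat -> borel S -> R[i]) n (j : X) : R[i] := inner lam (g n) (e j).
have bess (g : nat -> borel S -> R[i]) n N : L2 lam (g n) ->
    \sum_(a < N) oapp (fun j => cabs (co g n j) ^+ 2) 0 (decode a) <= rsqnorm lam (g n).
  exact: (onb_bessel onb).
have coL (g : nat -> borel S -> R[i]) n : L2 lam (g n) -> rsqnorm lam (g n) <= 1 ->
    L2 cnt (co g n) /\ rsqnorm cnt (co g n) <= 1.
  move=> lg ng.
  have [_ h] := ge0_integrable_counting codeK decodeK measurable_lvl (fun j => sqr_ge0 (cabs (co g n j)))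
    (fun N => bess g n N lg).
  have lco : L2 cnt (co g n).
    split; first exact: (cmeasurable_discrete measurable_lvl).
    by rewrite sqnormE; apply: le_lt_trans h _; rewrite ltry.
  split => //; rewrite -lee_fin rsqnormK// sqnormE; apply: le_trans h _; by rewrite lee_fin.
pose v' := co v; pose u' := co u.
have lv' n : L2 cnt (v' n) by have [] := coL v n (lv n) (svd_nv H n).
have lu' n : L2 cnt (u' n) by have [] := coL u n (lu n) (svd_nu H n).
have nv' n : rsqnorm cnt (v' n) <= 1 by have [] := coL v n (lv n) (svd_nv H n).
have nu' n : rsqnorm cnt (u' n) <= 1 by have [] := coL u n (lu n) (svd_nu H n).
(* Only the empty set is null for counting measure, so the cut of [summable_cut] removes no
   label. *)
have full (D : set X) : cnt (~` D) = 0%E -> forall j, D j.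
  move=> D0 j; apply: contrapT => Dj; have : (cnt [set j] <= cnt (~` D))%E.
    by apply: le_measure; rewrite ?inE; [exact: measurable_lvl..|move=> _ ->].
  by rewrite D0 counting1 lee_fin ler10.
have [DV [V' [_ /full DVT iV' V'0 vV']]] := summable_cut s0 (svd_sB H) lv' nv'.
have [DU [U' [_ /full DUT iU' U'0 uU']]] := summable_cut s0 (svd_sB H) lu' nu'.
have {}vV' x N := vV' x N (DVT x); have {}uU' x N := uU' x N (DUT x).
pose k' (i j : X) : R[i] := cintegral (lamS \x lamS)%E setT (fun p => k p.1 p.2 * e i p.1 * e j p.2).
have conj_e j x : conjc (e j x) = e j x by rewrite /e conjc_real.
have kcv' i j : ccvg (fun N => \sum_(n < N) (s n)%:C * v' n i * conjc (u' n j)) (k' i j).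
  have := @kernel_sum_form _ _ _ lamS K C B s v u V U H k kcv (e i) (e j) (le_e i) (le_e j).
  congr ccvg; apply/funext => N; apply: eq_bigr => n _; rewrite -mulrA; congr (_ * (_ * _)).
    by congr cintegral; apply/funext => x; rewrite conj_e.
  rewrite /u' /co -(inner_conj (lu n) (le_e j)); congr cintegral; apply/funext => x.
  by rewrite mulrC.
pose CC : set X := [set j | exists i, lvl_cell (c i) j].
(* [K] and [k] are identified on [C] only; this suffices for labels of the selected cells, whose
   basis functions vanish off [C]. *)
have KK' (i j : X) : CC i -> CC j -> lvl_kernel lam A f K i j = k' i j.
  move=> [ci Ci] [cj Cj]; rewrite /lvl_kernel /k'.
  have eC (a : lvl_index I l) ca x : lvl_cell (c ca) a -> ~ C x -> e a x = 0.
    move=> Ca nC; rewrite /e (_ : lvl_fun lam A f a x = 0)//.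
    apply/eqP/negPn/negP => /(lvl_fun_supp a x).1 /lvl_supp_sub.
    by rewrite Ca => /(@subC ca).
  apply: (@cintegral_ae_eq _ _ _ (lamS \x lamS)%E).
  - apply: cmeasurableM; [apply: cmeasurableM|]; first exact: mK.
      by apply: (@cmeasurable_fst _ _ _ _ _ (e i)); case: (le_e i).
    by apply: (@cmeasurable_snd _ _ _ _ _ (e j)); case: (le_e j).
  - apply: cmeasurableM; [apply: cmeasurableM|]; first exact: (kernel_sum_cmeasurable H kcv).
      by apply: (@cmeasurable_fst _ _ _ _ _ (e i)); case: (le_e i).
    by apply: (@cmeasurable_snd _ _ _ _ _ (e j)); case: (le_e j).
  apply: filterS Kk2 => -[x y] /= h.
  have [Cx|Cx] := pselect (C x); last by rewrite -!/(e _ _) (eC _ _ _ Ci Cx) !mulr0 !mul0r.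
  have [Cy|Cy] := pselect (C y); last by rewrite -!/(e _ _) (eC _ _ _ Cj Cy) !mulr0.
  by rewrite h.
pose w := fine (\int[lam]_x ((V x + U x) / 2)%:E).
have V0 x : 0 <= V x by have := svd_vV H x 0; rewrite big_ord0.
have U0 x : 0 <= U x by have := svd_uU H x 0; rewrite big_ord0.
have w0 : 0 <= w.
  by apply/fine_ge0/integral_ge0 => x _; rewrite lee_fin divr_ge0// addr_ge0.
(* The exponent of alpha is at most m, so each of the m! permutations contributes at most max(1,
   |alpha|)^m w^m. *)
exists (Num.max 1 `|alpha| * w); first by rewrite mulr_ge0// le_max ler01.
move=> kk m rho rho' km mrho mrho' rhoE rho'E.
pose Bc (p : 'I_m) := nth set0 (flatten [seq nseq (kk i) (A (c i).1 (c i).2) | i <- enum 'I_r]) p.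
pose Bd (p : 'I_m) := nth set0 (flatten [seq nseq (kk i) (lvl_cell (c i)) | i <- enum 'I_r]) p.
have BE p : exists i, Bc p = A (c i).1 (c i).2 /\ Bd p = lvl_cell (c i).
  by have [i h] := nth_flatten_nseq p km; exists i; rewrite /Bc /Bd !h.
have mBc p : measurable (Bc p : set (borel S)).
  by have [i [-> _]] := BE p; exact: (cells_measurable HA).
have BcC p : Bc p `<=` C by have [i [-> _]] := BE p; exact: subC.
have BdC p : Bd p `<=` CC by have [i [_ ->]] := BE p => j Cj; exists i.
have [z [z1 z2] zB] := @box_det_integral _ _ _ lamS s v u V U k s0 lv lu (svd_vV H) (svd_uU H) (svd_iV H) (svd_iU H) kcv
  m Bc mBc K C alpha rho BcC Kk2 Kk1 mrho rhoE.
have [z' [z1' z2'] _] := @box_det_integral _ _ _ cntS s v' u' V' U' k' s0 lv' lu' vV' uU' iV' iU' kcv'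
  m Bd (fun p => measurable_lvl _) (lvl_kernel lam A f K) CC alpha rho' BdC
  (aeW _ (fun q h1 h2 => KK' q.1 q.2 h1 h2)) (aeW _ (fun j h => KK' j j h h)) mrho' rho'E.
(* Parseval for 1_A v_n and u_n', the indicator passing to the labels by [inner_lvl_cell]. This is
   the only place where the two spaces are compared. *)
have bi p n n' : box_inner cntS v' u' Bd p n n' = box_inner lamS v u Bc p n n'.
  have [i [Ei Ei']] := BE p; rewrite /box_inner Ei Ei'.
  have lDv := L2_restr (cells_measurable HA (c i).1 (c i).2) (lv n).
  have pv := parseval onb lDv (lu n').
  pose zz (j : X) : R[i] := (\1_(lvl_cell (c i)) j)%:C * (v' n j * conjc (u' n' j)).
  have zzE : (fun N => \sum_(a < N) oapp zz 0 (decode a)) = (fun N => \sum_(a < N)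
      oapp (fun j => inner lam (fun x => (\1_(A (c i).1 (c i).2) x)%:C * v n x) (e j) * conjc (inner lam (u n') (e j))) 0 (decode a)).
    apply/funext => N; apply: eq_bigr => a _; case: (decode a) => [j|] //=.
    by rewrite inner_lvl_cell /zz mulrA.
  have zz1 N : \sum_(a < N) oapp (cabs \o zz) 0 (decode a) <= 1.
    apply: (@le_trans _ _ (\sum_(a < N) (oapp (fun j => cabs (co v n j) ^+ 2) 0 (decode a) / 2 +
       oapp (fun j => cabs (co u n' j) ^+ 2) 0 (decode a) / 2))).
      apply: ler_sum => a _; case: (decode a) => [j|] /=; last by rewrite mul0r addr0.
      rewrite /zz 2!cabsM cabsJ.
      apply: (@le_trans _ _ (cabs (v' n j) * cabs (u' n' j))).
        by rewrite ler_piMl ?mulr_ge0 ?cabs_ge0 ?cabs_indic_le1.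
      have := sqr_ge0 (cabs (v' n j) - cabs (u' n' j)); rewrite sqrrB /v' /u'; lra.
    rewrite big_split/= -!mulr_suml.
    have := bess v n N (lv n); have := bess u n' N (lu n').
    have := svd_nv H n; have := svd_nu H n'; lra.
  have [_ zc] := cintegral_counting codeK decodeK measurable_lvl zz1.
  rewrite zzE in zc; rewrite -[LHS](ccvg_unique pv zc).
  by congr cintegral; apply/funext => x; rewrite mulrA.
have zz' : z' = z.
  have bs : box_det_sum cntS s v' u' Bd alpha = box_det_sum lamS s v u Bc alpha.
    apply/funext => N; apply: eq_bigr => sg _; congr (_ * _); apply: eq_bigr => phi _; congr (_ * _).
    by apply: eq_bigr => p _; exact: bi.
  by rewrite bs in z2'; exact: (cvg_unique _ z2' z2).
exists z; first by split; [exact: z1|rewrite -zz'; exact: z1'].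
apply: le_trans zB _.
apply: (@le_trans _ _ (\sum_(sg : 'S_m) (Num.max 1 `|alpha| * w) ^+ m)); last first.
  by rewrite sumr_const card_Sn mulr_natl.
apply: ler_sum => sg _; rewrite exprMn ler_wpM2r ?exprn_ge0//.
apply: (@le_trans _ _ (Num.max 1 `|alpha| ^+ (m - #|porbits sg|))).
  by rewrite lerXn2r ?nnegrE ?le_max ?lexx ?orbT ?ler01.
by apply: ler_weXn2l; [rewrite le_max lexx|exact: leq_subr].
Qed.

End matching.

(** * Measurability on the configuration space *)

Lemma borel_measurable_fun (R : realType) d (X : measurableType d) (g : X -> R) :
  (forall O : set R, open O -> measurable (g @^-1` O)) -> measurable_fun setT g.
Proof.
move=> h; apply: (measurability _ (RGenOInfty.measurableE R)) => _ [_ [x ->] <-].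
by rewrite setTI; apply: h; rewrite set_itvE; exact: open_gt.
Qed.

Section second_countable.
Variables (S : ptopologicalType).
Hypothesis S_second_countable : @second_countable S.

(** The basic open sets with the hereditary property P are indexed by their codes; codes without
    such a set get the empty set, which has P as well. *)
Lemma lindelof (P : set S -> Prop) (O : set S) : P set0 ->
  (forall U V, V `<=` U -> P U -> P V) ->
  (forall x, O x -> exists2 U, nbhs x U & P U) ->
  exists2 F : nat -> set S, (forall n, open (F n) /\ P (F n)) & O `<=` \bigcup_n F n.
Proof.
move=> P0 PS Pn; have [Bs /countable_injP[f finj] [Bo Bb]] := S_second_countable.
pose Q n : set (set S) := [set V | [/\ Bs V, P V & f V = n]].
exists (fun n => xget set0 (Q n)) => [n|x Ox].
  by case: xgetP => [V _ [BV PV _]|_]; [split => //; exact: Bo|split => //; exact: open0].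
have [U xU PU] := Pn x Ox; have [V [BV Vx] VU] := Bb x _ xU.
have QV : Q (f V) V by split => //; exact: PS PU.
exists (f V) => //; case: xgetP => [W _ [BW PW fW]|/(_ V)//].
by rewrite (finj W V) ?inE.
Qed.

Hypothesis S_locally_compact : locally_compact [set: S].

Lemma precompactU (U V : set S) : precompact U -> precompact V -> precompact (U `|` V).
Proof. by rewrite !precompactE closureU; exact: compactU. Qed.

Lemma precompact0 : precompact (set0 : set S).
Proof. by rewrite precompactE closure0; exact: compact0. Qed.

Lemma precompact_exhaustion : exists U : nat -> set S,
  [/\ forall n, open (U n), forall n, precompact (U n),
      {homo U : n m / (n <= m)%N >-> n `<=` m} & \bigcup_n U n = setT].
Proof.
have [||x _|F Fo FT] := @lindelof precompact setT.
- exact: precompact0.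
- by move=> U V VU; exact: precompact_subset.
- have [U xU cU] := S_locally_compact Logic.I (x := x).
  have xU' : nbhs x U by move: xU; rewrite /within /=; apply: (@filterS _ (nbhs x)) => y; exact.
  by exists U => //; exists U.
exists (fun n => \big[setU/set0]_(i < n) F i); split.
- by move=> n; apply: big_ind => [|U V|i _]; [exact: open0|exact: openU|case: (Fo i)].
- by move=> n; apply: big_ind => [|U V|i _]; [exact: precompact0|exact: precompactU|case: (Fo i)].
- move=> n m nm; exact: subset_bigsetU.
apply/seteqP; split => // x _; have [n _ Fx] := FT x Logic.I.
by exists n.+1 => //; rewrite big_ord_recr/=; right.
Qed.

End second_countable.

Lemma continuous_measurable_borel (R : realType) (T : ptopologicalType) (g : T -> R) :
  continuous g -> measurable_fun setT (g : borel T -> R).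
Proof.
move=> cg; apply: borel_measurable_fun => O oO; apply: sub_sigma_algebra.
by move/continuousP : cg; exact.
Qed.

(** * Evaluations of a configuration are vaguely measurable *)

Section config_measurable.
Variables (R : realType) (S : ptopologicalType).
Hypothesis S_hausdorff : hausdorff_space S.
Hypothesis S_locally_compact : locally_compact [set: S].
Hypothesis S_second_countable : @second_countable S.

(** Monotone approximation from below by continuous functions; for precompact O they have compact
    support, which makes s(O) a limit of vaguely continuous functions of s. *)
Lemma precompact_open_approx (O : set S) : open O -> exists h : nat -> S -> R,
  [/\ forall n, continuous (h n), forall n x, 0 <= h n x <= 1,
      forall n x, ~ O x -> h n x = 0, forall x, {homo h^~ x : n m / (n <= m)%N >-> n <= m} &
      forall x, (h n x) @[n --> \oo] --> (\1_O x : R)].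
Proof.
move=> oO.
pose P V := exists g : S -> R, [/\ continuous g, forall x, 0 <= g x <= 1,
  forall x, ~ O x -> g x = 0 & forall x, V x -> g x = 1].
have [||x Ox|F FP OF] := @lindelof S S_second_countable P O.
- by exists (fun=> 0); split => // [|x]; [exact: cst_continuous|rewrite lexx ler01].
- by move=> U V VU [g [g1 g2 g3 g4]]; exists g; split => // x /VU; exact: g4.
- have cO : closed (~` O) by rewrite closedC.
  have := @locally_compact_completely_regular S R S_locally_compact S_hausdorff x (~` O) cO (fun h => h Ox).
  move=> /uniform_separatorP => /(_ R)[g [cg g01 gx gO]].
  have gE y : 0 <= g y <= 1.
    by have := g01 (g y) (ex_intro2 _ _ y Logic.I erefl); rewrite /= in_itv.
  have gx0 : g x = 0 by apply: (gx (g x)); exists x.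
  (* The separating function is rescaled to be equal to 1 on a neighbourhood of x, namely where g <
     1/2, and not just at x. *)
  pose h := (fun=> 1) \min (fun y => 2 * (1 - g y)).
  have c2 : continuous (fun y => 2 * (1 - g y)).
    by move=> y; apply: cvgM; [exact: cvg_cst|apply: cvgB; [exact: cvg_cst|exact: cg]].
  exists [set y | g y < 2^-1].
    have oG : open [set y | g y < 2^-1].
      rewrite (_ : [set y | _] = g @^-1` [set y | y < 2^-1])//.
      by move/continuousP : cg; apply; exact: open_lt.
    by apply: open_nbhs_nbhs; split => //=; rewrite gx0 invr_gt0.
  exists h; split.
  - by apply: min_fun_continuous => //; exact: cst_continuous.
  - move=> y; rewrite /h/= le_min ler01/= ge_min lexx /= andbT.
    by have /andP[_ g1] := gE y; rewrite mulr_ge0// subr_ge0.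
  - move=> y yO; rewrite /h/= (_ : g y = 1) ?subrr ?mulr0; last by apply: (gO (g y)); exists y.
    by rewrite min_r.
  - by move=> y /= gy; rewrite /h/= min_l//; lra.
have [g gP] := choice (fun n => (FP n).2).
(* This increases with n, vanishes off O, and equals 1 as soon as some [g i] with i < n equals 1 at
   x. *)
pose h n x := 1 - \prod_(i < n) (1 - g i x).
have p01 n x : 0 <= \prod_(i < n) (1 - g i x) <= 1.
  apply/andP; split; first by apply: prodr_ge0 => i _; have [_ + _ _] := gP i => /(_ x); lra.
  by apply: prodr_ile1 => i _; have [_ + _ _] := gP i => /(_ x); lra.
have hd x : {homo h^~ x : n m / (n <= m)%N >-> n <= m}.
  apply/nondecreasing_seqP => n; rewrite /h lerB// big_ord_recr/=.
  have [_ + _ _] := gP n => /(_ x) gx; have /andP[p0 _] := p01 n x.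
  by rewrite ler_piMr//; lra.
exists h; split => //.
- move=> n x; apply: cvgB; first exact: cvg_cst.
  elim: n => [|n IH].
    by rewrite big_ord0; under eq_fun do rewrite big_ord0; exact: cvg_cst.
  rewrite big_ord_recr/=; under eq_fun do rewrite big_ord_recr/=.
  by apply: cvgM => //; apply: cvgB; [exact: cvg_cst|]; have [+ _ _ _] := gP n; exact.
- by move=> n x; have := p01 n x; rewrite /h; lra.
- move=> n x xO; rewrite /h big1 ?subrr// => i _.
  by have [_ _ /(_ _ xO) -> _] := gP i; rewrite subr0.
move=> x; rewrite indicE; case: (boolP (x \in O)) => xO; apply: cvg_near_cst; last first.
  apply: nearW => n; rewrite /h big1 ?subrr// => i _.
  by have [_ _ h3 _] := gP i; rewrite h3 ?subr0//; move: xO; rewrite notin_setE.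
have [N _ Fx] := OF x (set_mem xO).
exists N.+1 => // n /= Nn; rewrite /h (bigD1 (Ordinal Nn))//=.
by have [_ _ _ ->//] := gP N; rewrite subrr mul0r subr0.
Qed.

Lemma measurable_vague_eval (phi : Cc R S) :
  measurable_fun setT (fun s : borel (config R S) => vague_eval s phi).
Proof.
apply: continuous_measurable_borel.
have c1 : continuous (@vague_eval R S) by exact: initial_continuous.
move=> s; apply: (@continuous_comp _ _ _ (@vague_eval R S) (fun p => p phi)); first exact: c1.
exact: (@proj_continuous {classic (Cc R S)} (fun _ => R) phi (vague_eval s)).
Qed.

Lemma config_precompact_lty (s : config R S) (B : set (borel S)) :
  measurable B -> precompact (B : set S) -> (s B < +oo)%E.
Proof.
rewrite precompactE => mB cB; apply: (@le_lt_trans _ _ (s (closure (B : set S)))).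
  apply: le_measure; rewrite ?inE//; last exact: subset_closure.
  rewrite -(setCK (closure _)); apply: measurableC; apply: sub_sigma_algebra.
  by apply: closed_openC; exact: closed_closure.
exact: config_finite.
Qed.

Let measurable_open (O : set S) : open O -> measurable (O : set (borel S)).
Proof. by move=> oO; exact: sub_sigma_algebra. Qed.

Let eval (B : set (borel S)) (s : borel (config R S)) : \bar R := (s : config R S) B.

Let measurable_eval_open (O : set S) : open O -> precompact O -> measurable_fun setT (eval O).
Proof.
move=> oO cO; have mO := measurable_open oO.
have [h [hc h01 hO hn hcv]] := precompact_open_approx oO.
have supp n : compact (closure [set x | h n x != 0]).
  rewrite -precompactE; apply: precompact_subset cO => x /=.
  by apply: contra_neqP; exact: hO.
pose phi n : Cc R S := exist _ (h n) (conj (hc n) (supp n)).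
have mh n : measurable_fun setT (h n : borel S -> R) by exact: continuous_measurable_borel.
apply: (@emeasurable_fun_cvg _ _ _ _ (fun n (s : borel (config R S)) => (vague_eval s (phi n))%:E)).
  by move=> n; apply/measurable_EFinP; exact: measurable_vague_eval.
move=> s _; have h0 n x : (0 <= (h n x)%:E)%E by rewrite lee_fin; have /andP[] := h01 n x.
have sE n : (vague_eval s (phi n))%:E = (\int[(s : config R S)]_x (h n x)%:E)%E.
  rewrite /vague_eval/= fineK// ge0_fin_numE; last by apply: integral_ge0 => x _.
  apply: (@le_lt_trans _ _ (\int[(s : config R S)]_x (\1_O x)%:E)%E); last first.
    by rewrite integral_indic// setIT; exact: config_precompact_lty.
  apply: ge0_le_integral => //; first exact/measurable_EFinP.
    by apply/measurable_EFinP/measurable_indicP.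
  move=> x _; rewrite lee_fin indicE; case: (boolP (x \in O)) => xO; first by have /andP[] := h01 n x.
  by rewrite hO//; move: xO; rewrite notin_setE.
under eq_fun do rewrite sE.
have -> : eval O s = (\int[(s : config R S)]_x limn (fun n => (h n x)%:E))%E.
  transitivity (\int[(s : config R S)]_x (\1_O x)%:E)%E; first by rewrite integral_indic// setIT.
  apply: eq_integral => x _.
  by apply/esym/cvg_lim => //; apply: cvg_EFin; [exact: nearW|exact: hcv].
apply: cvg_monotone_convergence => //.
  by move=> n; exact/measurable_EFinP.
by move=> x _ n m nm; rewrite lee_fin; exact: hn.
Qed.

(** Dynkin's theorem within each precompact [U n], where configurations are finite and complements
    can be subtracted; then n tends to infinity. *)
Lemma measurable_config_eval (B : set (borel S)) : measurable B ->
  measurable_fun setT (fun s : borel (config R S) => (s : config R S) B).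
Proof.
move=> mB; have [U [oU cU ndU UT]] := precompact_exhaustion S_second_countable S_locally_compact.
have mU n := measurable_open (oU n).
have Ufin n (E : set (borel S)) (s : config R S) : measurable E -> (s (E `&` U n) < +oo)%E.
  move=> mE; apply: config_precompact_lty; first exact: measurableI.
  exact: precompact_subset (@subIsetr _ _ _) (cU n).
have loc n : forall E : set (borel S), measurable E -> measurable_fun setT (eval (E `&` U n)).
  apply: (@dynkin_induction _ (borel S) (@open S)) => //.
  - exact: openI.
  - by rewrite setTI; exact: measurable_eval_open.
  - move=> E oE; apply: measurable_eval_open; first exact: openI.
    exact: precompact_subset (@subIsetr _ _ _) (cU n).
  - move=> E mE mfE.
    rewrite (_ : eval _ = (fun s => eval (U n) s - eval (E `&` U n) s)%E).
      apply: emeasurable_funB => //; exact: measurable_eval_open.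
    apply/funext => s; rewrite /eval [X in (_ = X - _)%E](measureDI _ (mU n) mE).
    rewrite [U n `&` E]setIC addeK; last by rewrite ge0_fin_numE//; exact: Ufin.
    by congr (_ _); rewrite setDE setIC.
  - move=> F mF tF mfF.
    rewrite (_ : eval _ = (fun s => \sum_(k <oo) eval (F k `&` U n) s)%E).
      by apply: ge0_emeasurable_sum.
    apply/funext => s; rewrite /eval setI_bigcupl measure_bigcup//.
    - by apply: eq_eseriesl => k; rewrite in_setT.
    - by move=> k _; exact: measurableI.
    - exact: trivIset_setIr.
apply: (@emeasurable_fun_cvg _ _ _ _ (fun n (s : borel (config R S)) => eval (B `&` U n) s)) => [n|s _]; first exact: loc.
have BE : \bigcup_n (B `&` U n) = B by rewrite -setI_bigcupr UT setIT.
rewrite -[X in _ --> _ X]BE; apply: nondecreasing_cvg_mu.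
- by move=> n; exact: measurableI.
- by apply: bigcup_measurable => n _; exact: measurableI.
by move=> n m nm; apply/subsetPset; apply: setIS; exact: ndU.
Qed.

End config_measurable.

(** The sum counts the indices j with x j in B; infinitely many of them would push it above every
    real number. *)
Lemma esum_dirac_nat (R : realType) (T : ptopologicalType) (J : countType) (x : J -> T)
    (B : set (borel T)) :
  (\esum_(j in [set: J]) (\d_(x j : borel T) B : \bar R) < +oo)%E ->
  exists n : nat, (\esum_(j in [set: J]) (\d_(x j : borel T) B : \bar R))%E = (n%:R)%:E.
Proof.
pose D := [set j | B (x j)].
have d0 j : (0 <= (\d_(x j : borel T) B : \bar R))%E by rewrite diracE lee_fin ler0n.
have dE : (\esum_(j in [set: J]) (\d_(x j : borel T) B : \bar R) = \esum_(j in D) (1 : \bar R))%E.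
  rewrite [RHS]esum_mkcond; apply: eq_esum => j _.
  rewrite diracE; have [/set_mem Dj|Dj] := boolP (j \in D); first by rewrite mem_set.
  by rewrite memNset// => Bj; move: Dj; rewrite notin_setE.
have cardE (F : {fset J}) : (\sum_(j <- F) (1 : \bar R) = (#|` F|%:R)%:E)%E.
  by rewrite sumEFin -(natr_sum _ _ _ (fun=> 1%N)) sum1_size.
rewrite dE => fin; have finD : finite_set D.
  apply: contrapT => /infinite_set_fset infD; move: fin; rewrite ltNge; apply/negP; rewrite negbK.
  rewrite leye_eq; apply/eqP/eqyP => r r0.
  have [F FD rF] := infD (Num.truncn r).+1.
  apply: esum_ge; exists [set` F]; first by split.
  rewrite fsbig_finite//= set_fsetK cardE lee_fin.
  by apply: (@le_trans _ _ (Num.truncn r).+1%:R); rewrite ?ler_nat// ltW// truncnS_gt.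
exists #|` fset_set D|; rewrite esum_fset//.
by rewrite fsbig_finite//= cardE.
Qed.

(** * Determinacy by factorial moments *)

Section factorial_generating_function.
Variables (d : measure_display) (T : measurableType d) (R : realType).
Variables (P : {measure set T -> \bar R}) (N : T -> nat) (h : T -> R) (M E : R).
Hypothesis mN : measurable_fun setT N.
Hypothesis mh : measurable_fun setT h.
Hypothesis h0 : forall x, 0 <= h x.
Hypothesis M0 : 0 <= M.
Hypothesis E0 : 0 <= E.
Hypothesis bound : forall k, (\int[P]_x ('C(N x, k)%:R * h x)%:E <= (M * E ^+ k)%:E)%E.

(* 1/j! times the j-th derivative of t |-> E[h t^N]; the truncated exponent is
   harmless since the binomial coefficient vanishes for N < j. *)
Definition gen_fun (j : nat) (t : R) : R[i] :=
  cintegral P setT (fun x => ('C(N x, j)%:R * t ^+ (N x - j) * h x)%:C).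

Let measurable_N (f : nat -> R) : measurable_fun setT (fun x => f (N x)).
Proof. by apply: (measurableT_comp _ mN). Qed.

Let measurable_term j (t : R) : measurable_fun setT (fun x => 'C(N x, j)%:R * t ^+ (N x - j) * h x).
Proof. by apply: measurable_funM => //; exact: (measurable_N (fun n => 'C(n, j)%:R * t ^+ (n - j))). Qed.

Let integral_term j (t : R) : 0 <= t <= 1 ->
  (\int[P]_x ('C(N x, j)%:R * t ^+ (N x - j) * h x)%:E <= (M * E ^+ j)%:E)%E.
Proof.
move=> /andP[t0 t1]; apply: le_trans (bound j); apply: ge0_le_integral => //.
- by move=> x _; rewrite lee_fin !mulr_ge0 ?exprn_ge0.
- exact/measurable_EFinP.
- apply/measurable_EFinP/measurable_funM => //; exact: (measurable_N (fun n => 'C(n, j)%:R)).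
by move=> x _; rewrite lee_fin ler_wpM2r// ler_piMr// exprn_ile1.
Qed.

Let integrable_term j (t : R) : 0 <= t <= 1 ->
  cintegrable P setT (fun x => ('C(N x, j)%:R * t ^+ (N x - j) * h x)%:C).
Proof.
move=> t01; split.
  apply/integrableP; split; first by apply/measurable_EFinP; exact: measurable_term.
  under eq_integral do rewrite ReC.
  rewrite (eq_integral (fun x => ('C(N x, j)%:R * t ^+ (N x - j) * h x)%:E)).
    by apply: le_lt_trans (integral_term j t01) _; rewrite ltry.
  move=> x _; rewrite gee0_abs// lee_fin !mulr_ge0 ?exprn_ge0//.
  by case/andP: t01.
by under eq_fun do rewrite ImC; exact: integrable0.
Qed.

Lemma bin_le_exp2 n k : ('C(n, k) <= 2 ^ n)%N.
Proof.
have [kn|nk] := leqP k n; last by rewrite bin_small.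
rewrite -[2%N]/(1 + 1)%N expnDn (bigD1 (Ordinal (kn : (k < n.+1)%N)))//=.
by rewrite !exp1n !muln1 leq_addr.
Qed.

(** Newton's formula combined with C(n, j) C(n - j, k) = C(j + k, j) C(n, j + k): the Taylor
    coefficients of a normalized derivative are multiples of higher normalized derivatives. *)
Let taylor n j (t y : R) :
  'C(n, j)%:R * (t - y) ^+ (n - j) =
  \sum_(k < (n - j).+1) (- y) ^+ k * 'C(j + k, j)%:R * ('C(n, j + k)%:R * t ^+ (n - (j + k))).
Proof.
have [jn|nj] := leqP j n; last first.
  by rewrite bin_small// mul0r big1// => k _; rewrite [X in _ * (X%:R * _)]bin_small ?mul0r ?mulr0// ltn_addr.
rewrite exprDn mulr_sumr; apply: eq_bigr => k _.
have kn : (k <= n - j)%N by rewrite -ltnS.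
rewrite subnDA.
transitivity ((- y) ^+ k * t ^+ (n - j - k) * ('C(n, j) * 'C(n - j, k))%:R : R).
  by rewrite natrM -[_ *+ 'C(n - j, k)]mulr_natr; ring.
suff -> : ('C(n, j) * 'C(n - j, k) = 'C(j + k, j) * 'C(n, j + k))%N by rewrite natrM; ring.
have jkn : (j + k <= n)%N by rewrite -leq_subRL.
apply/eqP; rewrite -(eqn_pmul2r (fact_gt0 j)) -(eqn_pmul2r (fact_gt0 k)) -(eqn_pmul2r (fact_gt0 (n - (j + k)))).
apply/eqP.
have h1 := bin_fact jn; have h2 := bin_fact kn; have h3 := bin_fact (leq_addr k j).
have h4 := bin_fact jkn.
rewrite -subnDA in h2; rewrite addKn in h3.
transitivity n`!; first by rewrite -h1 -h2; ring.
by rewrite -h4 -h3; ring.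
Qed.

(** Since C(j + k, j) is at most 2^(j + k) and the binomial moments are at most M E^(j + k), the
    terms are dominated by a geometric series of ratio y (2 E); this fixes the admissible step. *)
Lemma gen_fun_taylor j (t y : R) : 0 <= t <= 1 -> 0 <= y <= t -> y * (2 * E) < 1 ->
  ccvg (fun n => \sum_(k < n) ((- y) ^+ k * 'C(j + k, j)%:R)%:C * gen_fun (j + k) t)
    (gen_fun j (t - y)).
Proof.
move=> t01 /andP[y0 yt] yE.
have [||||_] := @cintegral_series _ _ _ P
  (fun k x => ((- y) ^+ k * 'C(j + k, j)%:R)%:C * ('C(N x, j + k)%:R * t ^+ (N x - (j + k)) * h x)%:C)
  (fun x => ('C(N x, j)%:R * (t - y) ^+ (N x - j) * h x)%:C).
- move=> k; apply: cmeasurableM; first exact: cmeasurable_cst.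
  exact: (cintegrable_measurable (integrable_term (j + k) t01)).
- exact: cmeasurable_real.
- apply: aeW => x.
  (* At a fixed x the series is a finite sum, its terms vanishing once j + k exceeds N x. *)
  have E1 n : (N x - j < n)%N -> \sum_(k < n) ((- y) ^+ k * 'C(j + k, j)%:R)%:C *
      ('C(N x, j + k)%:R * t ^+ (N x - (j + k)) * h x)%:C =
      ('C(N x, j)%:R * (t - y) ^+ (N x - j) * h x)%:C.
    move=> nx; rewrite taylor mulr_suml rmorph_sum/=.
    pose F k := ((- y) ^+ k * 'C(j + k, j)%:R * ('C(N x, j + k)%:R * t ^+ (N x - (j + k))) * h x)%:C.
    rewrite -(big_mkord xpredT F) -(big_mkord xpredT (fun k => ((- y) ^+ k * 'C(j + k, j)%:R)%:C *
      ('C(N x, j + k)%:R * t ^+ (N x - (j + k)) * h x)%:C)).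
    rewrite (@big_cat_nat _ _ _ (N x - j).+1)//= [X in _ + X]big_nat_cond [X in _ + X]big1 ?addr0.
      by apply: eq_bigr => k _; rewrite /F -rmorphM/= !mulrA.
    move=> k /andP[/andP[kn _] _]; rewrite [X in _ * (X%:R * _ * _)%:C]bin_small ?mul0r ?mulr0//.
    by move: kn; clear; lia.
  split; apply: cvg_near_cst; exists (N x - j).+1 => // n /= xn; by rewrite E1.
- pose q := y * (2 * E).
  have q0 : 0 <= q by rewrite /q !mulr_ge0.
  apply: (@le_lt_trans _ _ (M * (2 * E) ^+ j / (1 - q))%:E); last by rewrite ltry.
  apply: lime_le.
    by apply: is_cvg_nneseries => n _ _; apply: integral_ge0 => x _; rewrite lee_fin cabs_ge0.
  apply: nearW => n; rewrite big_mkord.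
  apply: (@le_trans _ _ (\sum_(k < n) (M * (2 * E) ^+ j * q ^+ k)%:E)%E).
    apply: lee_sum => k _; have /cintegrableP[mi ci] := integrable_term (j + k) t01.
    under eq_integral do rewrite cabsM EFinM.
    rewrite integralZl//.
    apply: (@le_trans _ _ ((y ^+ k * 2 ^+ (j + k))%:E * (M * E ^+ (j + k))%:E)%E).
      apply: lee_pmul; rewrite ?lee_fin ?cabs_ge0//.
      - by apply: integral_ge0 => x _; rewrite lee_fin cabs_ge0.
      - rewrite cabsC normrM normrX normrN ger0_norm// ger0_norm// ler_wpM2l ?exprn_ge0//.
        by rewrite -natrX ler_nat bin_le_exp2.
      apply: le_trans (integral_term (j + k) t01); rewrite le_eqVlt; apply/orP; left.
      apply/eqP; apply: eq_integral => x _; rewrite cabsC ger0_norm// !mulr_ge0 ?exprn_ge0//.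
      by case/andP: t01.
    rewrite -EFinM lee_fin le_eqVlt; apply/orP; left; apply/eqP.
    by rewrite /q !exprMn !exprD; ring.
  rewrite sumEFin lee_fin -mulr_sumr ler_wpM2l ?mulr_ge0 ?exprn_ge0 ?mulr_ge0//.
  have q1 : 0 < 1 - q by rewrite subr_gt0.
  rewrite -(ler_pM2r q1) mulVf ?gt_eqF// mulrC -[X in X * _]opprB mulNr -subrX1 opprB.
  by rewrite gerBl exprn_ge0.
- congr ccvg; apply/funext => n; apply: eq_bigr => k _.
  by rewrite cintegralZ//; exact: integrable_term.
Qed.

Lemma gen_fun1E j : gen_fun j 1 = cintegral P setT (fun x => ('C(N x, j)%:R * h x)%:C).
Proof. by congr cintegral; apply/funext => x; rewrite expr1n mulr1. Qed.

(** As 0^0 = 1, only N = j contributes; for N < j, where the truncated exponent is 0 too, the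
    binomial coefficient vanishes. *)
Lemma gen_fun0E j : gen_fun j 0 = cintegral P setT (fun x => ((N x == j)%:R * h x)%:C).
Proof.
congr cintegral; apply/funext => x; congr (_ * _)%:C; rewrite expr0n.
have [Nj|jN|<-] := ltngtP (N x) j.
- by rewrite bin_small// mul0r.
- by rewrite subn_eq0 leqNgt jN mulr0.
- by rewrite binn subnn mulr1.
Qed.

End factorial_generating_function.

Section two_spaces.
Variables (R : realType) (d1 d2 : measure_display).
Variables (T1 : measurableType d1) (T2 : measurableType d2).
Variables (P1 : {measure set T1 -> \bar R}) (P2 : {measure set T2 -> \bar R}).

Lemma fine_cintegral_real d (T : measurableType d) (P : {measure set T -> \bar R}) (f : T -> R) (c : R) :
  measurable_fun setT f -> (forall x, 0 <= f x) -> (\int[P]_x (f x)%:E <= c%:E)%E ->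
  (\int[P]_x (f x)%:E)%E = (complex.Re (cintegral P setT (fun x => (f x)%:C)))%:E.
Proof.
move=> mf f0 fc; rewrite Re_cintegral fineK//.
rewrite ge0_fin_numE; first by apply: le_lt_trans fc _; rewrite ltry.
by apply: integral_ge0 => x _; rewrite lee_fin f0.
Qed.

(** The weights h1 and h2 need not have anything to do with N1 and N2; in [joint_law_eq] they carry
    the factors of the other counts. *)
Lemma factorial_moments_eq (N1 : T1 -> nat) (N2 : T2 -> nat) (h1 : T1 -> R) (h2 : T2 -> R) (M E : R) :
  measurable_fun setT N1 -> measurable_fun setT N2 ->
  measurable_fun setT h1 -> measurable_fun setT h2 ->
  (forall x, 0 <= h1 x) -> (forall x, 0 <= h2 x) -> 0 <= M -> 0 <= E ->
  (forall k, (\int[P1]_x ('C(N1 x, k)%:R * h1 x)%:E = \int[P2]_x ('C(N2 x, k)%:R * h2 x)%:E)%E) ->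
  (forall k, (\int[P1]_x ('C(N1 x, k)%:R * h1 x)%:E <= (M * E ^+ k)%:E)%E) ->
  forall n, (\int[P1]_x ((N1 x == n)%:R * h1 x)%:E = \int[P2]_x ((N2 x == n)%:R * h2 x)%:E)%E.
Proof.
move=> mN1 mN2 mh1 mh2 h10 h20 M0 E0 eqk b1 n.
have b2 k : (\int[P2]_x ('C(N2 x, k)%:R * h2 x)%:E <= (M * E ^+ k)%:E)%E by rewrite -eqk.
have mN (d : measure_display) (T : measurableType d) (N : T -> nat) (h : T -> R) (g : nat -> R) :
    measurable_fun setT N -> measurable_fun setT h -> measurable_fun setT (fun x => g (N x) * h x).
  by move=> mN mh; apply: measurable_funM => //; exact: (measurableT_comp (f := g) _ mN).
have e1 k : gen_fun P1 N1 h1 k 1 = gen_fun P2 N2 h2 k 1.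
  rewrite !gen_fun1E; apply: complexP; rewrite ?Im_cintegral.
    apply: EFin_inj; rewrite -(fine_cintegral_real (c := M * E ^+ k))//.
    - rewrite -(fine_cintegral_real (c := M * E ^+ k))//.
      + exact: (mN _ _ _ _ (fun n => 'C(n, k)%:R)).
      + by move=> x; rewrite mulr_ge0.
    - exact: (mN _ _ _ _ (fun n => 'C(n, k)%:R)).
    - by move=> x; rewrite mulr_ge0.
  by rewrite (eq_integral (cst 0%E)) ?integral0.
(* L exceeds 2 E, so 1 / L is an admissible step, and L such steps lead exactly from 1 to 0. *)
pose L := (Num.truncn (2 * E)).+1.
have L0 : 0 < L%:R :> R by [].
have LE : L%:R^-1 * (2 * E) < 1 by rewrite mulrC ltr_pdivrMr// mul1r; exact: truncnS_gt.
(* The derivatives of all orders k are carried along, since one expansion uses all of them at the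
   preceding point. *)
have key s : (s <= L)%N -> forall k, gen_fun P1 N1 h1 k (1 - s%:R / L%:R) = gen_fun P2 N2 h2 k (1 - s%:R / L%:R).
  elim: s => [_ k|s ih sL k]; first by rewrite mul0r subr0.
  pose u : R := s%:R / L%:R; pose y : R := L%:R^-1.
  have s1 : u + y <= 1.
    by rewrite /u /y -[X in _ + X]mul1r -mulrDl natr1 ler_pdivrMr// mul1r ler_nat.
  have p0 : 0 <= u by rewrite divr_ge0.
  have i0 : 0 <= y by rewrite invr_ge0.
  have -> : 1 - s.+1%:R / L%:R = (1 - u) - y by rewrite /u /y -natr1; ring.
  have t01 : 0 <= 1 - u <= 1 by clear -s1 p0 i0; lra.
  have y0t : 0 <= y <= 1 - u by clear -s1 p0 i0; lra.
  have := gen_fun_taylor mN1 mh1 h10 M0 E0 b1 k t01 y0t LE.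
  under eq_fun do under eq_bigr do rewrite (ih (ltnW sL)).
  move/ccvg_unique; apply.
  exact: (gen_fun_taylor mN2 mh2 h20 M0 E0 b2 k t01 y0t LE).
have := key L (leqnn _) n; rewrite mulfV ?gt_eqF// subrr !gen_fun0E => e0.
have le d (T : measurableType d) (P : {measure set T -> \bar R}) (N : T -> nat) (h : T -> R) :
    measurable_fun setT N -> measurable_fun setT h -> (forall x, 0 <= h x) ->
    (\int[P]_x ('C(N x, n)%:R * h x)%:E <= (M * E ^+ n)%:E)%E ->
    (\int[P]_x ((N x == n)%:R * h x)%:E <= (M * E ^+ n)%:E)%E.
  move=> mNN mh hh; apply: le_trans; apply: ge0_le_integral => //.
  - by move=> x _; rewrite lee_fin mulr_ge0.
  - by apply/measurable_EFinP; exact: (mN _ _ _ _ (fun m => (m == n)%:R)).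
  - by apply/measurable_EFinP; exact: (mN _ _ _ _ (fun m => 'C(m, n)%:R)).
  move=> x _; rewrite lee_fin ler_wpM2r// ler_nat.
  by case: eqP => // ->; rewrite binn.
rewrite (fine_cintegral_real (c := M * E ^+ n)) ?e0.
- rewrite -(fine_cintegral_real (c := M * E ^+ n))//.
  + exact: (mN _ _ _ _ (fun m => (m == n)%:R)).
  + by move=> x; rewrite mulr_ge0.
  + exact: le.
- exact: (mN _ _ _ _ (fun m => (m == n)%:R)).
- by move=> x; rewrite mulr_ge0.
- exact: le.
Qed.

Lemma joint_law_eq (r : nat) (N1 : 'I_r -> T1 -> nat) (N2 : 'I_r -> T2 -> nat) (E : R) :
  (forall i, measurable_fun setT (N1 i)) -> (forall i, measurable_fun setT (N2 i)) -> 0 <= E ->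
  (forall k : 'I_r -> nat, (\int[P1]_x (\prod_i 'C(N1 i x, k i)%:R)%:E =
                 \int[P2]_x (\prod_i 'C(N2 i x, k i)%:R)%:E)%E) ->
  (forall k : 'I_r -> nat, (\int[P1]_x (\prod_i 'C(N1 i x, k i)%:R)%:E <= (E ^+ (\sum_i k i))%:E)%E) ->
  forall n : 'I_r -> nat, P1 [set x | forall i, N1 i x = n i] = P2 [set x | forall i, N2 i x = n i].
Proof.
move=> mN1 mN2 E0 eqk b1 n.
(* Interpolation between moments and law: the first t coordinates carry the indicator of a value,
   the others still a binomial coefficient. At t = r the integral is the probability sought. *)
pose a (t : nat) (n : 'I_r -> nat) (i : 'I_r) (m : nat) : R :=
  if (i < t)%N then (m == n i)%:R else 'C(m, n i)%:R.
have a0 t k i m : 0 <= a t k i m by rewrite /a; case: ifP.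
have ma d (T : measurableType d) (N : 'I_r -> T -> nat) t k (p : pred 'I_r) :
    (forall i, measurable_fun setT (N i)) ->
    measurable_fun setT (fun x => \prod_(i | p i) a t k i (N i x)).
  move=> mN; under eq_fun do rewrite -big_filter.
  apply: measurable_prod => i _.
  exact: (measurableT_comp (f := a t k i) _ (mN i)).
have le1 t k : (\int[P1]_x (\prod_i a t k i (N1 i x))%:E <= (E ^+ (\sum_i k i))%:E)%E.
  apply: le_trans (b1 k); apply: ge0_le_integral => //.
  - by move=> x _; rewrite lee_fin prodr_ge0.
  - by apply/measurable_EFinP; exact: ma.
  - by apply/measurable_EFinP; have := ma _ _ N1 0%N k predT mN1.
  move=> x _; rewrite lee_fin; apply: ler_prod => i _; rewrite a0/= /a.
  by case: ifP => // _; rewrite ler_nat; case: eqP => // ->; rewrite binn.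
have claim t : (t <= r)%N -> forall k, (\int[P1]_x (\prod_i a t k i (N1 i x))%:E =
    \int[P2]_x (\prod_i a t k i (N2 i x))%:E)%E.
  elim: t => [_ k|t ih tr k]; first by have := eqk k.
  pose i0 := Ordinal tr.
  (* Varying the order m at coordinate t only yields all binomial moments of that count, with the
     remaining factors as weight. *)
  pose upd m i := if i == i0 then m else k i.
  have aS d (T : measurableType d) (N : 'I_r -> T -> nat) x :
      \prod_i a t.+1 k i (N i x) = (N i0 x == k i0)%:R * \prod_(i | i != i0) a t k i (N i x).
    rewrite (bigD1 i0)//= {1}/a ltnS leqnn; congr (_ * _); apply: eq_bigr => i ii0.
    by rewrite /a ltnS leq_eqVlt (negbTE (ii0 : val i != t)).
  have aU d (T : measurableType d) (N : 'I_r -> T -> nat) x m :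
      \prod_i a t (upd m) i (N i x) = 'C(N i0 x, m)%:R * \prod_(i | i != i0) a t k i (N i x).
    rewrite (bigD1 i0)//= {1}/a ltnn /upd eqxx; congr (_ * _); apply: eq_bigr => i ii0.
    by rewrite /a (negbTE ii0).
  under eq_integral do rewrite aS; under [RHS]eq_integral do rewrite aS.
  apply: (@factorial_moments_eq _ _ _ _ (E ^+ (\sum_(i | i != i0) k i)) E) => //.
  - exact: ma.
  - exact: ma.
  - by move=> x; rewrite prodr_ge0.
  - by move=> x; rewrite prodr_ge0.
  - by rewrite exprn_ge0.
  - move=> m; have := ih (ltnW tr) (upd m).
    by under eq_integral do rewrite aU; under [RHS]eq_integral do rewrite aU.
  - move=> m; have := le1 t (upd m); under eq_integral do rewrite aU.
    have -> : (\sum_i upd m i = \sum_(i | i != i0) k i + m)%N.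
      rewrite (bigD1 i0)//= {1}/upd eqxx addnC; congr addn.
      by apply: eq_bigr => i /negbTE ii; rewrite /upd ii.
    by rewrite exprD.
have fin d (T : measurableType d) (P : {measure set T -> \bar R}) (N : 'I_r -> T -> nat) :
    (forall i, measurable_fun setT (N i)) ->
    P [set x | forall i, N i x = n i] = (\int[P]_x (\prod_i a r n i (N i x))%:E)%E.
  move=> mN.
  have mD : measurable [set x | forall i, N i x = n i].
    rewrite (_ : [set x | _] = \bigcap_(i in setT) (N i @^-1` [set n i])).
      apply: fin_bigcap_measurable => // i _.
      by rewrite -[X in measurable X]setTI; exact: mN.
    by apply/seteqP; split => [x h i _|x h i]; exact: h.
  rewrite -[X in P X]setIT -integral_indic//; apply: eq_integral => x _.
  congr EFin; rewrite indicE; case: (boolP (x \in _)) => [/set_mem/= h|].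
    by rewrite big1// => i _; rewrite /a ltn_ord h eqxx.
  rewrite notin_setE => /existsNP[i ni]; rewrite (bigD1 i)//= /a ltn_ord.
  by case: eqP => // _; rewrite mul0r.
by rewrite !fin//; exact: claim.
Qed.

End two_spaces.

(** * Joint law of the cell counts *)

Section counts.
Variables (R : realType) (d : measure_display) (T : measurableType d).

Lemma falling_nat (n k : nat) : falling ((n%:R)%:E : \bar R) k = ((n ^_ k)%:R)%:E.
Proof.
elim: k => [|k ih]; first by rewrite /falling big_ord0.
rewrite /falling big_ord_recr/= -/(falling _ k) ih -EFinB -EFinM ffactnSr.
have [kn|nk] := leqP k n; first by rewrite natrM natrB.
by rewrite ffact_small// mul0n mul0r.
Qed.

(* junk value 0 at +oo *)
Definition count (x : \bar R) : nat := Num.truncn (fine x).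

Lemma count_nat n : count (n%:R)%:E = n.
Proof. by rewrite /count/= natrK. Qed.

Lemma emeasurable_prod n (h : 'I_n -> T -> \bar R) :
  (forall i, measurable_fun setT (h i)) -> measurable_fun setT (fun x => \prod_i h i x)%E.
Proof.
elim: n h => [|n ih] h mh.
  by under eq_fun do rewrite big_ord0; exact: measurable_cst.
under eq_fun do rewrite big_ord_recr/=.
by apply: emeasurable_funM; [exact: ih|].
Qed.

Variable g : T -> \bar R.
Hypothesis mg : measurable_fun setT g.
Hypothesis gP : forall x, (g x < +oo)%E -> exists n : nat, g x = (n%:R)%:E.

Lemma measurable_count_eq n : measurable [set x | g x = (n%:R)%:E].
Proof.
rewrite (_ : [set x | _] = g @^-1` [set (n%:R)%:E])//.
by rewrite -[X in measurable X]setTI; apply: mg.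
Qed.

Lemma measurable_count : measurable_fun setT (fun x => count (g x)).
Proof.
move=> _ Y _; rewrite setTI.
have mpinf : measurable [set x | g x = +oo%E].
  rewrite (_ : [set x | _] = g @^-1` [set +oo%E])//.
  by rewrite -[X in measurable X]setTI; apply: mg.
rewrite (_ : _ @^-1` Y = \bigcup_(n in Y) [set x | g x = (n%:R)%:E] `|`
  [set x | g x = +oo%E /\ Y 0%N]); last first.
  apply/seteqP; split => [x /= Yx|x [[n Yn /= ->]|[/= ->]]]; last 2 first.
  - by rewrite count_nat.
  - by rewrite /count/= truncn0.
  have [gy|] := eqVneq (g x) +oo%E; first by right; split => //; move: Yx; rewrite gy /count truncn0.
  rewrite -ltey => /gP[n gn]; left; exists n => //=.
  by move: Yx; rewrite gn count_nat.
apply: measurableU; first by apply: bigcup_measurable => n _; exact: measurable_count_eq.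
have [Y0|Y0] := pselect (Y 0%N); last by rewrite (_ : [set x | _] = set0)//; apply/seteqP; split => // x [].
by rewrite (_ : [set x | _] = [set x | g x = +oo%E])//; apply/seteqP; split => // x [].
Qed.

End counts.

(** A multinomial coefficient is a product of r binomial coefficients, each at most a power of 2.
    This turns the bound m! D^m on factorial moments into a geometric bound on binomial moments. *)
Lemma fact_le_prod (r : nat) (k : 'I_r -> nat) :
  ((\sum_i k i)`! <= 2 ^ (r * \sum_i k i) * \prod_i (k i)`!)%N.
Proof.
elim: r k => [|r ih] k; first by rewrite !big_ord0.
rewrite !big_ord_recl; set s := (\sum_(i < r) _)%N; set p := (\prod_(i < r) _)%N.
have h := ih (fun i => k (lift ord0 i)); rewrite -/s -/p in h.
have := bin_fact (leq_addr s (k ord0)); rewrite addKn => <-.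
apply: (@leq_trans (2 ^ (k ord0 + s) * ((k ord0)`! * (2 ^ (r * s) * p)))).
  by rewrite leq_mul ?bin_le_exp2// leq_mul.
have -> : (2 ^ (k ord0 + s) * ((k ord0)`! * (2 ^ (r * s) * p)) =
    2 ^ (k ord0 + s + r * s) * ((k ord0)`! * p))%N.
  by rewrite [(2 ^ (k ord0 + s + r * s))%N]expnD -[RHS]mulnA; congr muln; rewrite mulnCA.
by rewrite leq_mul2r leq_exp2l// mulSn leq_add2l leq_mul2l leq_addl !orbT.
Qed.

Section count_moments.
Variables (R : realType) (d : measure_display) (T : measurableType d).
Variable P : {measure set T -> \bar R}.
Variables (r : nat) (g : 'I_r -> T -> \bar R).
Hypothesis mg : forall i, measurable_fun setT (g i).
Hypothesis gP : forall i x, (g i x < +oo)%E -> exists n : nat, g i x = (n%:R)%:E.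
Hypothesis gfin : {ae P, forall x, forall i, (g i x < +oo)%E}.

Lemma factorial_moment (k : 'I_r -> nat) (z : R) :
  (\int[P]_x \prod_i falling (g i x) (k i))%E = z%:E ->
  (\int[P]_x (\prod_i 'C(count (g i x), k i)%:R)%:E)%E = (z / (\prod_i (k i)`!)%:R)%:E.
Proof.
move=> zE; have pk : (\prod_i (k i)`!)%:R != 0 :> R.
  by rewrite pnatr_eq0 -lt0n prodn_gt0// => i; exact: fact_gt0.
pose F x : R := \prod_i (count (g i x) ^_ k i)%:R.
have mF : measurable_fun setT F.
  apply: measurable_prod => i _.
  have mc := measurable_count (mg i) (@gP i).
  exact: (measurableT_comp (f := fun n : nat => (n ^_ k i)%:R : R) _ mc).
have FE : (\int[P]_x (F x)%:E)%E = z%:E.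
  rewrite -zE; apply: ae_eq_integral => //; first exact/measurable_EFinP.
    apply: emeasurable_prod => i; apply: emeasurable_prod => j.
    by apply: emeasurable_funB => //; exact: measurable_cst.
  apply: filterS gfin => x gx _; rewrite /F -prodEFin; apply: eq_bigr => i _.
  by have [n gn] := gP (gx i); rewrite gn count_nat falling_nat.
have -> : (\int[P]_x (\prod_i 'C(count (g i x), k i)%:R)%:E)%E =
    (\int[P]_x (((\prod_i (k i)`!)%:R^-1)%:E * (F x)%:E))%E.
  apply: eq_integral => x _; rewrite -EFinM; congr EFin.
  apply: (mulfI pk); rewrite mulrA mulfV// mul1r /F natr_prod -big_split/=.
  by apply: eq_bigr => i _; rewrite -natrM mulnC bin_ffact.
rewrite ge0_integralZl// ?FE -?EFinM 1?mulrC//.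
- exact/measurable_EFinP.
- by move=> x _; rewrite lee_fin prodr_ge0.
Qed.

End count_moments.

Lemma lvl_space_hausdorff (I : pcountType) l : hausdorff_space (lvl_space I l).
Proof.
rewrite open_hausdorff => x y xy; exists ([set x], [set y]).
  by split; rewrite inE.
split; [exact: discrete_open|exact: discrete_open|].
by apply/eqP/seteqP; split => // z [/= -> xy']; rewrite xy' eqxx in xy.
Qed.

Lemma lvl_space_locally_compact (I : pcountType) l : locally_compact [set: lvl_space I l].
Proof.
move=> x _; exists [set x]; last first.
  split; first exact: compact_set1.
  by rewrite -(setCK [set x]); apply: open_closedC; exact: discrete_open.
by apply: (@filterS _ (nbhs x) _ [set x]).
Qed.

Lemma lvl_space_second_countable (I : pcountType) l : @second_countable (lvl_space I l).
Proof.
exists (range (fun x : lvl_space I l => [set x])).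
  apply: card_le_trans (card_image_le _ _) _.
  exact: (@countableP (lvl_index I l)).
split; first by move=> _ [x _ <-]; exact: discrete_open.
move=> x U xU; exists [set x]; first by split => //; exists x.
by move=> _ -> /=; exact: nbhs_singleton.
Qed.

Section count_law.
Variables (R : realType) (S : ptopologicalType).
Hypothesis S_hausdorff : hausdorff_space S.
Hypothesis S_locally_compact : locally_compact [set: S].
Hypothesis S_second_countable : @second_countable S.
Variables (lam : {measure set (borel S) -> \bar R}).
Hypothesis lam_radon : radon lam.
Variables (K : S -> S -> R[i]) (alpha : R).
Hypothesis K_alpha : kernel_assumptions lam K alpha.
Variable mu : probability (borel (config R S)) R.
Hypothesis mu_det : alpha_det_process mu lam K alpha.
Variables (I : pcountType) (A : I -> seq bool -> set S).
Hypothesis HA : nested_partitions lam A.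
Variable f : I -> seq bool -> S -> R.
Hypothesis Hf : adapted_basis lam A f.
Variable l : nat.
Notation X := (lvl_space I l).
Variable nu : probability (borel (config R X)) R.
Hypothesis nu_det : alpha_det_process nu counting (lvl_kernel lam A f K) alpha.

Lemma measurable_cell_count (i : I) (w : seq bool) :
  measurable_fun setT (fun s : borel (config R S) => (s : config R S) (A i w)).
Proof.
by apply: measurable_config_eval => //; exact: (cells_measurable HA).
Qed.

Lemma measurable_lvl_count (c : I * l.-tuple bool) :
  measurable_fun setT (fun s : borel (config R X) => (s : config R X) (lvl_cell c)).
Proof.
apply: measurable_config_eval.
- exact: lvl_space_hausdorff.
- exact: lvl_space_locally_compact.
- exact: lvl_space_second_countable.
exact: measurable_lvl.
Qed.

Lemma config_nat (T : ptopologicalType) (s : config R T) (B : set (borel T)) :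
  measurable B -> (s B < +oo)%E -> exists n : nat, s B = (n%:R)%:E.
Proof.
by move=> mB; have [J [x sx]] := config_atoms s; rewrite sx//; exact: esum_dirac_nat.
Qed.

Lemma cell_count_lty (s : config R S) (i : I) (w : seq bool) : (s (A i w) < +oo)%E.
Proof.
by apply: config_precompact_lty; [exact: (cells_measurable HA)|exact: (cells_precompact HA)].
Qed.

Section cells.
Variables (r : nat) (c : 'I_r -> I * l.-tuple bool).
Hypothesis cI : injective c.
Let g1 i (s : borel (config R S)) : \bar R := (s : config R S) (A (c i).1 (c i).2).
Let g2 i (s : borel (config R X)) : \bar R := (s : config R X) (lvl_cell (c i)).

Lemma factorial_moments_match : exists2 D : R, 0 <= D & forall k : 'I_r -> nat,
  exists2 z : R, (\int[mu]_s (\prod_i falling (g1 i s) (k i)) = z%:E)%E /\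
    (\int[nu]_s (\prod_i falling (g2 i s) (k i)) = z%:E)%E &
    `|z| <= (\sum_i k i)`!%:R * D ^+ (\sum_i k i).
Proof.
have [D D0 h] := cell_moments_match S_hausdorff lam_radon K_alpha HA Hf c.
exists D => // k.
have [rho rc rE] := mu_det (\sum_i k i); have [rho' rc' rE'] := nu_det (\sum_i k i).
have [z [z1 z2] zB] := h k _ rho rho' erefl (correlation_measurable rc) (correlation_measurable rc') rE rE'.
exists z => //; split.
- rewrite -z1; apply: (correlation_moment rc) => //.
    by move=> i; exact: (cells_measurable HA).
  move=> i j _ _ [x [Ai Aj]]; apply: cI.
  have := cell_eq HA (etrans (size_tuple _) (esym (size_tuple _))) Ai Aj.
  by move: (c i) (c j) => [a w] [a' w'] /= [-> /val_inj ->].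
- rewrite -z2; apply: (correlation_moment rc') => //.
    by move=> i; exact: measurable_lvl.
  by move=> i j _ _ [x [xi xj]]; apply: cI; exact: (etrans (esym xi) xj).
Qed.

End cells.

(** Configurations on the discrete label space are only required to be finite on finite sets, while
    [lvl_cell c] is infinite. Finiteness almost everywhere follows from the first moment, which is
    that of a cell count. *)
Lemma lvl_count_lty (c : I * l.-tuple bool) :
  {ae nu, forall s : config R X, (s (lvl_cell c) < +oo)%E}.
Proof.
have [|D _ /(_ (fun=> 1%N))] := @factorial_moments_match 1 (fun=> c).
  by move=> i j _; rewrite (ord1 i) (ord1 j).
rewrite big_ord1 => -[z [_ zE] _].
have int : nu.-integrable setT (fun s : borel (config R X) => (s : config R X) (lvl_cell c)).
  apply/integrableP; split; first exact: measurable_lvl_count.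
  apply: (@le_lt_trans _ _ z%:E); last by rewrite ltry.
  rewrite -zE le_eqVlt; apply/orP; left; apply/eqP; apply: eq_integral => s _.
  by rewrite big_ord1 /falling big_ord1 sube0 gee0_abs.
have := integrable_ae measurableT int; apply: filterS => s /(_ Logic.I).
by rewrite ge0_fin_numE.
Qed.

Lemma count_law_eq (r : nat) (c : 'I_r -> I * l.-tuple bool) (n : 'I_r -> nat) : injective c ->
  mu [set s : config R S | forall i, count (s (A (c i).1 (c i).2)) = n i] =
  nu [set s : config R X | forall i, count (s (lvl_cell (c i))) = n i].
Proof.
move=> cI; have [D D0 h] := factorial_moments_match cI.
have mom := @factorial_moment R _ _.
have m1 i := measurable_cell_count (c i).1 (c i).2.
have m2 i := measurable_lvl_count (c i).
have p1 i (s : config R S) : (s (A (c i).1 (c i).2) < +oo)%E -> exists n : nat, s (A (c i).1 (c i).2) = (n%:R)%:E.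
  by apply: config_nat; exact: (cells_measurable HA).
have p2 i (s : config R X) : (s (lvl_cell (c i)) < +oo)%E -> exists n : nat, s (lvl_cell (c i)) = (n%:R)%:E.
  by apply: config_nat; exact: measurable_lvl.
have f1 : {ae mu, forall s : config R S, forall i, (s (A (c i).1 (c i).2) < +oo)%E}.
  by apply: aeW => s i; exact: cell_count_lty.
have f2 : {ae nu, forall s : config R X, forall i, (s (lvl_cell (c i)) < +oo)%E}.
  by apply: filter_forall => i; exact: lvl_count_lty.
have M1 := factorial_moment m1 p1 f1.
have M2 := factorial_moment m2 p2 f2.
(* The factor 2^r is the loss in [fact_le_prod] when m! is divided by the product of the k_i!. *)
apply: (joint_law_eq (E := 2 ^+ r * D)).
- by move=> i; exact: (measurable_count (m1 i) (@p1 i)).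
- by move=> i; exact: (measurable_count (m2 i) (@p2 i)).
- by rewrite mulr_ge0// exprn_ge0.
- by move=> k; have [z [z1 z2] _] := h k; rewrite (M1 _ _ z1) (M2 _ _ z2).
move=> k; have [z [z1 _] zB] := h k; rewrite (M1 _ _ z1) lee_fin.
have p0 : 0 < (\prod_i (k i)`!)%:R :> R.
  by rewrite ltr0n prodn_gt0// => i; exact: fact_gt0.
rewrite ler_pdivrMr//; apply: le_trans (ler_norm _) _; apply: le_trans zB _.
rewrite exprMn -exprM mulrAC ler_wpM2r ?exprn_ge0//.
by rewrite -natrX -natrM ler_nat; exact: fact_le_prod.
Qed.

End count_law.

(** * The unlabel map *)

Section ae_indicator_integral.
Variables (d : measure_display) (T : measurableType d) (R : realType).
Variable mu : {measure set T -> \bar R}.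
Import HBNNSimple.

(** Nothing is assumed on the measurability of [phi], so the integral is handled as a supremum over
    simple functions: those below [phi] are almost everywhere below the indicator of [G], and
    conversely [phi] lies above the indicator of [G] minus a null set. *)
Lemma ae_integral_indic (phi : T -> \bar R) (G : set T) :
  measurable G -> (forall x, 0 <= phi x)%E -> {ae mu, forall x, phi x = (\1_G x)%:E} ->
  (\int[mu]_x phi x = mu G)%E.
Proof.
move=> mG phi0 [N [mN N0 Ns]].
have mI : measurable_fun setT (fun x : T => (\1_G x : R)%:E).
  by apply/measurable_EFinP; exact/measurable_indicP.
have I0 (x : T) : (0 <= (\1_G x : R)%:E)%E by rewrite lee_fin.
rewrite -[G in RHS]setIT -integral_indic//; apply/eqP; rewrite eq_le; apply/andP; split.
  rewrite ge0_integralTE//; apply: ge_ereal_sup => _ [h hphi <-].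
  rewrite -[sintegral _ _](_ : (\int[mu]_x (h x)%:E = _)%E); last first.
    by rewrite integral_nnsfun// patch_setT.
  apply: ae_ge0_le_integral => //.
  - by move=> x _; rewrite lee_fin.
  - by apply/measurable_EFinP.
  exists N; split => // x /= /not_implyP[_ hI]; apply: Ns => /= phiE; apply: hI.
  by rewrite -phiE.
have mNG : measurable (G `&` ~` N) by apply: measurableI => //; exact: measurableC.
apply: (@le_trans _ _ (\int[mu]_x (\1_(G `&` ~` N) x)%:E)%E).
  rewrite !integral_indic// !setIT (measureDI mu mG mN).
  have mGN : measurable (G `&` N) by exact: measurableI.
  by rewrite (subset_measure0 mGN mN _ N0) ?adde0 ?setDE//; exact: subIsetr.
rewrite !ge0_integralTE//; apply: ereal_sup_le => _ [h hI <-]; exists h => //= x.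
apply: le_trans (hI x) _; rewrite indicE; case: (boolP (x \in _)) => [/set_mem[Gx Nx]|_//].
have -> // : phi x = 1%E.
have [//|ne] := pselect (phi x = (\1_G x)%:E); first by rewrite indicE mem_set.
by case: Nx; exact: Ns.
Qed.

End ae_indicator_integral.

Lemma esum_countable (R : realType) (J : countType) (a : J -> \bar R) : (forall j, 0 <= a j)%E ->
  (\esum_(j in [set: J]) a j = \sum_(n <oo) oapp a 0%E (@pickle_inv J n))%E.
Proof.
move=> a0; have oa0 n : (0 <= oapp a 0%E (@pickle_inv J n))%E by case: pickle_inv => /=.
rewrite nneseries_esumT//.
transitivity (\esum_(n in range (@choice.pickle J)) oapp a 0%E (@pickle_inv J n))%E.
  rewrite (@reindex_esum _ _ _ setT _ (@choice.pickle J)).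
    by apply: eq_esum => j _; rewrite pickleK_inv.
  by split => [j _|i j _ _|n [j _ <-]]; [exists j|exact: (pcan_inj pickleK_inv)|exists j].
rewrite esum_mkcond; apply: eq_esum => n _; case: ifPn => // nr.
case jn : (pickle_inv n) => [j|] //=; move: nr; rewrite notin_setE => -[]; exists j => //.
by have := @pickle_invK J n; rewrite jn.
Qed.

Section sum_of_diracs.
Variables (R : realType) (S : ptopologicalType) (J : countType).

(** As a countable series of measures this is a measure for every family x; only local finiteness
    decides whether it is a configuration. *)
Definition dirac_sum (x : J -> S) : set (borel S) -> \bar R :=
  mseries (fun n => oapp (fun j => [the measure (borel S) R of dirac (x j : borel S)]) mzero
    (@pickle_inv J n)) 0.
HB.instance Definition _ x := Measure.on (dirac_sum x).

Lemma dirac_sumE x : is_sum_dirac x (dirac_sum x).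
Proof.
move=> B mB; rewrite esum_countable; last by move=> j; rewrite diracE lee_fin.
by apply: eq_eseriesr => n _; case: pickle_inv.
Qed.

Hypothesis S_hausdorff : hausdorff_space S.
Variable U : nat -> set S.
Hypothesis oU : forall n, open (U n).
Hypothesis cU : forall n, precompact (U n).
Hypothesis ndU : {homo U : n m / (n <= m)%N >-> n `<=` m}.
Hypothesis UT : \bigcup_n U n = setT.

Lemma compact_sub_exhaustion (C : set S) : compact C -> exists n, C `<=` U n.
Proof.
rewrite compact_cover => cC; have [||F _ CF] := cC nat setT U => //.
  by move=> x _; have : setT x by []; rewrite -UT.
exists (\sum_(n <- F) n)%N => x /CF[n nF Ux]; apply: (ndU _ Ux).
by rewrite (big_rem n)//= leq_addr.
Qed.

(** Every compact set lies in some [U n], so local finiteness is a countable family of conditions;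
    this makes the domain of the unlabel map measurable. *)
Lemma config_existsP (x : J -> S) :
  (exists s : config R S, is_sum_dirac x s) <->
  forall n, (\esum_(j in [set: J]) (\d_(x j : borel S) (U n) : \bar R) < +oo)%E.
Proof.
have mU n : measurable (U n : set (borel S)) by apply: sub_sigma_algebra; exact: oU.
split => [[s sx] n|fin].
  by rewrite -sx//; exact: config_precompact_lty.
have atoms : exists (J' : countType) (y : J' -> S), is_sum_dirac y (dirac_sum x).
  by exists J, x; exact: dirac_sumE.
have finC (C : set S) : compact C -> (dirac_sum x C < +oo)%E.
  move=> cC; have [n CU] := compact_sub_exhaustion cC.
  apply: (@le_lt_trans _ _ (dirac_sum x (U n))); last by rewrite dirac_sumE.
  apply: le_measure; rewrite ?inE//.
  by apply: measurable_closed; exact: compact_closed.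
by exists (Config atoms finC); exact: dirac_sumE.
Qed.

Lemma measurable_coord (j : J) (E : set (borel S)) : measurable E ->
  measurable [set x : prod_space J S | E (x j)].
Proof. by move=> mE; apply: sub_sigma_algebra; exists j, E. Qed.

Lemma measurable_config_exists :
  measurable [set x : prod_space J S | exists s : config R S, is_sum_dirac x s].
Proof.
have mU n : measurable (U n : set (borel S)) by apply: sub_sigma_algebra; exact: oU.
rewrite (_ : [set x | _] = \bigcap_n [set x : prod_space J S |
    (\esum_(j in [set: J]) (\d_(x j : borel S) (U n) : \bar R) < +oo)%E]); last first.
  by apply/seteqP; split => [x /= /config_existsP h n _|x h /=]; [exact: h|apply/config_existsP => n; exact: h].
apply: bigcapT_measurable => n.
have mf : measurable_fun setT (fun x : prod_space J S =>
    (\esum_(j in [set: J]) (\d_(x j : borel S) (U n) : \bar R))%E).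
  pose F k (x : prod_space J S) : \bar R :=
    oapp (fun j : J => (\1_[set x : prod_space J S | (U n : set S) (x j)] x)%:E) 0%E (@pickle_inv J k).
  have F0 k x : (0 <= F k x)%E by rewrite /F; case: pickle_inv => //= j; rewrite lee_fin.
  have -> : (fun x : prod_space J S => (\esum_(j in [set: J]) (\d_(x j : borel S) (U n) : \bar R))%E) =
      (fun x => \sum_(k <oo) F k x)%E.
    apply/funext => x; rewrite esum_countable; last by move=> j; rewrite diracE lee_fin.
    apply: eq_eseriesr => k _; rewrite /F; case: pickle_inv => [j|//].
    rewrite /oapp diracE indicE.
    by have [xU|xU] := pselect ((U n : set S) (x j)); [rewrite !mem_set|rewrite !memNset].
  apply: ge0_emeasurable_sum => // k _; rewrite /F.
  case: pickle_inv => [j|] /=; last exact: measurable_cst.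
  by apply/measurable_EFinP/measurable_indicP; exact: measurable_coord.
rewrite (_ : [set x | _] = setT `&` (fun x : prod_space J S =>
    (\esum_(j in [set: J]) (\d_(x j : borel S) (U n) : \bar R))%E) @^-1` [set z | (z < +oo)%E]).
  apply: mf => //; rewrite (_ : [set z | _] = ~` [set +oo%E]); first exact: measurableC.
  by apply/seteqP; split => z; rewrite /= ltey => /eqP.
by rewrite setTI.
Qed.

End sum_of_diracs.

(** * Events as functions of all cell counts *)

Section transport.
Variables (R : realType) (S : ptopologicalType).
Hypothesis S_hausdorff : hausdorff_space S.
Hypothesis S_locally_compact : locally_compact [set: S].
Hypothesis S_second_countable : @second_countable S.
Variables (lam : {measure set (borel S) -> \bar R}).
Hypothesis lam_radon : radon lam.
Variables (K : S -> S -> R[i]) (alpha : R).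
Hypothesis K_alpha : kernel_assumptions lam K alpha.
Variable mu : probability (borel (config R S)) R.
Hypothesis mu_det : alpha_det_process mu lam K alpha.
Variables (I : pcountType) (A : I -> seq bool -> set S).
Hypothesis HA : nested_partitions lam A.
Variable f : I -> seq bool -> S -> R.
Hypothesis Hf : adapted_basis lam A f.
Variable l : nat.
Notation X := (lvl_space I l).
Variable nu : probability (borel (config R X)) R.
Hypothesis nu_det : alpha_det_process nu counting (lvl_kernel lam A f K) alpha.
Notation cell_index := (I * l.-tuple bool)%type.

(** The empty set is added because two cylinders that prescribe different values at a common cell do
    not meet. *)
Definition count_cylinders : set (set (cell_index -> nat)) :=
  [set C | C = set0 \/ exists (F : {fset cell_index}) (n : cell_index -> nat),
    C = [set g | forall c, c \in F -> g c = n c]].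
Notation count_space := (g_sigma_algebraType count_cylinders).

Lemma count_cylindersI : setI_closed count_cylinders.
Proof.
move=> C C' [->|[F [n ->]]]; first by rewrite set0I; left.
move=> [->|[F' [n' ->]]]; first by rewrite setI0; left.
have [agree|] := pselect (forall c, c \in F -> c \in F' -> n c = n' c); last first.
  move=> ne; left; apply/seteqP; split => // g [/= gn gn']; apply: ne => c cF cF'.
  by rewrite -gn// gn'.
right; exists (F `|` F')%fset, (fun c => if c \in F then n c else n' c).
apply/seteqP; split => [g [/= gn gn'] c|g /= h].
  by rewrite inE; case: ifPn => [cF _|cF /= cF']; [exact: gn|exact: gn'].
split => c cF; have := h c; rewrite inE cF ?orbT => ->//.
by case: ifPn => // cF'; exact: agree.
Qed.

Definition cell_counts (s : borel (config R S)) : count_space :=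
  fun c => count ((s : config R S) (A c.1 c.2)).

Definition lvl_counts (s : borel (config R X)) : count_space :=
  fun c => count ((s : config R X) (lvl_cell c)).

Lemma measurable_counts d (T : measurableType d) (g : T -> count_space) :
  (forall c, measurable_fun setT (fun x => g x c)) -> measurable_fun setT g.
Proof.
move=> mg; apply: (@measurability _ _ T count_space setT g count_cylinders erefl).
move=> _ [_ [->|[F [n ->]]] <-]; first by rewrite preimage_set0 setI0.
rewrite setTI (_ : _ @^-1` _ = \bigcap_(c in [set` F]) ((fun x => g x c) @^-1` [set n c])).
  apply: fin_bigcap_measurable => // c _.
  by rewrite -[X in measurable X]setTI; exact: mg.
by apply/seteqP; split => x h c; exact: h.
Qed.

Lemma measurable_cell_counts : measurable_fun setT cell_counts.
Proof.
apply: measurable_counts => c; apply: measurable_count.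
  exact: (measurable_cell_count S_hausdorff S_locally_compact S_second_countable HA).
by move=> s; apply: config_nat; exact: (cells_measurable HA).
Qed.

Lemma measurable_lvl_counts : measurable_fun setT lvl_counts.
Proof.
apply: measurable_counts => c; apply: measurable_count.
  exact: measurable_lvl_count.
by move=> s; apply: config_nat; exact: measurable_lvl.
Qed.

(** The cylinders over finitely many cells form a pi-system generating the sigma-algebra, and on
    them the laws agree by [count_law_eq]. *)
Lemma counts_law_eq (E : set count_space) : measurable E ->
  mu (cell_counts @^-1` E) = nu (lvl_counts @^-1` E).
Proof.
pose m1 : {measure set count_space -> \bar R} :=
  @measure_function_pushforward__canonical__measure_function_Measure _ _ _ _ R mu _ measurable_cell_counts.
pose m2 : {measure set count_space -> \bar R} :=
  @measure_function_pushforward__canonical__measure_function_Measure _ _ _ _ R nu _ measurable_lvl_counts.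
apply: (@measure_unique _ _ count_space count_cylinders (fun=> setT) erefl count_cylindersI _ _ m1 m2).
- by move=> _; right; exists fset0, (fun=> 0%N); apply/seteqP; split.
- by apply/seteqP; split => // x _; exists 0%N.
- move=> _ [->|[F [n ->]]]; first by rewrite !measure0.
  pose c (i : 'I_(size F)) : cell_index := tnth (in_tuple F) i.
  have cI : injective c.
    move=> i j; rewrite /c !(tnth_nth point)/= => /eqP; rewrite nth_uniq ?fset_uniq// => /eqP ij.
    exact: val_inj.
  have := count_law_eq S_hausdorff S_locally_compact S_second_countable lam_radon K_alpha mu_det HA Hf nu_det
    (fun i => n (c i)) cI.
  have cF x : x \in F -> exists i, c i = x.
    by move=> /(tnthP (in_tuple F))[i ->]; exists i.
  have Fc i : c i \in F by exact: mem_tnth.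
  rewrite /m1 /m2 /= /pushforward => h.
  transitivity (mu [set s : config R S | forall i, count (s (A (c i).1 (c i).2)) = n (c i)]).
    congr (mu _); apply/seteqP; split => s /= hs => [i|x /cF[i <-]]; [exact: (hs (c i))|exact: hs].
  rewrite h; congr (nu _); apply/seteqP; split => s /= hs => [x /cF[i <-]|i]; [exact: hs|exact: (hs (c i))].
- by move=> _; rewrite /m1/= /pushforward preimage_setT probability_setT ltry.
Qed.

Lemma cell_count_sigma_preimage (AA : set (config R S)) : cell_count_sigma A l AA ->
  exists2 E : set count_space, measurable E & AA = cell_counts @^-1` E.
Proof.
move: AA; apply: smallest_sub.
  split.
  - by exists set0 => //; rewrite preimage_set0.
  - move=> _ [E mE ->]; exists (~` E); first exact: measurableC.
    by rewrite setTD preimage_setC.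
  - move=> F FE; have h n : exists E : set count_space, measurable E /\ F n = cell_counts @^-1` E.
      by have [E mE ->] := FE n; exists E.
    have [E EP] := choice h.
    exists (\bigcup_n E n); first by apply: bigcup_measurable => n _; case: (EP n).
    by rewrite preimage_bigcup; apply: eq_bigcupr => n _; case: (EP n).
move=> _ [i [w [n ->]]]; exists [set g : count_space | g (i, w) = n].
  apply: sub_sigma_algebra; right; exists [fset (i, w)]%fset, (fun=> n).
  by apply/seteqP; split => [g /= gn c|g /= h]; [rewrite inE => /eqP ->|apply: h; rewrite inE].
apply/seteqP; split => s; rewrite /= /cell_counts/=; [by move=> ->; exact: count_nat|move=> <-].
(* Cells are precompact, so the number of points is finite and [count] does not return its default
   value. *)
have [m ->] := config_nat (cells_measurable HA i w) (cell_count_lty HA s i w).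
by rewrite count_nat.
Qed.

End transport.

Section unlabel.
Variables (R : realType) (S : ptopologicalType).
Hypothesis S_hausdorff : hausdorff_space S.
Hypothesis S_locally_compact : locally_compact [set: S].
Hypothesis S_second_countable : @second_countable S.
Variables (lam : {measure set (borel S) -> \bar R}).
Hypothesis lam_radon : radon lam.
Variables (I : pcountType) (A : I -> seq bool -> set S).
Hypothesis HA : nested_partitions lam A.
Variable f : I -> seq bool -> S -> R.
Hypothesis Hf : adapted_basis lam A f.
Variable l : nat.
Notation X := (lvl_space I l).

Lemma measurable_lvl_supp (j : lvl_index I l) : measurable (lvl_supp A j : set (borel S)).
Proof.
case: j => -[[i w] v] h; rewrite /lvl_supp/=.
by case: v {h} => [|b v]; exact: (cells_measurable HA).
Qed.

Lemma lvl_law_supp (j : lvl_index I l) : lvl_law lam A f j (lvl_supp A j) = 1%E.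
Proof.
have [[Le oe] _] := lvl_onb HA Hf (cell_finite lam_radon HA) l.
have e1 : rsqnorm lam (fun x : borel S => (lvl_fun lam A f j x)%:C) = 1.
  by have := oe j j Logic.I Logic.I; rewrite inner_self eqxx => /(congr1 (@complex.Re R)); rewrite ReC.
have := rsqnormK (Le j Logic.I); rewrite e1 => ->.
rewrite /lvl_law integral_mkcond /sqnorm; apply: eq_integral => x _.
rewrite patchE ReC ImC expr0n addr0; case: ifPn => // xj.
suff -> : lvl_fun lam A f j x = 0 by rewrite expr0n.
apply/eqP/negPn/negP => /(lvl_fun_supp lam_radon HA Hf j x).1.
by move: xj; rewrite notin_setE.
Qed.

Variables (J : countType) (lab : J -> X) (ii : config R X).
Hypothesis lab_sum : is_sum_dirac lab ii.
Variable Lam : probability (prod_space J S) R.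
Hypothesis Lam_product : is_product_law Lam (fun n => lvl_law lam A f (lab n)).
Hypothesis unlabel_defined :
  {ae Lam, forall x : J -> S, exists s : config R S, is_sum_dirac x s}.

Let supp (n : J) : set (borel S) := lvl_supp A (lab n).

Let msupp (n : J) : measurable [set x : prod_space J S | supp n (x n)].
Proof. by apply: measurable_coord; exact: measurable_lvl_supp. Qed.

Let Lam_supp1 (n : J) : Lam [set x | supp n (x n)] = 1%E.
Proof.
have := Lam_product [fset n]%fset (fun _ => measurable_lvl_supp (lab n)).
rewrite big_seq_fset1 lvl_law_supp => <-; congr (Lam _).
apply/seteqP; split => [x /= xn j|x /= h]; first by rewrite inE => /eqP ->.
by apply: h; rewrite inE.
Qed.

Lemma labels_in_supp : {ae Lam, forall x : J -> S, forall n, supp n (x n)}.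
Proof.
have h m : {ae Lam, forall x : J -> S, if @pickle_inv J m is Some n then supp n (x n) else True}.
  case: pickle_inv => [n|]; last exact: aeW.
  exists (~` [set x : prod_space J S | supp n (x n)]); split => //; first exact: measurableC.
  by rewrite probability_setC// Lam_supp1 subee.
by apply: filterS (ae_foralln h) => x hx n; have := hx (choice.pickle n); rewrite pickleK_inv.
Qed.

(** The equality holds term by term: the point with label [lab n] lies in the cell named by the
    first component of that label, and in no other cell of the level. *)
Lemma unlabel_count (x : J -> S) (s : config R S) (c : I * l.-tuple bool) :
  (forall n, supp n (x n)) -> is_sum_dirac x s -> s (A c.1 c.2) = ii (lvl_cell c).
Proof.
move=> xs sx; rewrite sx; last exact: (cells_measurable HA).
rewrite lab_sum; last exact: measurable_lvl.
apply: eq_esum => n _; rewrite !diracE; congr (_%:R)%:E; congr nat_of_bool.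
have An := lvl_supp_sub HA (xs n).
apply/idP/idP => /set_mem h; apply/mem_set.
  rewrite /lvl_cell/=; have := cell_eq HA (etrans (size_tuple _) (esym (size_tuple _))) An h.
  by move: (val (lab n)).1 c {An h} => [i w] [i' w']/= [-> /val_inj ->].
by rewrite -h.
Qed.

(** Given the labels, all cell counts are deterministic. The preimage is thus empty, or else the
    whole set [W] on which the unlabel map is defined, which has probability 1. *)
Lemma unlabel_law (E : set (I * l.-tuple bool -> nat)) :
  Lam (unlabel_preimage supp (@cell_counts R S I A l @^-1` E)) =
  (\1_(@lvl_counts R I l @^-1` E) (ii : borel (config R X)))%:E.
Proof.
have key (x : J -> S) (s : config R S) : (forall n, supp n (x n)) -> is_sum_dirac x s ->
    @cell_counts R S I A l s = lvl_counts ii.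
  by move=> xs sx; apply/funext => c; rewrite /cell_counts /lvl_counts (unlabel_count c xs sx).
have [Eii|Eii] := pselect (E (lvl_counts ii)); last first.
  rewrite indicE memNset//= (_ : unlabel_preimage _ _ = set0) ?measure0//.
  apply/seteqP; split => // x [xs [s /= Es sx]]; apply: Eii.
  by rewrite -(key x s).
rewrite indicE mem_set//.
have -> : unlabel_preimage supp (@cell_counts R S I A l @^-1` E) =
    (\bigcap_m [set x : prod_space J S | if @pickle_inv J m is Some n then supp n (x n) else True]) `&`
    [set x | exists s : config R S, is_sum_dirac x s].
  apply/seteqP; split => [x [xs [s _ sx]]|x [xs [s sx]]].
    by split; [move=> m _ /=; case: pickle_inv|exists s].
  have {}xs n : supp n (x n) by have := xs (choice.pickle n) Logic.I; rewrite /= pickleK_inv.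
  by split => //; exists s => //=; rewrite (key x s).
set W := _ `&` _.
have mW : measurable W.
  apply: measurableI; last first.
    have [U [oU cU ndU UT]] := precompact_exhaustion S_second_countable S_locally_compact.
    exact: (@measurable_config_exists R S J S_hausdorff U oU cU ndU UT).
  apply: bigcapT_measurable => m; case: pickle_inv => [n|]; first exact: msupp.
  by rewrite (_ : [set x | _] = setT)//; apply/seteqP.
have : {ae Lam, forall x, W x}.
  apply: (@filterS2 _ (almost_everywhere Lam) _ _ _ _ _ unlabel_defined labels_in_supp) => x ex xs.
  by split => // m _ /=; case: pickle_inv.
move=> [N [mN N0 Ns]].
have W0 : Lam (~` W) = 0%E by apply: (subset_measure0 _ mN Ns N0); exact: measurableC.
by have := probability_setC Lam (measurableC mW); rewrite setCK W0 sube0 => ->.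
Qed.

End unlabel.

Theorem theorem2p4 (R : realType) (S : ptopologicalType)
    (S_hausdorff : hausdorff_space S)
    (S_locally_compact : locally_compact [set: S])
    (S_second_countable : @second_countable S)
    (lam : {measure set (borel S) -> \bar R}) (lam_radon : radon lam)
    (lam_pos : forall O : set S, open O -> O !=set0 -> (0 < lam O)%E)
    (K : S -> S -> R[i]) (alpha : R) (K_alpha : kernel_assumptions lam K alpha)
    (mu : probability (borel (config R S)) R)
    (mu_det : alpha_det_process mu lam K alpha)
    (I : pcountType) (A : I -> seq bool -> set S)
    (A_partitions : nested_partitions lam A)
    (f : I -> seq bool -> S -> R) (f_basis : adapted_basis lam A f)
    (l : nat)
    (nu : probability (borel (config R (lvl_space I l))) R)
    (nu_det : alpha_det_process nu counting (lvl_kernel lam A f K) alpha)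
    (J : config R (lvl_space I l) -> countType)
    (lab : forall ii, J ii -> lvl_space I l)
    (lab_sum : forall ii, is_sum_dirac (lab ii) ii)
    (Lam : forall ii, probability (prod_space (J ii) S) R)
    (Lam_product : forall ii,
      is_product_law (Lam ii) (fun n => lvl_law lam A f (lab ii n)))
    (unlabel_defined : {ae nu, forall ii, {ae Lam ii, forall x : J ii -> S,
      exists s : config R S, is_sum_dirac x s}})
    (AA : set (config R S)) (AA_measurable : cell_count_sigma A l AA) :
  mu AA = (\int[nu]_ii Lam ii
    (unlabel_preimage (fun n => lvl_supp A (lab ii n)) AA))%E.
Proof.
have [E mE ->] := cell_count_sigma_preimage A_partitions AA_measurable.
rewrite (counts_law_eq S_hausdorff S_locally_compact S_second_countable lam_radon K_alpha mu_det
  A_partitions f_basis nu_det mE).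
(* For almost every [ii] the inner probability is 0 or 1, so the right side is the [nu]-probability
   of an event. *)
apply/esym/ae_integral_indic => //.
  by rewrite -[X in measurable X]setTI; apply: measurable_lvl_counts.
apply: (@filterS _ (almost_everywhere nu) _ _ _ _ unlabel_defined) => ii ud.
exact: (unlabel_law S_hausdorff S_locally_compact S_second_countable lam_radon A_partitions f_basis
  (lab_sum ii) (Lam_product ii) ud E).
Qed.
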